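(* Let $X_1,X_2,\dots$ be i.i.d. with $\mathbf{E}X_1=-a<0$ and $\mathrm{Var}(X_1)<\infty$. Assume $\overline F(x)\sim e^{-g(x)}x^{-2}$ as $x\to\infty$, where $g:(0,\infty)\to\mathbb{R}$ is continuously differentiable, nondecreasing for all sufficiently large $x$, and such that $x\mapsto g(x)/x$ is nonincreasing on $(0,\infty)$ with $g(x)/x\to0$. Then: (i) there exists a constant $C>0$ such that for all sufficiently large $x$, \[ \mathbf{P}(A_\tau>x)\le Cx^{1/4}\exp\left\{-g(\sqrt{2ax})\sqrt{1-\frac{2Cg(\sqrt{2ax})}{a\sqrt{2ax}}}\right\}; \] (ii) for every $\varepsilon>0$ there exists $C>0$ such that \[ \liminf_{x\to\infty}\frac{\mathbf{P}(A_\tau>x)}{\overline F(\sqrt{2ax}+Cx^{1/4+\varepsilon})}\ge\mathbf{E}\tau; \] (iii) if moreover there is $\gamma_0\in(0,1)$ such that $x\mapsto g(x)/x^{\gamma_0}$ is nonincreasing on $(0,\infty)$ with $g(x)/x^{\gamma_0}\to0$, then \[ \lim_{x\to\infty}\frac{\ln\mathbf{P}(A_\tau>x)}{\ln\overline F(\sqrt{2ax})}=1. \]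
   Context: $S_0=0$, $S_n=X_1+\dots+X_n$, $\overline F(x)=\mathbf{P}(X_1>x)$, $\tau=\min\{n\ge1:S_n\le0\}$, $A_\tau=\sum_{k=0}^{\tau-1}S_k$. *)

(* Defs.v *)
From HB Require Import structures.
From mathcomp Require Import all_boot all_order all_algebra.
From mathcomp Require Import all_classical all_reals all_analysis.
Set Implicit Arguments. Unset Strict Implicit. Unset Printing Implicit Defensive.
Import Order.TTheory GRing.Theory Num.Theory.
Import numFieldNormedType.Exports.
Local Open Scope classical_set_scope.
Local Open Scope ring_scope.

Section Defs.
Context {d : measure_display} {T : measurableType d} {R : realType}.
Variable (P : probability T R).

(* X i is the (i+1)-th summand X_{i+1} of the paper. *)

Definition mutually_independent (X : nat -> {RV P >-> R}) : Prop :=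
  forall (I : seq nat) (B : nat -> set R), uniq I ->
    (forall i, measurable (B i)) ->
    P (\bigcap_(i in [set` I]) (X i @^-1` B i)) = (\prod_(i <- I) P (X i @^-1` B i))%E.

Definition identically_distributed (X : nat -> {RV P >-> R}) : Prop :=
  forall n (B : set R), measurable B -> distribution P (X n) B = distribution P (X 0) B.

Definition iid (X : nat -> {RV P >-> R}) : Prop :=
  mutually_independent X /\ identically_distributed X.

Definition Ssum (X : nat -> {RV P >-> R}) (n : nat) (w : T) : R :=
  \sum_(i < n) X i w.

Definition Fbar (X : nat -> {RV P >-> R}) (x : R) : R :=
  fine (P [set w | x < X 0 w]).

Definition tau_opt (X : nat -> {RV P >-> R}) (w : T) : option nat :=
  match pselect (exists n, (1 <= n)%N && (Ssum X n w <= 0)) with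
  | left h => Some (ex_minn h)
  | right _ => None
  end.

Definition tau (X : nat -> {RV P >-> R}) (w : T) : \bar R :=
  if tau_opt X w is Some n then (n%:R)%:E else +oo%E.

Definition Atau (X : nat -> {RV P >-> R}) (w : T) : \bar R :=
  if tau_opt X w is Some n then (\sum_(k < n) Ssum X k w)%:E else +oo%E.

Definition PAtau_gt (X : nat -> {RV P >-> R}) (x : R) : R :=
  fine (P [set w | (x%:E < Atau X w)%E]).

Definition Etau (X : nat -> {RV P >-> R}) : \bar R := (\int[P]_w tau X w)%E.

End Defs.

(* Main.v *)
(* The quantity 2 a A + S^2, where S is the height and A the area swept so far, is invariant
   along the fluid path of slope -a, and A_tau > x forces H = sqrt (2 a A + (S + k)^2) to
   reach y = sqrt (2 a x).  For a shift k large enough to absorb second moments, exp (h H) is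
   a supermartingale as long as the jumps stay below a level v with h u <= g u + O(1) on
   [1/h, v].  Hence H reaches y either with probability at most exp (- h (y - k)) or through
   a big jump; the number of steps before tau, whose mean is bounded by means of a linear
   Lyapunov function, controls the probability of the latter.  The tilt h = (g y + 1) / y
   yields (i); a finer tilt at level y / 6, used when g y <= y^(1/4), yields the upper half
   of (iii), where the factor y^-2 matters.  For the lower bounds, a jump above y + K before
   tau produces an area above x unless the centred walk deviates by K within y / a steps,
   which Kolmogorov's inequality makes unlikely. *)
Require Import Defs.
From HB Require Import structures.
From mathcomp Require Import all_boot all_order all_algebra.
From mathcomp Require Import all_classical all_reals all_analysis.
From mathcomp Require Import measurable_realfun.
From mathcomp Require Import ring lra.
Import Order.TTheory GRing.Theory Num.Theory.
Import numFieldNormedType.Exports.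
Local Open Scope classical_set_scope.
Local Open Scope ring_scope.
Set Implicit Arguments. Unset Strict Implicit. Unset Printing Implicit Defensive.

(** * Conditioning on the past of the walk *)

Definition cylinders {d : measure_display} {T : measurableType d} {R : realType}
  (P : probability T R) (X : nat -> {RV P >-> R}) (k : nat) : set (set T) :=
  [set G | exists B : nat -> set R, (forall i, measurable (B i)) /\
     G = \bigcap_(i in [set i | (i < k)%N]) (X i @^-1` B i)].

Notation past X k := (g_sigma_algebraType (cylinders X k)).

Section Filtration.
Context {d : measure_display} {T : measurableType d} {R : realType}.
Variables (P : probability T R) (X : nat -> {RV P >-> R}).

Lemma measurable_cylinder k G : cylinders X k G -> measurable G.
Proof.
by move=> [B [mB ->]]; apply: bigcap_measurableType => i _; exact: measurable_funPTI.
Qed.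

Lemma cylindersI k : setI_closed (cylinders X k).
Proof.
move=> _ _ [B [mB ->]] [C [mC ->]]; exists (fun i => B i `&` C i); split.
  by move=> i; exact: measurableI.
apply/seteqP; split=> w /=.
  by move=> [hB hC] i ik; split; [exact: hB|exact: hC].
by move=> h; split=> i ik; have [] := h i ik.
Qed.

Lemma cylindersT k : cylinders X k setT.
Proof.
exists (fun=> setT); split=> //.
by apply/seteqP; split.
Qed.

Lemma past_measurable k (G : set T) : measurable (G : set (past X k)) -> measurable G.
Proof.
apply: smallest_sub; first exact: sigma_algebra_measurable.
by move=> A; exact: measurable_cylinder.
Qed.

Lemma cylindersS k : cylinders X k `<=` cylinders X k.+1.
Proof.
move=> _ [B [mB ->]].
exists (fun i => if (i < k)%N then B i else setT); split.
  by move=> i; case: ifP.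
apply/seteqP; split=> w /= h i ik; last first.
  by have := h i; rewrite ik; apply; exact: ltnW.
by case: ifP => // ik'; exact: h.
Qed.

Lemma past_measurableS k (G : set T) :
  measurable (G : set (past X k)) -> measurable (G : set (past X k.+1)).
Proof.
apply: smallest_sub; first exact: sigma_algebra_measurable.
by move=> A /cylindersS; exact: sub_sigma_algebra.
Qed.

Lemma measurable_id_past k : measurable_fun setT (idfun : T -> past X k).
Proof. by move=> _ A mA; rewrite setTI; exact: (past_measurable mA). Qed.

Lemma past_measurable_fun k d' (U : measurableType d') (f : T -> U) :
  measurable_fun setT (f : past X k -> U) -> measurable_fun setT f.
Proof. by move=> mf _ A mA; apply: past_measurable; exact: mf. Qed.

Lemma past_measurable_X k i : (i < k)%N -> measurable_fun setT (X i : past X k -> R).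
Proof.
move=> ik _ A mA; rewrite setTI; apply: sub_sigma_algebra.
exists (fun j => if j == i then A else setT); split.
  by move=> j; case: ifP.
apply/seteqP; split=> w /=.
  by move=> Aw j _; case: eqP => // ->.
by move=> /(_ i); rewrite eqxx; exact.
Qed.

Hypothesis indepX : iid X.

Lemma past_indep k (G : set T) (B : set R) : measurable (G : set (past X k)) ->
  measurable B -> P (G `&` X k @^-1` B) = (P G * P (X k @^-1` B))%E.
Proof.
move=> mG mB.
have mXB : measurable (X k @^-1` B) by exact: measurable_funPTI.
have PB0 : (0 <= fine (P (X k @^-1` B)))%R by exact: fine_ge0.
have PBE : P (X k @^-1` B) = (fine (P (X k @^-1` B)))%:E.
  by rewrite fineK// fin_num_measure.
pose m2 : {measure set T -> \bar R} := mscale (NngNum PB0) P.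
pose m1 : {measure set T -> \bar R} := mrestr P mXB.
have -> : P (G `&` X k @^-1` B) = m1 G by [].
have -> : (P G * P (X k @^-1` B))%E = m2 G by rewrite /m2/= /mscale/= -PBE muleC.
apply: (g_sigma_algebra_measure_unique (cylinders X k) _ (fun=> setT)) => //.
- by move=> A; exact: measurable_cylinder.
- by move=> _; exact: cylindersT.
- by apply/seteqP; split=> // x _; exists 0%N.
- exact: cylindersI.
- move=> _ [C [mC ->]]; rewrite /m1 /m2 /= /mrestr /mscale /= -PBE.
  pose C' i := if i == k then B else C i.
  have mC' i : measurable (C' i) by rewrite /C'; case: ifP.
  have CE i : (i < k)%N -> C' i = C i by rewrite /C' => ik; rewrite ltn_eqF.
  have iotaE n (D : nat -> set T) : \bigcap_(i in [set` iota 0 n]) D i =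
      \bigcap_(i in [set i | (i < n)%N]) D i.
    by apply: eq_bigcapl; split=> i /=; rewrite mem_iota.
  have := indepX.1 _ C' (iota_uniq 0 k.+1) mC'.
  have C'k : C' k = B by rewrite /C' eqxx.
  rewrite iotaE -{2}addn1 iotaD add0n big_cat big_seq1 C'k /=.
  have -> : (\prod_(i <- iota 0 k) P (X i @^-1` C' i) =
            P (\bigcap_(i in [set i | (i < k)%N]) (X i @^-1` C i)))%E.
    rewrite -iotaE (indepX.1 _ _ (iota_uniq 0 k) mC).
    by apply: eq_big_seq => i; rewrite mem_iota => /CE ->.
  rewrite muleC => <-; congr (P _).
  apply/seteqP; split=> w /=.
    move=> [h Bw] i /=; rewrite ltnS leq_eqVlt => /orP[/eqP ->|ik].
      by rewrite C'k.
    by rewrite CE//; exact: h.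
  move=> h; split.
    by move=> i ik; rewrite -CE//; apply: h => /=; exact: ltnW.
  by have := h k; rewrite C'k; apply => /=.
- by move=> _; rewrite /m1/= /mrestr setTI (le_lt_trans (probability_le1 _ _))// ltry.
Qed.

Local Notation mu := (distribution P (X 0%N)).

HB.instance Definition _ k := isMeasurableFun.Build _ _ _ _ (idfun : T -> past X k)
  (@measurable_id_past k).

Lemma integral_past_step k (f : past X k * R -> \bar R) :
  measurable_fun setT f -> (forall z, 0 <= f z)%E ->
  (\int[P]_w f (w : past X k, X k w) = \int[P]_w \int[mu]_u f (w : past X k, u))%E.
Proof.
move=> mf f0.
pose idX : {mfun T >-> past X k} := (idfun : T -> past X k).
pose pm := distribution P idX.
have mJ : measurable_fun setT (fun w : T => (w : past X k, X k w)).
  apply: measurable_fun_pair; [exact: measurable_id_past|exact: measurable_funP].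
pose Jm := isMeasurableFun.Build _ _ _ _ _ mJ.
pose J : {mfun T >-> (past X k * R)%type} := HB.pack (fun w : T => (w : past X k, X k w)) Jm.
have -> : (\int[P]_w f (w : past X k, X k w) = \int[distribution P J]_z f z)%E.
  by rewrite ge0_integral_distribution.
have -> : (\int[distribution P J]_z f z = \int[pm \x mu]_z f z)%E.
  apply: eq_measure_integral => A mA _; apply/esym/product_measure_unique => //.
  move=> G B mG mB; rewrite /pm /distribution /pushforward.
  rewrite [LHS](_ : _ = P (G `&` X k @^-1` B))// past_indep//; congr (_ * _)%E.
  by have := indepX.2 k _ mB.
rewrite fubini_tonelli1// /fubini_F /pm ge0_integral_distribution//.
  exact: measurable_fun_fubini_tonelli_F f mf f0.
by move=> z; apply: integral_ge0 => u _.
Qed.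

Lemma integral_past_step_on k d' (U : measurableType d') (Y : T -> U) (G : set T)
    (f : U * R -> \bar R) :
  measurable (G : set (past X k)) -> measurable_fun setT (Y : past X k -> U) ->
  measurable_fun setT f -> (forall z, 0 <= f z)%E ->
  (\int[P]_(w in G) f (Y w, X k w) = \int[P]_(w in G) \int[mu]_u f (Y w, u))%E.
Proof.
move=> mG mY mf f0.
have mG' := past_measurable mG.
pose h (z : past X k * R) := ((\1_(G : set (past X k)) z.1)%:E * f (Y z.1, z.2))%E.
have mh : measurable_fun setT h.
  apply: emeasurable_funM.
    by apply/measurable_EFinP; apply: measurableT_comp => //; exact: measurable_indic.
  apply: measurableT_comp mf _ => //; apply: measurable_fun_pair => //.
  exact: measurableT_comp.
have h0 z : (0 <= h z)%E by rewrite /h mule_ge0// lee_fin.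
have hE w u : h (w, u) = ((fun w => f (Y w, u)) \_ G) w.
  rewrite /h /= patchE indicE; case: (w \in G); by rewrite ?mul1e ?mul0e.
rewrite [LHS]integral_mkcond [RHS]integral_mkcond.
transitivity (\int[P]_w h (w : past X k, X k w))%E.
  apply: eq_integral => w _; rewrite hE; by rewrite !patchE.
rewrite integral_past_step//; apply: eq_integral => w _.
rewrite patchE; case: ifPn => wG.
  by apply: eq_integral => u _; rewrite hE patchE wG.
by rewrite integral0_eq// => u _; rewrite hE patchE (negbTE wG).
Qed.

Lemma le_integral_past_step k d' (U : measurableType d') (Y : T -> U) (G : set T)
    (f : U * R -> \bar R) (v : T -> \bar R) :
  measurable (G : set (past X k)) -> measurable_fun setT (Y : past X k -> U) ->
  measurable_fun setT f -> (forall z, 0 <= f z)%E ->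
  measurable_fun setT v ->
  (forall w, G w -> \int[mu]_u f (Y w, u) <= v w)%E ->
  (\int[P]_(w in G) f (Y w, X k w) <= \int[P]_(w in G) v w)%E.
Proof.
move=> mG mY mf f0 mv fv.
have mG' := past_measurable mG.
rewrite (integral_past_step_on mG mY)//.
have I0 w : (0 <= \int[mu]_u f (Y w, u))%E by apply: integral_ge0 => u _.
apply: ge0_le_integral => //.
- have mF := measurable_fun_fubini_tonelli_F (m2 := mu) f mf f0.
  apply: measurable_funTS; apply: (past_measurable_fun (k := k)).
  exact: (measurableT_comp mF mY).
- exact: measurable_funTS.
Qed.

Lemma potential_step k d' (U : measurableType d') (Y : T -> U) (G G' H : set T)
    (f : U * R -> R) (V V1 V2 : T -> R) :
  measurable (G : set (past X k)) -> measurable G' -> measurable H ->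
  G' `<=` G -> H `<=` G ->
  measurable_fun setT (Y : past X k -> U) ->
  measurable_fun setT f -> (forall z, 0 <= f z) ->
  measurable_fun setT V -> measurable_fun setT V1 -> measurable_fun setT V2 ->
  (forall w, G' w -> 0 <= V1 w) -> (forall w, H w -> 0 <= V2 w) ->
  (forall w, G w -> \int[mu]_u (f (Y w, u))%:E <= (V w)%:E)%E ->
  (forall w, G w -> (V1 \_ G') w + (V2 \_ H) w <= f (Y w, X k w)) ->
  (\int[P]_(w in G') (V1 w)%:E + \int[P]_(w in H) (V2 w)%:E
     <= \int[P]_(w in G) (V w)%:E)%E.
Proof.
move=> mG mG' mH G'G HG mY mf f0 mV mV1 mV2 V10 V20 fV Vf.
have mG0 := past_measurable mG.
have m1 : measurable_fun setT (fun w => ((V1 \_ G') w)%:E).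
  by apply/measurable_EFinP/(measurable_restrictT V1 mG'); exact: measurable_funTS.
have m2 : measurable_fun setT (fun w => ((V2 \_ H) w)%:E).
  by apply/measurable_EFinP/(measurable_restrictT V2 mH); exact: measurable_funTS.
have p1 w : (0 <= ((V1 \_ G') w)%:E)%E.
  by rewrite lee_fin patchE; case: ifPn => // /[!inE] /V10.
have p2 w : (0 <= ((V2 \_ H) w)%:E)%E.
  by rewrite lee_fin patchE; case: ifPn => // /[!inE] /V20.
have toG (D : set T) (W : T -> R) : D `<=` G ->
    (\int[P]_(w in D) (W w)%:E = \int[P]_(w in G) ((W \_ D) w)%:E)%E.
  move=> DG; rewrite integral_mkcond [RHS]integral_mkcond.
  apply: eq_integral => w _; rewrite !patchE.
  case: ifPn => [/[!inE] Dw|_]; last by case: ifP.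
  by rewrite (mem_set (DG _ Dw)).
rewrite (toG _ _ G'G) (toG _ _ HG) -ge0_integralD//=; last 2 first.
  exact: measurable_funTS.
  exact: measurable_funTS.
apply: (@le_trans _ _ (\int[P]_(w in G) (f (Y w, X k w))%:E)%E).
  apply: ge0_le_integral => //.
  - by move=> w Gw; rewrite adde_ge0.
  - by apply: measurable_funTS; exact: emeasurable_funD.
  - apply: measurable_funTS; apply/measurable_EFinP.
    apply: (measurableT_comp mf); apply: measurable_fun_pair.
      exact: past_measurable_fun mY.
    exact: measurable_funP.
apply: (le_integral_past_step (f := fun z => (f z)%:E) mG mY) => //.
- exact/measurable_EFinP.
- exact/measurable_EFinP.
Qed.

End Filtration.

(** * The walk and its excursion *)

Section Walk.
Context {d : measure_display} {T : measurableType d} {R : realType}.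
Variables (P : probability T R) (X : nat -> {RV P >-> R}).

Definition area (n : nat) (w : T) : R := \sum_(k < n) Ssum X k w.

Definition positive_until (k : nat) : set T :=
  [set w | forall i, (0 < i <= k)%N -> 0 < Ssum X i w].

Lemma Ssum0 w : Ssum X 0 w = 0.
Proof. by rewrite /Ssum big_ord0. Qed.

Lemma SsumS k w : Ssum X k.+1 w = Ssum X k w + X k w.
Proof. by rewrite /Ssum big_ord_recr. Qed.

Lemma area0 w : area 0 w = 0.
Proof. by rewrite /area big_ord0. Qed.

Lemma areaS k w : area k.+1 w = area k w + Ssum X k w.
Proof. by rewrite /area big_ord_recr. Qed.

Lemma measurable_Ssum k n : (k <= n)%N -> measurable_fun setT (Ssum X k : past X n -> R).
Proof.
elim: k => [|k IH] kn.
  by rewrite (_ : Ssum X 0 = cst 0)//; apply/funext => w; rewrite Ssum0.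
rewrite (_ : Ssum X k.+1 = fun w : past X n => Ssum X k w + X k w); last first.
  by apply/funext => w; rewrite SsumS.
apply: measurable_funD; first exact: IH (ltnW kn).
exact: past_measurable_X.
Qed.

Lemma measurable_area k n : (k <= n.+1)%N -> measurable_fun setT (area k : past X n -> R).
Proof.
elim: k => [|k IH] kn.
  by rewrite (_ : area 0 = cst 0)//; apply/funext => w; rewrite area0.
rewrite (_ : area k.+1 = fun w : past X n => area k w + Ssum X k w); last first.
  by apply/funext => w; rewrite areaS.
apply: measurable_funD; first exact: IH (ltnW kn).
exact: measurable_Ssum.
Qed.

Lemma positive_untilS k : positive_until k.+1 =
  positive_until k `&` [set w | 0 < Ssum X k.+1 w].
Proof.
apply/seteqP; split=> w /=.
  move=> h; split; last by apply: h; rewrite leqnn.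
  by move=> i /andP[i0 ik]; apply: h; rewrite i0 (leqW ik).
move=> [h hk] i /andP[i0]; rewrite leq_eqVlt => /orP[/eqP -> //|].
by rewrite ltnS => ik; apply: h; rewrite i0.
Qed.

Lemma positive_until0 : positive_until 0 = setT.
Proof. by apply/seteqP; split=> // w _ i /andP[]; case: i. Qed.

Lemma positive_until_le k n : (k <= n)%N -> positive_until n `<=` positive_until k.
Proof. by move=> kn w h i /andP[i0 ik]; apply: h; rewrite i0 (leq_trans ik). Qed.

Lemma positive_until_ge0 k i w : positive_until k w -> (i <= k)%N -> 0 <= Ssum X i w.
Proof.
case: i => [|i] h ik; first by rewrite Ssum0.
by apply/ltW/h; rewrite ik.
Qed.

Lemma positive_until_area_ge0 k i w :
  positive_until k w -> (i <= k.+1)%N -> 0 <= area i w.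
Proof.
move=> h ik; rewrite /area sumr_ge0// => j _.
apply: (positive_until_ge0 h); rewrite -ltnS; exact: leq_trans (ltn_ord j) ik.
Qed.

Lemma past_measurable_gt0 n (f : T -> R) : measurable_fun setT (f : past X n -> R) ->
  measurable ([set w | 0 < f w] : set (past X n)).
Proof.
move=> mf; rewrite (_ : [set w | _] = setT `&` f @^-1` `]0, +oo[).
  by apply: mf.
by apply/seteqP; split=> w /=; rewrite in_itv/= andbT; [split|case].
Qed.

Lemma past_measurable_positive_until k n : (k <= n)%N ->
  measurable (positive_until k : set (past X n)).
Proof.
elim: k => [|k IH] kn; first by rewrite positive_until0; exact: measurableT.
rewrite positive_untilS; apply: measurableI; first exact: IH (ltnW kn).
by apply: past_measurable_gt0; exact: measurable_Ssum.
Qed.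

Lemma measurable_positive_until k : measurable (positive_until k).
Proof. exact: past_measurable (past_measurable_positive_until (leqnn k)). Qed.

Lemma measurable_area_gt n x : measurable [set w | x < area n w].
Proof.
have h : measurable_fun setT (fun w => area n w - x).
  apply: measurable_funB => //.
  exact: past_measurable_fun (measurable_area (leqnSn n)).
rewrite (_ : [set w | _] = setT `&` (fun w => area n w - x) @^-1` `]0, +oo[).
  by apply: h.
by apply/seteqP; split=> w /=; rewrite in_itv/= andbT subr_gt0; [split|case].
Qed.

Variant tau_opt_spec (w : T) : option nat -> Prop :=
| TauOptSome n of positive_until n w & Ssum X n.+1 w <= 0 : tau_opt_spec w (Some n.+1)
| TauOptNone of (forall k, positive_until k w) : tau_opt_spec w None.

Lemma tau_optP w : tau_opt_spec w (tau_opt X w).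
Proof.
rewrite /tau_opt; case: pselect => [h|h]; last first.
  apply: TauOptNone => k i /andP[i0 _]; rewrite ltNge; apply/negP => Si.
  by apply: h; exists i; rewrite i0 Si.
case: ex_minnP => -[|n] /andP[// _ Sn] min_n.
apply: TauOptSome => // i /andP[i0 ik]; rewrite ltNge; apply/negP => Si.
by have := min_n i; rewrite i0 Si ltnNge ik /= => /(_ isT).
Qed.

Lemma Atau_gtP x w : (x%:E < Atau X w)%E <->
  (forall k, positive_until k w) \/ (exists k, positive_until k w /\ x < area k.+1 w).
Proof.
rewrite /Atau; case: tau_optP => [n pn Sn|h]; last first.
  by rewrite ltry; split=> // _; left.
rewrite lte_fin -/(area n.+1 w); split=> [xA|]; first by right; exists n.
case=> [/(_ n.+1 n.+1)|[k [pk xA]]].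
  by rewrite leqnn => /(_ isT); rewrite ltNge Sn.
apply: (lt_le_trans xA).
have kn : (k <= n)%N.
  rewrite leqNgt; apply/negP => nk; have := pk n.+1; rewrite nk => /(_ isT).
  by rewrite ltNge Sn.
rewrite -(subnKC kn).
have : (k + (n - k) <= n)%N by rewrite subnKC.
elim: (n - k)%N => [|j IH] jn; first by rewrite addn0.
rewrite addnS in jn *; apply: (le_trans (IH (ltnW jn))).
by rewrite [leRHS]areaS lerDl; exact: positive_until_ge0 pn _.
Qed.

Lemma measurable_Atau_gt x : measurable [set w | (x%:E < Atau X w)%E].
Proof.
rewrite (_ : [set w | _] = \bigcap_k positive_until k `|`
    \bigcup_k (positive_until k `&` [set w | x < area k.+1 w])).
  apply: measurableU.
    by apply: bigcapT_measurable => k; exact: measurable_positive_until.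
  apply: bigcupT_measurable => k; apply: measurableI.
    exact: measurable_positive_until.
  exact: measurable_area_gt.
apply/seteqP; split=> w /=.
  by move=> /Atau_gtP[h|[k h]]; [left=> k _; exact: h|right; exists k].
by move=> h; apply/Atau_gtP; case: h => [h|[k _ h]]; [left=> k; exact: h|right; exists k].
Qed.

Lemma tauE w : tau X w = (\sum_(0 <= k <oo) (\1_(positive_until k) w)%:E)%E.
Proof.
rewrite /tau; case: tau_optP => [n pn Sn|h].
  rewrite (nneseries_split 0 n.+1)//=.
  rewrite [X in (_ + X)%E]eseries0 ?adde0; last first.
    move=> k; rewrite add0n => nk _; rewrite indicE memNset// => /(_ n.+1).
    by rewrite nk ltNge Sn => /(_ isT).
  rewrite add0n sumEFin; congr (_%:E).
  rewrite big_nat (eq_bigr (fun=> 1)) => [|k /andP[_ kn]].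
    by rewrite -big_nat sumr_const_nat subn0.
  by rewrite indicE mem_set//; apply: positive_until_le pn.
apply/esym/eqyP => r r0.
have [n rn] : exists n : nat, r <= n%:R.
  by exists (Num.trunc r).+1; exact/ltW/truncnS_gt.
apply: (@le_trans _ _ (n%:R%:E)); first by rewrite lee_fin.
apply: (@le_trans _ _ (\sum_(0 <= k < n) (\1_(positive_until k) w)%:E)%E).
  rewrite sumEFin lee_fin (eq_bigr (fun=> 1)) => [|k _].
    by rewrite sumr_const_nat subn0.
  by rewrite indicE mem_set.
by apply: nneseries_lim_ge => k _; rewrite lee_fin.
Qed.

Lemma EtauE : (Etau X = \sum_(0 <= k <oo) P (positive_until k))%E.
Proof.
rewrite /Etau; under eq_integral do rewrite tauE.
rewrite integral_nneseries//.
- apply: eq_eseriesr => k _; rewrite integral_indic ?setIT//.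
  exact: measurable_positive_until.
- move=> k; apply/measurable_EFinP/measurable_indic; exact: measurable_positive_until.
Qed.

Lemma lt_Etau c : (c%:E < Etau X)%E -> exists N,
  (c%:E < \sum_(0 <= k < N) P (positive_until k))%E.
Proof.
rewrite EtauE => cE; apply: contrapT => h.
have : (\sum_(0 <= k <oo) P (positive_until k) <= c%:E)%E.
  apply: lime_le; first exact: is_cvg_nneseries.
  apply: nearW => N; rewrite leNgt; apply/negP => cN; apply: h; by exists N.
by rewrite leNgt cE.
Qed.

End Walk.

(** * The Lyapunov function *)

Section RealInequalities.
Context {R : realType}.
Implicit Types s u h a b w k A S : R.

Lemma expR_le_quad s : s <= 1 -> expR s <= 1 + s + 2 * s ^+ 2.
Proof.
move=> s1.
have h0 : 0 < 1 - s / 2 by lra.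
have h1 : 1 - s / 2 <= expR (- (s / 2)) by have := expR_ge1Dx (- (s / 2)); lra.
have h2 : expR s = (expR (- (s / 2))) ^- 2.
  by rewrite -expRM_natl -expRN; congr expR; rewrite mulr_natl mulr2n; lra.
rewrite h2; apply: (@le_trans _ _ ((1 - s / 2) ^- 2)).
  rewrite lef_pV2 ?posrE ?exprn_gt0 ?expR_gt0//.
  by rewrite lerXn2r// nnegrE ?expR_ge0// ltW.
rewrite -[leLHS]mul1r ler_pdivrMr ?exprn_gt0//.
have p : 0 <= s ^+ 2 * ((1 - s) * (5 / 4 - s / 2)).
  by rewrite mulr_ge0 ?sqr_ge0// mulr_ge0; lra.
by rewrite -subr_ge0; apply: le_trans p _; lra.
Qed.

Lemma expR_half : expR (2^-1) <= 2 :> R.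
Proof. by apply: (le_trans (expR_le_quad _)); lra. Qed.

Lemma expR1_le4 : expR 1 <= 4 :> R.
Proof. by apply: (le_trans (expR_le_quad _)); lra. Qed.

Definition Hfun a k A S : R := Num.sqrt (2 * a * A + (Num.max (S + k) 0) ^+ 2).

Definition Hinc a k A S u : R := Hfun a k (A + S) (S + u) - Hfun a k A S.

Section Hfun.
Variables a k A S : R.
Hypotheses (a0 : 0 < a) (k0 : 0 < k) (A0 : 0 <= A) (S0 : 0 <= S).

Let H := Hfun a k A S.

Lemma Hfun_sqr : H ^+ 2 = 2 * a * A + (S + k) ^+ 2.
Proof.
rewrite /H /Hfun sqr_sqrtr; last first.
  by rewrite addr_ge0 ?sqr_ge0// !mulr_ge0// ltW.
by rewrite max_l// addr_ge0// ltW.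
Qed.

Lemma Hfun_ge : S + k <= H.
Proof.
rewrite -(@ler_pXn2r _ 2)// ?nnegrE ?sqrtr_ge0//; last by rewrite addr_ge0// ltW.
by rewrite -/H Hfun_sqr lerDr !mulr_ge0// ltW.
Qed.

Lemma Hfun_gt0 : 0 < H.
Proof. by apply: lt_le_trans Hfun_ge; rewrite ltr_wpDl. Qed.

Let H' u := Hfun a k (A + S) (S + u).

Let H'_sqr u : (H' u) ^+ 2 = 2 * a * (A + S) + (Num.max (S + u + k) 0) ^+ 2.
Proof.
by rewrite sqr_sqrtr// addr_ge0 ?sqr_ge0// !mulr_ge0 ?addr_ge0// ltW.
Qed.

Let H'_ge0 u : 0 <= H' u. Proof. exact: sqrtr_ge0. Qed.

Lemma Hinc_le_tangent u :
  Hinc a k A S u <= (2 * a * S + 2 * (S + k) * u + u ^+ 2) / (2 * H).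
Proof.
have [a_gt0 k_gt0 A_ge0 S_ge0] := And4 a0 k0 A0 S0.
have H0 := Hfun_gt0; rewrite /Hinc -/H -/(H' u).
rewrite ler_pdivlMr ?mulr_gt0//.
have e1 := Hfun_sqr; have e2 := H'_sqr u.
have m : (Num.max (S + u + k) 0) ^+ 2 <= (S + u + k) ^+ 2.
  by case: (leP (S + u + k) 0) => _; rewrite ?expr0n ?sqr_ge0.
have := sqr_ge0 (H' u - H); nra.
Qed.

Lemma Hinc_le u : Hinc a k A S u <= Num.max u 0 + a.
Proof.
have [a_gt0 k_gt0 A_ge0 S_ge0] := And4 a0 k0 A0 S0.
have H0 := Hfun_gt0; have HS := Hfun_ge; rewrite /Hinc -/H -/(H' u) lerBlDr.
set v := Num.max u 0; have v0 : 0 <= v by rewrite le_max lexx orbT.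
have uv : u <= v by rewrite le_max lexx.
clearbody v.
rewrite -(@ler_pXn2r _ 2)// ?nnegrE//; last by rewrite !addr_ge0// ltW.
rewrite H'_sqr.
have m : (Num.max (S + u + k) 0) ^+ 2 <= (S + v + k) ^+ 2.
  have p1 : 0 <= S + v + k by lra.
  have p2 : Num.max (S + u + k) 0 <= S + v + k.
    by rewrite ge_max p1 andbT lerD2r lerD2l.
  by rewrite lerXn2r// nnegrE// le_max lexx orbT.
apply: (le_trans (lerD (lexx _) m)).
have e1 := Hfun_sqr; rewrite -/H in HS.
have -> : (v + a + H) ^+ 2 = H ^+ 2 + 2 * H * (v + a) + (v + a) ^+ 2 by ring.
rewrite e1.
have h1 : (S + k) * (v + a) <= H * (v + a) by rewrite ler_wpM2r// addr_ge0// ltW.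
nra.
Qed.

Lemma Hinc_ge u : Num.min u 0 <= Hinc a k A S u.
Proof.
have [a_gt0 k_gt0 A_ge0 S_ge0] := And4 a0 k0 A0 S0.
have H0 := Hfun_gt0; have HS := Hfun_ge; rewrite /Hinc -/H -/(H' u) lerBrDr.
rewrite -/H in HS.
have e1 := Hfun_sqr; have e2 := H'_sqr u.
have [u0|u0] := leP 0 u.
  rewrite add0r -(@ler_pXn2r _ 2)// ?nnegrE// ?(ltW H0)// H'_sqr e1 max_l; last lra.
  have p1 : 0 <= a * S by rewrite mulr_ge0// ltW.
  have p2 : 0 <= u * (S + k) by rewrite mulr_ge0// addr_ge0// ltW.
  have p3 := sqr_ge0 u; lra.
have [Hu|Hu] := leP (u + H) 0; first exact: le_trans Hu _.
rewrite -(@ler_pXn2r _ 2)// ?nnegrE// ?(ltW Hu)// H'_sqr.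
have [r|r] := leP (S + u + k) 0.
  rewrite expr0n/= addr0.
  have : (u + H) ^+ 2 <= (H - (S + k)) ^+ 2 by rewrite lerXn2r ?nnegrE//; lra.
  have : (S + k) * (S + k) <= H * (S + k) by rewrite ler_wpM2r//; lra.
  nra.
have : (S + k) * - u <= H * - u by rewrite ler_wpM2r//; lra.
nra.
Qed.

End Hfun.
End RealInequalities.

Section Law.
Context {R : realType}.
Variable mu : probability R R.

Definition utail (x : R) : R := fine (mu `]x, +oo[%classic).

Lemma utailE x : mu `]x, +oo[%classic = (utail x)%:E.
Proof. by rewrite fineK//; exact: fin_num_measure. Qed.

Lemma utail_ge0 x : 0 <= utail x.
Proof. exact: fine_ge0. Qed.

Definition exp_trunc (h b w u : R) : R := \1_(`]b, w]%classic : set R) u * expR (h * u).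

Lemma exp_trunc_ge0 h b w u : 0 <= exp_trunc h b w u.
Proof. by rewrite mulr_ge0// expR_ge0. Qed.

Lemma exp_truncE h b w u :
  exp_trunc h b w u = if (b < u) && (u <= w) then expR (h * u) else 0.
Proof.
rewrite /exp_trunc indicE; case: ifPn => h1.
  by rewrite mem_set ?mul1r//= in_itv.
by rewrite memNset ?mul0r//= in_itv/=; exact/negP.
Qed.

Lemma measurable_exp_trunc h b w : measurable_fun setT (exp_trunc h b w).
Proof.
apply: measurable_funM; first exact: measurable_indic.
by apply: measurableT_comp => //; exact: mulrl_measurable.
Qed.

Lemma block_index (b l u : R) (I : nat) : b < u -> u <= b + I%:R * l ->
  exists2 i, (i < I)%N & b + i%:R * l < u <= b + i.+1%:R * l.
Proof.
move=> bu; elim: I => [|I IH]; first by rewrite mul0r addr0 leNgt bu.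
move=> uI; have [/IH[i iI h]|h] := leP u (b + I%:R * l).
  by exists i => //; exact: ltnW.
by exists I => //; rewrite h uI.
Qed.

(* Cut ]b, w] into blocks of length 1/h, on which expR (h * u) varies by a factor e. *)
Lemma integral_exp_trunc_le (h b w : R) (I : nat) (c : nat -> R) :
  0 < h -> w <= b + I%:R / h -> (forall i, 0 <= c i) ->
  (forall i, (i < I)%N -> b + i%:R / h < w ->
     expR (h * (b + i%:R / h)) * utail (b + i%:R / h) <= c i) ->
  (\int[mu]_u (exp_trunc h b w u)%:E <= (4 * \sum_(i < I) c i)%:E)%E.
Proof.
move=> h0 wI c0 hc.
pose s (i : nat) := b + i%:R / h.
pose W (i : nat) : set R := if s i < w then `]s i, +oo[%classic else set0.
have mW i : measurable (W i) by rewrite /W; case: ifP.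
have mI i : measurable_fun setT (fun u => (\1_(W i) u)%:E).
  by apply/measurable_EFinP; apply: measurable_indic; exact: mW.
pose k (i : nat) := 4 * expR (h * s i).
have mkI (i : nat) : measurable_fun setT (fun u => ((k i)%:E * (\1_(W i) u)%:E)%E).
  by apply: measurable_funeM; exact: mI.
have k0 i : 0 <= k i by rewrite mulr_ge0// expR_ge0.
have hle u : ((exp_trunc h b w u)%:E <= \sum_(i < I) (k i)%:E * (\1_(W i) u)%:E)%E.
  rewrite exp_truncE; case: ifPn => [/andP[bu uw]|_]; last first.
    by apply: sume_ge0 => i _; rewrite mule_ge0// lee_fin.
  have [i iI /andP[si siS]] := block_index bu (le_trans uw wI).
  rewrite (bigD1 (Ordinal iI))//=.
  rewrite -[leLHS]adde0; apply: leeD; last first.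
    by apply: sume_ge0 => j _; rewrite mule_ge0// lee_fin.
  have -> : \1_(W i) u = 1 :> R.
    by rewrite indicE mem_set// /W (lt_le_trans si uw)//= in_itv/= andbT.
  rewrite mule1 lee_fin /k.
  have -> : h * u = h * (u - s i) + h * s i by ring.
  rewrite expRD ler_wpM2r ?expR_ge0//.
  apply: le_trans expR1_le4; rewrite ler_expR.
  rewrite mulrC -ler_pdivlMr// lerBlDl /s (le_trans siS)//.
  by rewrite -addrA lerD2l -mulrDl natr1.
apply: (@le_trans _ _ (\int[mu]_u (\sum_(i < I) (k i)%:E * (\1_(W i) u)%:E)%E)%E).
  apply: ge0_le_integral => //.
  - by move=> u _; rewrite lee_fin exp_trunc_ge0.
  - by apply/measurable_EFinP; exact: measurable_exp_trunc.
  - by apply: emeasurable_sum => i; exact: mkI.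
rewrite (@ge0_integral_sum _ _ _ mu _ measurableT 'I_I
  (fun i u => ((k i)%:E * (\1_(W i) u)%:E)%E)); last 2 first.
- by move=> i; exact: mkI.
- by move=> i u _; rewrite mule_ge0// lee_fin.
rewrite mulr_sumr -sumEFin; apply: lee_sum => i _.
rewrite ge0_integralZl//; last by rewrite lee_fin.
rewrite integral_indic// setIT /W; case: ifPn => [sw|_]; last first.
  by rewrite measure0 mule0 lee_fin mulr_ge0.
by rewrite [X in (_ * X)%E](utailE (s i)) /k -EFinM lee_fin -mulrA ler_pM2l//; apply: hc => //.
Qed.

Lemma sum_inv_odd_sqr (I : nat) : \sum_(i < I) (2 * i%:R + 1 : R) ^- 2 <= 2.
Proof.
case: I => [|I]; first by rewrite big_ord0.
apply: (@le_trans _ _ (2 - I.+1%:R^-1)); last by rewrite gerBl invr_ge0.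
elim: I => [|I IH].
  by rewrite big_ord1 mulr0 add0r expr1n invr1; lra.
rewrite big_ord_recr/=; apply: (le_trans (lerD IH (lexx _))).
have x0 : 0 <= I%:R :> R by [].
rewrite -[I.+2%:R]natr1 -[I.+1%:R]natr1.
set x := I%:R in x0 *.
apply: (@le_trans _ _ (2 - (x + 1)^-1 + (x + 1 + 1) ^- 2)).
  rewrite lerD2l lef_pV2 ?posrE ?exprn_gt0//; try lra.
  by rewrite lerXn2r ?nnegrE; lra.
have : (x + 1 + 1) ^- 2 <= (x + 1)^-1 * (x + 1 + 1)^-1.
  rewrite expr2 invfM ler_wpM2r ?invr_ge0; try lra.
  by rewrite lef_pV2 ?posrE; lra.
have -> : (x + 1)^-1 * (x + 1 + 1)^-1 = (x + 1)^-1 - (x + 1 + 1)^-1.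
  by field; apply/andP; split; lra.
lra.
Qed.

Section TailBounds.
Variables (g : R -> R) (s0 : R).
Hypothesis s0_gt0 : 0 < s0.
Hypothesis utail_le : forall s, s0 <= s -> utail s <= 2 * expR (- g s) * s ^- 2.

Lemma expR_utail_le h M s : s0 <= s -> h * s <= g s + M ->
  expR (h * s) * utail s <= 2 * expR M * s ^- 2.
Proof.
move=> ss hs; have s_gt0 := lt_le_trans s0_gt0 ss.
apply: (le_trans (ler_wpM2l (expR_ge0 _) (utail_le ss))).
rewrite mulrA ler_wpM2r ?invr_ge0 ?exprn_ge0 ?(ltW s_gt0)//.
by rewrite mulrCA ler_wpM2l// -expRD ler_expR; lra.
Qed.

Lemma integral_exp_trunc_tail h w M : 0 < h -> s0 <= (2 * h)^-1 ->
  (forall u, (2 * h)^-1 <= u -> u <= w -> h * u <= g u + M) ->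
  (\int[mu]_u (exp_trunc h (2 * h)^-1 w u)%:E <= (64 * expR M * h ^+ 2)%:E)%E.
Proof.
move=> h0 sb hM; set b := (2 * h)^-1.
have b0 : 0 < b := lt_le_trans s0_gt0 sb.
have [I wI] : exists I : nat, w <= b + I%:R / h.
  exists (Num.trunc (h * (w - b))).+1.
  by rewrite -lerBlDl ler_pdivlMr// mulrC; exact/ltW/truncnS_gt.
pose c (i : nat) := 2 * expR M * (b + i%:R / h) ^- 2.
have bi (i : nat) : b <= b + i%:R / h by rewrite lerDl divr_ge0// ltW.
apply: (le_trans (@integral_exp_trunc_le h b w I c h0 wI _ _)).
- by move=> i; rewrite /c mulr_ge0 ?invr_ge0 ?sqr_ge0// mulr_ge0// expR_ge0.
- move=> i _ iw; apply: expR_utail_le; first exact: le_trans sb (bi i).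
  by apply: hM; [exact: bi|exact: ltW].
rewrite lee_fin /c -mulr_sumr.
have E (i : nat) : (b + i%:R / h) ^- 2 = 4 * h ^+ 2 * (2 * i%:R + 1) ^- 2.
  have i0 : 0 <= i%:R :> R by [].
  by rewrite /b; field; rewrite !gt_eqF//=; lra.
under eq_bigr do rewrite E.
rewrite -mulr_sumr.
have := sum_inv_odd_sqr I; set s := \sum_(i < I) _ => s2.
have eh : 0 <= expR M * h ^+ 2 by rewrite mulr_ge0 ?expR_ge0 ?sqr_ge0.
have := ler_wpM2l eh s2; lra.
Qed.

Lemma integral_exp_trunc_large h w y M : 0 < h -> s0 <= w -> w <= y ->
  (forall u, w <= u -> u <= y -> h * u <= g u + M) ->
  (\int[mu]_u (exp_trunc h w y u)%:E
     <= (8 * expR M * (h * y + 1) * w ^- 2)%:E)%E.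
Proof.
move=> h0 sw wy hM.
have w0 : 0 < w := lt_le_trans s0_gt0 sw.
pose I := (Num.trunc (h * (y - w))).+1.
have wi (i : nat) : w <= w + i%:R / h by rewrite lerDl divr_ge0// ltW.
apply: (le_trans (@integral_exp_trunc_le h w y I (fun=> 2 * expR M * w ^- 2) h0 _ _ _)).
- by rewrite -lerBlDl ler_pdivlMr// mulrC; exact/ltW/truncnS_gt.
- by move=> i; rewrite mulr_ge0 ?invr_ge0 ?sqr_ge0// mulr_ge0// expR_ge0.
- move=> i _ iy; apply: (@le_trans _ _ (2 * expR M * (w + i%:R / h) ^- 2)).
    apply: expR_utail_le; first exact: le_trans sw (wi i).
    by apply: hM; [exact: wi|exact: ltW].
  rewrite ler_wpM2l ?mulr_ge0 ?expR_ge0// lef_pV2 ?posrE ?exprn_gt0//.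
    by rewrite lerXn2r ?nnegrE ?(ltW w0)// (le_trans _ (wi i))// ltW.
  exact: lt_le_trans (wi i).
rewrite lee_fin sumr_const card_ord -mulr_natl.
have IE : I%:R <= h * y + 1.
  rewrite /I -natr1 lerD2r.
  have hyw : 0 <= h * (y - w) by rewrite mulr_ge0 ?subr_ge0// ltW.
  have : (Num.trunc (h * (y - w)))%:R <= h * (y - w) by rewrite -truncn_ge_nat.
  move=> /le_trans; apply.
  by rewrite ler_pM2l// gerBl ltW.
have eh : 0 <= expR M * w ^- 2 by rewrite mulr_ge0 ?expR_ge0// invr_ge0 sqr_ge0.
have := ler_wpM2l eh IE; lra.
Qed.

End TailBounds.

Section Moments.
Variables (a m2 : R).
Hypothesis int1 : mu.-integrable setT (fun u : R => u%:E).
Hypothesis mean : (\int[mu]_u u%:E = (- a)%:E)%E.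
Hypothesis int2 : mu.-integrable setT (fun u : R => (u ^+ 2)%:E).
Hypothesis mom2 : (\int[mu]_u (u ^+ 2)%:E = m2%:E)%E.

Lemma integral_quad (al be ga : R) :
  (\int[mu]_u (al + be * u + ga * u ^+ 2)%:E = (al - be * a + ga * m2)%:E)%E.
Proof.
have i0 : mu.-integrable setT (fun=> al%:E).
  exact: finite_measure_integrable_cst.
have i1 : mu.-integrable setT (fun u => (be%:E * u%:E)%E) by exact: integrableZl.
have i2 : mu.-integrable setT (fun u => (ga%:E * (u ^+ 2)%:E)%E) by exact: integrableZl.
have i01 := integrableD measurableT i0 i1.
rewrite (eq_integral (fun u => (al%:E + be%:E * u%:E) + ga%:E * (u ^+ 2)%:E)%E)//.
rewrite (integralD measurableT i01 i2) (integralD measurableT i0 i1).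
rewrite (integralZl measurableT int1) (integralZl measurableT int2) mean mom2.
rewrite integral_cst//= -[setT]/(setT : set R).
rewrite (_ : mu setT = 1%E) ?probability_setT// mule1 -!EFinM -!EFinD.
by congr (_%:E); rewrite mulrN.
Qed.

Lemma integral_le_quad_trunc (f : R -> R) (al be ga c h b w tl : R) :
  measurable_fun setT f -> (forall u, 0 <= f u) -> 0 <= c ->
  (forall u, f u <= al + be * u + ga * u ^+ 2 + c * exp_trunc h b w u) ->
  (forall u, b < u -> u <= w -> 0 <= al + be * u + ga * u ^+ 2) ->
  (\int[mu]_u (exp_trunc h b w u)%:E <= tl%:E)%E ->
  (\int[mu]_u (f u)%:E <= (al - be * a + ga * m2 + c * tl)%:E)%E.
Proof.
move=> mf f0 c0 fle q0 htl.
have q_ge0 u : 0 <= al + be * u + ga * u ^+ 2.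
  case: (boolP ((b < u) && (u <= w))) => [/andP[]|h1]; first exact: q0.
  by have := fle u; rewrite exp_truncE (negbTE h1) mulr0 addr0; exact: le_trans.
have mq : measurable_fun setT (fun u => (al + be * u + ga * u ^+ 2)%:E).
  have q1 : measurable_fun setT (fun u : R => be * u) by exact: measurable_funM.
  have q2 : measurable_fun setT (fun u : R => ga * u ^+ 2).
    by apply: measurable_funM => //; exact: exprn_measurable.
  apply/measurable_EFinP; apply: measurable_funD q2; exact: measurable_funD q1.
have mt : measurable_fun setT (fun u => (exp_trunc h b w u)%:E).
  by apply/measurable_EFinP; exact: measurable_exp_trunc.
apply: (@le_trans _ _ (\int[mu]_u ((al + be * u + ga * u ^+ 2)%:E
    + c%:E * (exp_trunc h b w u)%:E))%E).
  apply: ge0_le_integral => //.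
  - by move=> u _; rewrite lee_fin.
  - exact/measurable_EFinP.
  - by apply: emeasurable_funD => //; exact: measurable_funeM.
  - by move=> u _; rewrite -EFinM -EFinD lee_fin.
rewrite ge0_integralD//; last 3 first.
- by move=> u _; rewrite lee_fin.
- by move=> u _; rewrite mule_ge0// lee_fin// exp_trunc_ge0.
- exact: measurable_funeM.
rewrite integral_quad ge0_integralZl//; last first.
- by move=> u _; rewrite lee_fin exp_trunc_ge0.
by rewrite [leRHS]EFinD EFinM leeD2l// lee_wpmul2l.
Qed.

End Moments.

End Law.

(** * Exponential moments of one increment *)

Section Kernel.
Context {R : realType}.

Lemma measurable_Hfun (a k : R) :
  measurable_fun setT (fun z : R * R => Hfun a k z.1 z.2).
Proof.
apply: (measurableT_comp (f := @Num.sqrt R)).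
  apply: continuous_measurable_fun; exact: sqrt_continuous.
apply: measurable_funD; first exact: measurable_funM.
apply: (measurable_funX 2); apply: measurable_maxr => //.
exact: measurable_funD.
Qed.

Lemma measurable_le_if d (T : measurableType d) (u f : T -> R) (w : R) :
  measurable_fun setT u -> measurable_fun setT f ->
  measurable_fun setT (fun x => if u x <= w then f x else 0).
Proof.
by move=> mu mf; apply: measurable_fun_ifT => //; exact: measurable_fun_ler.
Qed.

Definition trunc_exp_inc (a k h w A S u : R) : R :=
  if u <= w then expR (h * Hinc a k A S u) else 0.

Lemma trunc_exp_inc_ge0 a k h w A S u : 0 <= trunc_exp_inc a k h w A S u.
Proof. by rewrite /trunc_exp_inc; case: ifP => // _; exact: expR_ge0. Qed.

Lemma measurable_trunc_exp_inc (a k h w : R) :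
  measurable_fun setT (fun z : R * R * R => trunc_exp_inc a k h w z.1.1 z.1.2 z.2).
Proof.
apply: measurable_le_if => //.
apply: measurableT_comp => //; apply: measurable_funM => //.
apply: measurable_funB.
  apply: (measurableT_comp (measurable_Hfun a k)
    (g := fun z : R * R * R => (z.1.1 + z.1.2, z.1.2 + z.2))).
  by apply: measurable_fun_pair; apply: measurable_funD => //; exact: measurableT_comp.
apply: (measurableT_comp (measurable_Hfun a k) (g := fun z : R * R * R => z.1)).
exact: measurable_fst.
Qed.

Definition quad0 (a k h A S : R) : R := 1 + 4 * h ^+ 2 * a ^+ 2 + h * a * S / Hfun a k A S.
Definition quad1 (a k h A S : R) : R := h * (S + k) / Hfun a k A S.
Definition quad2 (a k h A S : R) : R := h / (2 * Hfun a k A S) + 4 * h ^+ 2.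

Section Pointwise.
Variables (a k h w A S : R).
Hypotheses (a_gt0 : 0 < a) (k_gt0 : 0 < k) (h_gt0 : 0 < h) (ha : h * a <= 2^-1).
Hypotheses (w_ge0 : 0 <= w) (A_ge0 : 0 <= A) (S_ge0 : 0 <= S).

Let q u := quad0 a k h A S + quad1 a k h A S * u + quad2 a k h A S * u ^+ 2.
Let b : R := (2 * h)^-1.

Lemma quad_ge0 u : 0 <= u -> 0 <= q u.
Proof.
have H0 := Hfun_gt0 a_gt0 k_gt0 A_ge0 S_ge0; have H0' := ltW H0.
have k0 := ltW k_gt0; have a0 := ltW a_gt0; have h0 := ltW h_gt0.
move=> u0; rewrite /q /quad0 /quad1 /quad2.
by rewrite !addr_ge0// !(mulr_ge0, sqr_ge0, addr_ge0, invr_ge0).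
Qed.

Lemma small_exponent u : u <= b -> h * Hinc a k A S u <= 1.
Proof.
move=> ub.
have d1 := Hinc_le a_gt0 k_gt0 A_ge0 S_ge0 u.
have hb : h * b = 2^-1 by rewrite /b invfM mulrCA mulfV ?mulr1 ?gt_eqF.
have : h * Hinc a k A S u <= h * (Num.max u 0 + a) by rewrite ler_pM2l.
have : h * Num.max u 0 <= 2^-1.
  by rewrite -hb ler_pM2l// ge_max ub/= invr_ge0 mulr_ge0// ltW.
move: ha; lra.
Qed.

Lemma trunc_exp_inc_large u : b < u ->
  trunc_exp_inc a k h w A S u <= 2 * exp_trunc h b w u.
Proof.
move=> bu; rewrite /trunc_exp_inc exp_truncE bu/=.
case: ifPn => _; last by rewrite mulr0.
have d1 := Hinc_le a_gt0 k_gt0 A_ge0 S_ge0 u.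
have b0 : 0 < b by rewrite invr_gt0 mulr_gt0.
rewrite max_l in d1; last exact/ltW/(lt_trans b0).
apply: le_trans (ler_wpM2r (expR_ge0 (h * u)) (@expR_half R)).
rewrite -expRD ler_expR.
have : h * Hinc a k A S u <= h * (u + a) by rewrite ler_pM2l.
move: ha; lra.
Qed.

Lemma trunc_exp_inc_small u : u <= b -> expR (h * Hinc a k A S u) <= q u.
Proof.
move=> ub; set D := Hinc a k A S u.
have H0 := Hfun_gt0 a_gt0 k_gt0 A_ge0 S_ge0.
have d0 := Hinc_le_tangent a_gt0 k_gt0 A_ge0 S_ge0 u.
have d1 := Hinc_le a_gt0 k_gt0 A_ge0 S_ge0 u.
have d2 := Hinc_ge a_gt0 k_gt0 A_ge0 S_ge0 u.
rewrite -/D in d0 d1 d2.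
apply: (le_trans (expR_le_quad (small_exponent ub))); rewrite -/D.
have dd : D ^+ 2 <= 2 * u ^+ 2 + 2 * a ^+ 2.
  have [u0|u0] := leP 0 u.
    rewrite max_l// in d1; rewrite min_r// in d2.
    have : D ^+ 2 <= (u + a) ^+ 2.
      by rewrite lerXn2r ?nnegrE// addr_ge0// ltW.
    have := sqr_ge0 (u - a); lra.
  rewrite max_r ?(ltW u0)// add0r in d1; rewrite min_l ?(ltW u0)// in d2.
  have : D ^+ 2 <= Num.max (u ^+ 2) (a ^+ 2).
    rewrite le_max; have [D0|D0] := leP 0 D.
      by apply/orP; right; rewrite lerXn2r// nnegrE// ltW.
    apply/orP; left; rewrite -[D ^+ 2]sqrrN -[u ^+ 2]sqrrN.
    by rewrite lerXn2r ?nnegrE ?oppr_ge0 ?lerN2 ?(ltW u0) ?(ltW D0).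
  have := sqr_ge0 u; have := sqr_ge0 a.
  by case: (leP (u ^+ 2) (a ^+ 2)) => _ p1 p2 p3; lra.
have hd : h * D <= h * ((2 * a * S + 2 * (S + k) * u + u ^+ 2) / (2 * Hfun a k A S)).
  by rewrite ler_pM2l.
have hdd : 2 * (h * D) ^+ 2 <= 2 * h ^+ 2 * (2 * u ^+ 2 + 2 * a ^+ 2).
  by rewrite exprMn mulrA ler_wpM2l// mulr_ge0// sqr_ge0.
have -> : q u = 1 + h * ((2 * a * S + 2 * (S + k) * u + u ^+ 2) / (2 * Hfun a k A S))
   + 2 * h ^+ 2 * (2 * u ^+ 2 + 2 * a ^+ 2).
  by rewrite /q /quad0 /quad1 /quad2; field; rewrite gt_eqF.
lra.
Qed.

Lemma trunc_exp_inc_le u : trunc_exp_inc a k h w A S u <= q u + 2 * exp_trunc h b w u.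
Proof.
have [ub|bu] := leP u b.
  apply: (@le_trans _ _ (q u)); last first.
    by rewrite lerDl mulr_ge0// exp_trunc_ge0.
  rewrite /trunc_exp_inc; case: ifPn => [_|]; first exact: trunc_exp_inc_small.
  by rewrite -ltNge => wu; apply: quad_ge0; exact/ltW/(le_lt_trans w_ge0).
apply: (le_trans (trunc_exp_inc_large bu)); rewrite lerDr; apply: quad_ge0.
by apply: ltW; apply: lt_trans bu; rewrite invr_gt0 mulr_gt0.
Qed.

Section Tilted.
Variable D : R.
Hypothesis D_gt0 : 0 < D.

Lemma tilted_inc_le u : Num.max (S + u + D) 0 * trunc_exp_inc a k h w A S u <=
  ((S + D) * quad0 a k h A S + 3 * h * a) + ((S + D) * quad1 a k h A S + 1) * u
   + ((S + D) * quad2 a k h A S + (3 * h + 3 * h * a + (2 * D)^-1)) * u ^+ 2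
   + (2 * (S + D) + 2 * w) * exp_trunc h b w u.
Proof.
have [a0 h0] := conj a_gt0 h_gt0; have a0' := ltW a0; have h0' := ltW h0.
have D0 := D_gt0; have S0 := S_ge0; have w0 := w_ge0; have ha' := ha.
have SD : 0 <= S + D by lra.
have et0 : 0 <= exp_trunc h b w u := exp_trunc_ge0 _ _ _ _.
have b0 : 0 < b by rewrite /b invr_gt0 mulr_gt0.
set et := exp_trunc h b w u in et0 *.
pose r := u + 3 * h * u ^+ 2 + 3 * h * a * (1 + u ^+ 2) + (2 * D)^-1 * u ^+ 2.
have D1 : 0 <= (2 * D)^-1 by rewrite invr_ge0; lra.
suff main : Num.max (S + u + D) 0 * trunc_exp_inc a k h w A S u <=
    (S + D) * (q u + 2 * et) + (r + 2 * w * et).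
  by apply: (le_trans main); rewrite /q /r; lra.
have u2 := sqr_ge0 u.
have r0 : 0 <= u -> 0 <= r.
  by move=> u0; rewrite /r !addr_ge0// !mulr_ge0// addr_ge0.
have [wu|uw] := ltP w u.
  have -> : trunc_exp_inc a k h w A S u = 0 by rewrite /trunc_exp_inc [u <= w]leNgt wu.
  rewrite mulr0.
  have u0 : 0 <= u by lra.
  have e1 : 0 <= q u + 2 * et by rewrite addr_ge0 ?mulr_ge0// quad_ge0.
  have e2 := mulr_ge0 SD e1; have e3 := r0 u0.
  have e4 : 0 <= w * et by rewrite mulr_ge0.
  lra.
have T_le := trunc_exp_inc_le u; rewrite -/et in T_le.
set E := trunc_exp_inc a k h w A S u in T_le *.
have E0 : 0 <= E := trunc_exp_inc_ge0 _ _ _ _ _ _ _.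
have d1 := Hinc_le a_gt0 k_gt0 A_ge0 S_ge0 u.
have d2 := Hinc_ge a_gt0 k_gt0 A_ge0 S_ge0 u.
have EE : E = expR (h * Hinc a k A S u) by rewrite /E /trunc_exp_inc uw.
have main1 := ler_wpM2l SD T_le.
have we0 : 0 <= w * et by rewrite mulr_ge0.
have [u0|u0] := leP u 0.
  rewrite max_r// add0r in d1; rewrite min_l// in d2.
  have mx : Num.max (S + u + D) 0 <= S + D + u + (4 * D)^-1 * u ^+ 2.
    have am : - u <= D + (4 * D)^-1 * u ^+ 2.
      have -> : D + (4 * D)^-1 * u ^+ 2 = - u + (4 * D)^-1 * (2 * D + u) ^+ 2.
        by field; rewrite gt_eqF.
      by rewrite lerDl mulr_ge0 ?sqr_ge0// invr_ge0; lra.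
    have : 0 <= (4 * D)^-1 * u ^+ 2 by rewrite mulr_ge0// invr_ge0; lra.
    by rewrite ge_max; move=> ?; apply/andP; split; lra.
  apply: (le_trans (ler_wpM2r E0 mx)).
  have E2 : E <= 2.
    rewrite EE; apply: le_trans (@expR_half R); rewrite ler_expR.
    by apply: le_trans ha; rewrite ler_pM2l.
  have uE : u * E <= u + h * u ^+ 2.
    have e1 : 1 + h * Hinc a k A S u <= E by rewrite EE expR_ge1Dx.
    have : u * E <= u * (1 + h * Hinc a k A S u) by rewrite ler_wnM2l.
    have : h * (u * Hinc a k A S u) <= h * (u * u).
      by rewrite ler_pM2l// ler_wnM2l.
    lra.
  have uuE : (4 * D)^-1 * u ^+ 2 * E <= (4 * D)^-1 * u ^+ 2 * 2.
    by rewrite ler_wpM2l// mulr_ge0// invr_ge0; lra.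
  have DE : (4 * D)^-1 * u ^+ 2 * 2 = (2 * D)^-1 * u ^+ 2.
    by field; rewrite gt_eqF.
  have h1 : 0 <= 2 * h * u ^+ 2 + 3 * h * a * (1 + u ^+ 2).
    by rewrite addr_ge0// mulr_ge0// ?mulr_ge0// addr_ge0.
  rewrite /r; lra.
have u0' := ltW u0; have rp := r0 u0'.
rewrite max_l; last lra.
have [ub|bu] := leP u b; last first.
  have := trunc_exp_inc_large bu; rewrite -/E -/et => El.
  have : u * E <= w * (2 * et) by rewrite ler_pM.
  lra.
rewrite max_l// in d1.
have hu : h * u <= 2^-1.
  have hb : h * b = 2^-1 by rewrite /b invfM mulrCA mulfV ?mulr1 ?gt_eqF.
  by rewrite -hb ler_pM2l.
have E3 : E <= 1 + 3 * (h * (u + a)).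
  have s1 : h * (u + a) <= 1 by lra.
  have s0 : 0 <= h * (u + a) by rewrite mulr_ge0// addr_ge0.
  have : E <= expR (h * (u + a)) by rewrite EE ler_expR ler_pM2l.
  have := expR_le_quad s1.
  have : (h * (u + a)) ^+ 2 <= h * (u + a) by rewrite expr2 ler_piMr.
  lra.
have uE : u * E <= u * (1 + 3 * (h * (u + a))) by rewrite ler_wpM2l.
have hau : h * a * u <= h * a * (1 + u ^+ 2).
  by rewrite ler_wpM2l ?mulr_ge0//; have := sqr_ge0 (u - 1); lra.
have du : 0 <= (2 * D)^-1 * u ^+ 2 by rewrite mulr_ge0.
rewrite /r; lra.
Qed.

End Tilted.
End Pointwise.

Section Means.
Variable mu : probability R R.
Variables (a m2 : R).
Hypothesis a_gt0 : 0 < a.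
Hypothesis int1 : mu.-integrable setT (fun u : R => u%:E).
Hypothesis mean : (\int[mu]_u u%:E = (- a)%:E)%E.
Hypothesis int2 : mu.-integrable setT (fun u : R => (u ^+ 2)%:E).
Hypothesis mom2 : (\int[mu]_u (u ^+ 2)%:E = m2%:E)%E.

Variables (k h w tl A S : R).
Hypotheses (k_gt0 : 0 < k) (h_gt0 : 0 < h) (ha : h * a <= 2^-1).
Hypotheses (w_ge0 : 0 <= w) (A_ge0 : 0 <= A) (S_ge0 : 0 <= S).
Hypothesis tail : (\int[mu]_u (exp_trunc h (2 * h)^-1 w u)%:E <= tl%:E)%E.
Hypothesis drift : h * (m2 - 2 * a * k) / (2 * Hfun a k A S)
  + 4 * h ^+ 2 * (m2 + a ^+ 2) + 2 * tl <= 0.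

Lemma measurable_trunc_exp_inc1 :
  measurable_fun setT (trunc_exp_inc a k h w A S).
Proof.
apply: (measurableT_comp (measurable_trunc_exp_inc a k h w)
  (g := fun u : R => ((A, S), u))).
exact: measurable_fun_pair.
Qed.

Lemma quad_mean : quad0 a k h A S - quad1 a k h A S * a + quad2 a k h A S * m2 + 2 * tl <= 1.
Proof.
have H0 := Hfun_gt0 a_gt0 k_gt0 A_ge0 S_ge0.
apply: le_trans (_ : 1 + (h * (m2 - 2 * a * k) / (2 * Hfun a k A S)
  + 4 * h ^+ 2 * (m2 + a ^+ 2) + 2 * tl) <= 1); last by rewrite gerDl.
rewrite le_eqVlt; apply/orP; left; apply/eqP.
by rewrite /quad0 /quad1 /quad2; field; rewrite gt_eqF.
Qed.

Let b_gt0 : 0 < (2 * h)^-1. Proof. by rewrite invr_gt0 mulr_gt0. Qed.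

Lemma integral_trunc_exp_inc_le1 :
  (\int[mu]_u (trunc_exp_inc a k h w A S u)%:E <= 1%:E)%E.
Proof.
apply: (@le_trans _ _ (quad0 a k h A S - quad1 a k h A S * a
    + quad2 a k h A S * m2 + 2 * tl)%:E); last by rewrite lee_fin quad_mean.
apply: (integral_le_quad_trunc int1 mean int2 mom2 _ _ _ _ _ tail) => //.
- exact: measurable_trunc_exp_inc1.
- by move=> u; exact: trunc_exp_inc_ge0.
- by move=> u; exact: trunc_exp_inc_le.
- by move=> u bu _; apply: quad_ge0 => //; exact: ltW (lt_trans b_gt0 bu).
Qed.

Lemma integral_tilted_inc (D : R) : 0 < D ->
  3 * h * a + (3 * h + 3 * h * a + (2 * D)^-1) * m2 + 2 * w * tl <= 3 / 4 * a ->
  (\int[mu]_u (Num.max (S + u + D) 0 * trunc_exp_inc a k h w A S u)%:E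
    <= (S + D - a / 4)%:E)%E.
Proof.
move=> D0 cond.
have SD : 0 <= S + D by rewrite addr_ge0// ltW.
set al := (S + D) * quad0 a k h A S + 3 * h * a.
set be := (S + D) * quad1 a k h A S + 1.
set ga := (S + D) * quad2 a k h A S + (3 * h + 3 * h * a + (2 * D)^-1).
apply: (@le_trans _ _ (al - be * a + ga * m2 + (2 * (S + D) + 2 * w) * tl)%:E); last first.
  have := ler_wpM2l SD quad_mean.
  rewrite lee_fin /al /be /ga; move: cond; lra.
apply: (integral_le_quad_trunc int1 mean int2 mom2 _ _ _ _ _ tail) => //.
- apply: measurable_funM; last exact: measurable_trunc_exp_inc1.
  apply: measurable_maxr => //; apply: measurable_funD => //; exact: measurable_funD.
- by move=> u; rewrite mulr_ge0 ?trunc_exp_inc_ge0// le_max lexx orbT.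
- by rewrite addr_ge0// mulr_ge0.
- by move=> u; exact: tilted_inc_le.
- move=> u bu _; have u0 := ltW (lt_trans b_gt0 bu).
  have qp : 0 <= quad0 a k h A S + quad1 a k h A S * u + quad2 a k h A S * u ^+ 2.
    exact: quad_ge0.
  have := mulr_ge0 SD qp.
  have h0 := ltW h_gt0; have a0 := ltW a_gt0.
  have : 0 <= (3 * h + 3 * h * a + (2 * D)^-1) * u ^+ 2.
    by rewrite mulr_ge0 ?sqr_ge0// !addr_ge0 ?mulr_ge0// ?mulr_ge0// invr_ge0 mulr_ge0// ltW.
  have : 0 <= h * a by rewrite mulr_ge0.
  rewrite /al /be /ga; move: u0; lra.
Qed.

End Means.
End Kernel.

(** * A maximal inequality for potentials *)

Section Maximal.
Context {d : measure_display} {T : measurableType d} {R : realType}.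
Variables (P : probability T R) (X : nat -> {RV P >-> R}).

Variables (n0 N : nat) (G : set T) (B C : nat -> set T) (V : nat -> T -> R).

Definition uncrossed (n : nat) : set T :=
  [set w | [/\ G w, forall i, (n0 < i <= n)%N -> B i w &
               forall i, (n0 <= i <= n)%N -> ~ C i w]].

Definition crossed (n : nat) : set T :=
  [set w | G w /\ exists m, [/\ (n0 <= m <= n)%N,
     forall i, (n0 < i <= m)%N -> B i w & C m w]].

Lemma uncrossed0 : uncrossed n0 = G `\` C n0.
Proof.
apply/seteqP; split=> w /=.
  by move=> [Gw _ h]; split=> //; apply: h; rewrite leqnn.
move=> [Gw nC]; split=> // i /andP[i1 i2].
  by move: (leq_trans i1 i2); rewrite ltnn.
by have -> : i = n0 by apply/eqP; rewrite eqn_leq i1 i2.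
Qed.

Lemma uncrossedS n : (n0 <= n)%N ->
  uncrossed n.+1 = uncrossed n `&` B n.+1 `\` C n.+1.
Proof.
move=> n0n; apply/seteqP; split=> w /=.
  move=> [Gw hB hC]; split; first split=> //.
  - split=> // i /andP[i1 i2]; [apply: hB|apply: hC]; by rewrite i1 leqW.
  - by apply: hB; rewrite ltnS n0n leqnn.
  - by apply: hC; rewrite leqnn leqW.
move=> [[[Gw hB hC] Bn] nCn]; split=> // i /andP[i1];
  rewrite leq_eqVlt => /orP[/eqP -> //|]; rewrite ltnS => i2.
  by apply: hB; rewrite i1.
by apply: hC; rewrite i1.
Qed.

Lemma crossed0 : crossed n0 = G `&` C n0.
Proof.
apply/seteqP; split=> w /=.
  move=> [Gw [m [/andP[m1 m2] _ Cm]]]; split=> //.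
  by have <- : m = n0 by apply/eqP; rewrite eqn_leq m1 m2.
move=> [Gw Cn]; split=> //; exists n0; split=> //; first by rewrite leqnn.
by move=> i /andP[i1 i2]; move: (leq_trans i1 i2); rewrite ltnn.
Qed.

Lemma crossedS n : (n0 <= n)%N ->
  crossed n.+1 = crossed n `|` (uncrossed n `&` B n.+1 `&` C n.+1).
Proof.
move=> n0n; apply/seteqP; split=> w /=.
  move=> [Gw [m [/andP[m1 m2] hB Cm]]].
  have [[m' [h1 h2 h3]]|h] := pselect (exists m', [/\ (n0 <= m' <= n)%N,
     forall i, (n0 < i <= m')%N -> B i w & C m' w]).
    by left; split=> //; exists m'.
  have mn : m = n.+1.
    apply/eqP; rewrite eqn_leq m2 ltnNge; apply/negP => mn; apply: h.
    by exists m; split=> //; rewrite m1.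
  move: hB Cm; rewrite mn => hB Cm; right; split=> //; split; last first.
    by apply: hB; rewrite ltnS n0n leqnn.
  split=> // i /andP[i1 i2].
    by apply: hB; rewrite i1 leqW.
  move=> Ci; apply: h; exists i; split=> //; first by rewrite i1.
  by move=> j /andP[j1 j2]; apply: hB; rewrite j1 leqW// (leq_trans j2).
case=> [[Gw [m [/andP[m1 m2] hB Cm]]]|[[[Gw hB hC] Bn] Cn]]; split=> //.
  by exists m; split=> //; rewrite m1 leqW.
exists n.+1; split=> //; first by rewrite leqW//=.
move=> i /andP[i1]; rewrite leq_eqVlt => /orP[/eqP -> //|].
by rewrite ltnS => i2; apply: hB; rewrite i1.
Qed.

Hypothesis n0N : (n0 <= N)%N.
Hypothesis mG : measurable (G : set (past X n0)).
Hypothesis mB : forall n, (n0 < n <= N)%N -> measurable (B n : set (past X n)).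
Hypothesis mC : forall n, (n0 <= n <= N)%N -> measurable (C n : set (past X n)).

Lemma past_measurable_uncrossed n : (n0 <= n <= N)%N ->
  measurable (uncrossed n : set (past X n)).
Proof.
move=> /andP[n0n]; rewrite -(subnKC n0n); elim: (n - n0)%N => [|j IH] nN.
  rewrite addn0 uncrossed0; apply: measurableD => //.
  by apply: mC; rewrite leqnn.
rewrite addnS in nN *; rewrite uncrossedS ?leq_addr//.
have nN' := ltnW nN.
apply: measurableD; last by apply: mC; rewrite nN leqW// leq_addr.
apply: measurableI; last by apply: mB; rewrite nN ltnS leq_addr.
by apply: past_measurableS; exact: IH.
Qed.

Lemma measurable_crossed n : (n0 <= n <= N)%N -> measurable (crossed n).
Proof.
move=> /andP[n0n]; rewrite -(subnKC n0n); elim: (n - n0)%N => [|j IH] nN.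
  rewrite addn0 crossed0; apply: measurableI; apply: past_measurable; first exact: mG.
  by apply: mC; rewrite leqnn.
rewrite addnS in nN *; rewrite crossedS ?leq_addr//.
have nN' := ltnW nN.
apply: measurableU; first exact: IH.
apply: (@past_measurable _ _ _ _ X (n0 + j).+1).
apply: measurableI; last by apply: mC; rewrite nN leqW// leq_addr.
apply: measurableI; last by apply: mB; rewrite nN ltnS leq_addr.
by apply: past_measurableS; apply: past_measurable_uncrossed; rewrite leq_addr.
Qed.

Hypothesis V_ge0 : forall n w, uncrossed n w -> 0 <= V n w.
Hypothesis mV : forall n, (n0 <= n <= N)%N -> measurable_fun setT (V n : past X n -> R).
Hypothesis V1 : forall w, G w -> C n0 w -> 1 <= V n0 w.
Hypothesis V_ge0' : forall w, G w -> 0 <= V n0 w.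
Hypothesis V_step : forall n, (n0 <= n < N)%N ->
  (\int[P]_(w in uncrossed n.+1) (V n.+1 w)%:E
   + P (uncrossed n `&` B n.+1 `&` C n.+1)
   <= \int[P]_(w in uncrossed n) (V n w)%:E)%E.

Lemma maximal_inequality n : (n0 <= n <= N)%N ->
  (P (crossed n) <= \int[P]_(w in G) (V n0 w)%:E)%E.
Proof.
suff main : (n0 <= n <= N)%N ->
  (P (crossed n) + \int[P]_(w in uncrossed n) (V n w)%:E
    <= \int[P]_(w in G) (V n0 w)%:E)%E.
  move=> /main; apply: le_trans; rewrite leeDl//.
  by apply: integral_ge0 => w /V_ge0; rewrite lee_fin.
have mG' := past_measurable mG.
have mC0 : measurable (C n0) by apply: past_measurable; apply: mC; rewrite leqnn.
have mV0 : measurable_fun setT (fun w => (V n0 w)%:E).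
  by apply/measurable_EFinP; apply: past_measurable_fun (mV _); rewrite leqnn.
move=> /andP[n0n]; rewrite -(subnKC n0n); elim: (n - n0)%N => [|j IH] nN.
  rewrite addn0 crossed0 uncrossed0.
  have -> : (\int[P]_(w in G) (V n0 w)%:E =
     \int[P]_(w in G `&` C n0) (V n0 w)%:E + \int[P]_(w in G `\` C n0) (V n0 w)%:E)%E.
    rewrite -ge0_integral_setU//; last 5 first.
    - exact: measurableI.
    - exact: measurableD.
    - exact: measurable_funTS.
    - by move=> w; rewrite lee_fin => -[[Gw _]|[Gw _]]; exact: V_ge0'.
    - by apply/disj_setPS => w [[_ ?] [_ ?]].
    by rewrite setUIDK.
  rewrite leeD2r// -[leLHS]mul1e -(integral_cst P (measurableI _ _ mG' mC0) 1).
  apply: ge0_le_integral => //.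
  - exact: measurableI.
  - exact: measurable_funTS.
  - by move=> w [Gw Cw]; rewrite lee_fin V1.
rewrite addnS in nN *; rewrite crossedS ?leq_addr//.
have nN' := ltnW nN.
apply: le_trans (IH nN').
have m1 : measurable (crossed (n0 + j)) by apply: measurable_crossed; rewrite leq_addr.
have m2 : measurable (uncrossed (n0 + j) `&` B (n0 + j).+1 `&` C (n0 + j).+1).
  apply: (@past_measurable _ _ _ _ X (n0 + j).+1).
  apply: measurableI; last by apply: mC; rewrite nN leqW// leq_addr.
  apply: measurableI; last by apply: mB; rewrite nN ltnS leq_addr.
  by apply: past_measurableS; apply: past_measurable_uncrossed; rewrite leq_addr.
apply: (@le_trans _ _ (P (crossed (n0 + j)) +
   P (uncrossed (n0 + j) `&` B (n0 + j).+1 `&` C (n0 + j).+1) +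
   \int[P]_(w in uncrossed (n0 + j).+1) (V (n0 + j).+1 w)%:E)%E).
  by rewrite leeD2r// measureU2.
rewrite -addeA leeD2l// addeC; apply: V_step; by rewrite leq_addr.
Qed.

End Maximal.

Section Hitting.
Context {d : measure_display} {T : measurableType d} {R : realType}.
Variables (P : probability T R) (X : nat -> {RV P >-> R}).
Hypothesis iidX : iid X.

Local Notation mu := (distribution P (X 0%N)).

Variables (a m2 : R).
Hypothesis a_gt0 : 0 < a.
Hypothesis int1 : mu.-integrable setT (fun u : R => u%:E).
Hypothesis mean : (\int[mu]_u u%:E = (- a)%:E)%E.
Hypothesis int2 : mu.-integrable setT (fun u : R => (u ^+ 2)%:E).
Hypothesis mom2 : (\int[mu]_u (u ^+ 2)%:E = m2%:E)%E.

Lemma measurable_set_le n (f : T -> R) (y : R) :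
  measurable_fun setT (f : past X n -> R) ->
  measurable ([set w | f w <= y] : set (past X n)).
Proof.
move=> mf; rewrite (_ : [set w | _] = setT `&` f @^-1` `]-oo, y]); first exact: mf.
by apply/seteqP; split=> w /=; rewrite in_itv/=; [split|case].
Qed.

Lemma measurable_set_ge n (f : T -> R) (y : R) :
  measurable_fun setT (f : past X n -> R) ->
  measurable ([set w | y <= f w] : set (past X n)).
Proof.
move=> mf; rewrite (_ : [set w | _] = setT `&` f @^-1` `[y, +oo[); first exact: mf.
by apply/seteqP; split=> w /=; rewrite in_itv/= andbT; [split|case].
Qed.

Definition Hproc (k : R) (n : nat) (w : T) : R := Hfun a k (area X n w) (Ssum X n w).

Lemma measurable_Hproc k n : measurable_fun setT (Hproc k n : past X n -> R).
Proof.
apply: (measurableT_comp (measurable_Hfun a k)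
  (g := (fun w => (area X n w, Ssum X n w)) : past X n -> R * R)).
by apply: measurable_fun_pair; [exact: measurable_area|exact: measurable_Ssum].
Qed.

Variables (k h v y tl : R).
Hypotheses (k_gt0 : 0 < k) (h_gt0 : 0 < h) (ha : h * a <= 2^-1) (v_ge0 : 0 <= v).
Hypothesis tail : (\int[mu]_u (exp_trunc h (2 * h)^-1 v u)%:E <= tl%:E)%E.
Hypothesis drift : forall H, 0 < H -> H < y ->
  h * (m2 - 2 * a * k) / (2 * H) + 4 * h ^+ 2 * (m2 + a ^+ 2) + 2 * tl <= 0.

Definition small_step (n : nat) : set T :=
  [set w | 0 < Ssum X n w /\ X n.-1 w <= v].
Definition crossing (n : nat) : set T := [set w | y <= Hproc k n w].
Definition pot (n : nat) (w : T) : R := expR (h * (Hproc k n w - y)).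

Lemma past_measurable_small_step n : measurable (small_step n.+1 : set (past X n.+1)).
Proof.
apply: measurableI.
  by apply: past_measurable_gt0; exact: measurable_Ssum.
apply: (measurable_set_le (f := X n)); exact: past_measurable_X.
Qed.

Lemma past_measurable_crossing n : measurable (crossing n : set (past X n)).
Proof. by apply: measurable_set_ge; exact: measurable_Hproc. Qed.

Lemma past_measurable_pot n : measurable_fun setT (pot n : past X n -> R).
Proof.
apply: measurableT_comp => //; apply: measurable_funM => //.
by apply: measurable_funB => //; exact: measurable_Hproc.
Qed.

Lemma measurable_pot n : measurable_fun setT (pot n).
Proof.
by move=> mT A mA; apply: (past_measurable (X := X) (k := n)); exact: past_measurable_pot.
Qed.

Lemma pot_ge0 n w : 0 <= pot n w.
Proof. exact: expR_ge0. Qed.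

Lemma potS n w : X n w <= v ->
  trunc_exp_inc a k h v (area X n w) (Ssum X n w) (X n w) * pot n w = pot n.+1 w.
Proof.
move=> Xv; rewrite /trunc_exp_inc Xv /pot -expRD; congr expR.
by rewrite /Hinc /Hproc areaS SsumS; ring.
Qed.

Definition pot_kernel (z : R * R * R) : R :=
  trunc_exp_inc a k h v z.1.1 z.1.2 z.2 * expR (h * (Hfun a k z.1.1 z.1.2 - y)).

Lemma measurable_exp_Hfun :
  measurable_fun setT (fun z : R * R * R => expR (h * (Hfun a k z.1.1 z.1.2 - y))).
Proof.
apply: measurableT_comp => //; apply: measurable_funM => //; apply: measurable_funB => //.
apply: (measurableT_comp (measurable_Hfun a k) (g := fun z : R * R * R => z.1)).
exact: measurable_fst.
Qed.

Lemma measurable_pot_kernel : measurable_fun setT pot_kernel.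
Proof.
by apply: measurable_funM; [exact: measurable_trunc_exp_inc|exact: measurable_exp_Hfun].
Qed.

Lemma pot_kernel_ge0 z : 0 <= pot_kernel z.
Proof. by rewrite mulr_ge0 ?trunc_exp_inc_ge0 ?expR_ge0. Qed.

Lemma trunc_exp_inc_mean_le1 A S : 0 <= A -> 0 <= S -> Hfun a k A S < y ->
  (\int[mu]_u (trunc_exp_inc a k h v A S u)%:E <= 1%:E)%E.
Proof.
move=> A0 S0 Hy; apply: (integral_trunc_exp_inc_le1 a_gt0 int1 mean int2 mom2 k_gt0 h_gt0
  ha v_ge0 A0 S0 tail).
by apply: drift => //; exact: Hfun_gt0.
Qed.

Lemma integral_pot_kernel n w : 0 <= area X n w -> 0 <= Ssum X n w -> Hproc k n w < y ->
  (\int[mu]_u (pot_kernel ((area X n w, Ssum X n w), u))%:E <= (pot n w)%:E)%E.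
Proof.
move=> A0 S0 Hy; rewrite /pot_kernel/=.
under eq_integral do rewrite EFinM muleC.
rewrite ge0_integralZl//.
- rewrite -[leRHS]mule1 lee_wpmul2l ?lee_fin ?expR_ge0//.
  exact: trunc_exp_inc_mean_le1.
- by apply/measurable_EFinP; exact: measurable_trunc_exp_inc1.
- by move=> u _; rewrite lee_fin trunc_exp_inc_ge0.
Qed.

Section From.
Variables (n0 : nat) (G : set T).
Hypothesis mG : measurable (G : set (past X n0)).
Hypothesis G_ge0 : forall w, G w -> 0 <= Ssum X n0 w /\ 0 <= area X n0 w.

Lemma uncrossed_ge0 n w : (n0 <= n)%N -> uncrossed n0 G small_step crossing n w ->
  0 <= Ssum X n w /\ 0 <= area X n w.
Proof.
move=> n0n [Gw hB _]; move: hB; rewrite -(subnKC n0n).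
elim: (n - n0)%N => [|j IH] hB; first by rewrite addn0; exact: G_ge0.
rewrite addnS in hB *.
have [|Sj Aj] := IH.
  by move=> i /andP[i1 i2]; apply: hB; rewrite i1 leqW.
rewrite areaS addr_ge0//; split=> //; apply/ltW.
by have [] := hB (n0 + j).+1; rewrite ?leqnn ?ltnS ?leq_addr.
Qed.

Lemma hitting_bound n : (n0 <= n)%N ->
  (P (crossed n0 G small_step crossing n) <= \int[P]_(w in G) (pot n0 w)%:E)%E.
Proof.
move=> n0n; have h0 := h_gt0.
have mB i : (n0 < i <= n)%N -> measurable (small_step i : set (past X i)).
  by case: i => // i _; exact: past_measurable_small_step.
have mC i : (n0 <= i <= n)%N -> measurable (crossing i : set (past X i)).
  by move=> _; exact: past_measurable_crossing.
apply: (maximal_inequality n0n mG mB mC (V := pot)); last by rewrite n0n leqnn.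
- by move=> i w _; exact: pot_ge0.
- by move=> i _; exact: past_measurable_pot.
- move=> w _ Cw; rewrite -expR0 ler_expR mulr_ge0 ?subr_ge0//; exact: ltW.
- by move=> w _; exact: pot_ge0.
move=> i /andP[n0i iN].
have mU : measurable (uncrossed n0 G small_step crossing i : set (past X i)).
  by apply: (past_measurable_uncrossed n0n mG mB mC); rewrite n0i ltnW.
have mU' : measurable (uncrossed n0 G small_step crossing i.+1 : set (past X i.+1)).
  by apply: (past_measurable_uncrossed n0n mG mB mC); rewrite leqW.
have mBC : measurable (uncrossed n0 G small_step crossing i `&` small_step i.+1
    `&` crossing i.+1).
  apply: (@past_measurable _ _ _ _ X i.+1).
  apply: measurableI; last exact: past_measurable_crossing.
  apply: measurableI; last exact: past_measurable_small_step.
  exact: past_measurableS.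
rewrite -[X in (_ + X)%E]mul1e -(integral_cst P mBC 1).
apply: (potential_step (k := i) iidX mU _ mBC _ _
  (Y := fun w => (area X i w, Ssum X i w)) (f := pot_kernel)).
- exact: past_measurable mU'.
- by rewrite uncrossedS// => w [[]].
- by move=> w [[]].
- by apply: measurable_fun_pair; [exact: measurable_area|exact: measurable_Ssum].
- exact: measurable_pot_kernel.
- exact: pot_kernel_ge0.
- exact: measurable_pot.
- exact: measurable_pot.
- by [].
- by move=> w _; exact: pot_ge0.
- by [].
- move=> w Uw; have [S0 A0] := uncrossed_ge0 n0i Uw.
  apply: integral_pot_kernel => //.
  case: Uw => _ _ /(_ i); rewrite n0i leqnn => /(_ isT).
  by rewrite /crossing/= ltNge => /negP.
move=> w Uw; rewrite !patchE.
case: ifPn => [/set_mem|_].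
  rewrite uncrossedS// => -[[_ [_ Xv]] nC].
  by rewrite memNset ?addr0; [rewrite -potS|move=> [_]].
case: ifPn => [/set_mem [[_ [_ Xv]] Cw]|_]; last by rewrite addr0 pot_kernel_ge0.
rewrite add0r; apply: (@le_trans _ _ (pot i.+1 w)); last by rewrite -potS.
by rewrite -expR0 ler_expR mulr_ge0 ?subr_ge0// ltW.
Qed.

End From.

Variable D : R.
Hypothesis D_gt0 : 0 < D.
Hypothesis tilt : 3 * h * a + (3 * h + 3 * h * a + (2 * D)^-1) * m2 + 2 * v * tl
  <= 3 / 4 * a.

Local Notation U := (uncrossed 0 setT small_step crossing).

Lemma past_measurable_U n : measurable (U n : set (past X n)).
Proof.
apply: (past_measurable_uncrossed (leq0n n)); last by rewrite leqnn.
- exact: measurableT.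
- by case=> // i _; exact: past_measurable_small_step.
- by move=> i _; exact: past_measurable_crossing.
Qed.

Lemma U_ge0 n w : U n w -> 0 <= Ssum X n w /\ 0 <= area X n w.
Proof.
apply: uncrossed_ge0 => // w' _.
by rewrite Ssum0 area0.
Qed.

Lemma sum_uncrossed_pot n :
  ((a / 4)%:E * \sum_(0 <= i < n) \int[P]_(w in U i) (pot i w)%:E
    <= (D * expR (h * (Hfun a k 0 0 - y)))%:E)%E.
Proof.
have a0 := a_gt0; have D0 := D_gt0.
pose W n w := (Ssum X n w + D) * pot n w.
have mW i : measurable_fun setT (W i : past X i -> R).
  apply: measurable_funM; last exact: past_measurable_pot.
  by apply: measurable_funD => //; exact: measurable_Ssum.
have W0 i w : U i w -> 0 <= W i w.
  by move=> /U_ge0[S0 _]; rewrite mulr_ge0 ?pot_ge0// addr_ge0// ltW.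
have mU0 i : measurable (U i).
  by apply: (past_measurable (X := X) (k := i)); exact: past_measurable_U.
have mp0 i := measurable_pot i.
have mW0 i : measurable_fun setT (W i).
  by move=> mT A mA; apply: (past_measurable (X := X) (k := i)); exact: mW.
have base : (\int[P]_(w in U 0) (W 0 w)%:E <= (D * expR (h * (Hfun a k 0 0 - y)))%:E)%E.
  have WE w : W 0 w = D * expR (h * (Hfun a k 0 0 - y)).
    by rewrite /W /pot /Hproc area0 Ssum0 add0r.
  under eq_integral do rewrite WE.
  rewrite integral_cst// -[leRHS]mule1 lee_wpmul2l ?probability_le1//.
  by rewrite lee_fin mulr_ge0 ?expR_ge0// ltW.
suff main : ((a / 4)%:E * \sum_(0 <= i < n) \int[P]_(w in U i) (pot i w)%:E
    + \int[P]_(w in U n) (W n w)%:E <= \int[P]_(w in U 0) (W 0 w)%:E)%E.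
  apply: le_trans base; apply: le_trans main; rewrite leeDl//.
  by apply: integral_ge0 => w /W0; rewrite lee_fin.
elim: n => [|i IH]; first by rewrite big_nil mule0 add0e.
apply: le_trans IH.
have I0 j : (0 <= \int[P]_(w in U j) (pot j w)%:E)%E.
  by apply: integral_ge0 => w _; rewrite lee_fin pot_ge0.
rewrite (big_nat_recr i 0%N); last by [].
rewrite ge0_muleDr; [|exact: sume_ge0|exact: I0].
rewrite -addeA leeD2l// addeC.
rewrite -ge0_integralZl//; last 3 first.
- by apply/measurable_EFinP; exact: measurable_funTS.
- by move=> w _; rewrite lee_fin pot_ge0.
- by rewrite lee_fin divr_ge0// ltW.
apply: (@le_trans _ _ (\int[P]_(w in U i.+1) (W i.+1 w)%:E +
   \int[P]_(w in U i) (a / 4 * pot i w)%:E)%E).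
  by rewrite leeD2l//; under eq_integral do rewrite -EFinM.
pose f (z : R * R * R) := (Num.max (z.1.2 + z.2 + D) 0
   * trunc_exp_inc a k h v z.1.1 z.1.2 z.2 + a / 4) * expR (h * (Hfun a k z.1.1 z.1.2 - y)).
have mf : measurable_fun setT f.
  apply: measurable_funM; last exact: measurable_exp_Hfun.
  apply: measurable_funD => //.
  apply: measurable_funM; last exact: measurable_trunc_exp_inc.
  apply: measurable_maxr => //; apply: measurable_funD => //.
  by apply: measurable_funD => //; exact: measurableT_comp.
have mx0 x : 0 <= Num.max x 0 :> R by rewrite le_max lexx orbT.
have f0 z : 0 <= f z.
  rewrite mulr_ge0 ?expR_ge0// addr_ge0//; first by rewrite mulr_ge0// trunc_exp_inc_ge0.
  by rewrite divr_ge0// ltW.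
have mUi : measurable (U i : set (past X i)) by exact: past_measurable_U.
have mUi1 := mU0 i.+1; have mUi' := mU0 i.
apply: (potential_step (k := i) iidX mUi mUi1 mUi' _ _
  (Y := fun w => (area X i w, Ssum X i w)) (f := f) (V := W i) (V1 := W i.+1)
  (V2 := fun w => a / 4 * pot i w)) => //.
- by rewrite uncrossedS// => w [[]].
- by apply: measurable_fun_pair; [exact: measurable_area|exact: measurable_Ssum].
- exact: measurable_funM.
- by move=> w; exact: W0.
- by move=> w _; rewrite mulr_ge0 ?pot_ge0// divr_ge0// ltW.
- move=> w Uw; have [S0 A0] := U_ge0 Uw.
  have Hy : Hproc k i w < y.
    case: Uw => _ _ /(_ i); rewrite leq0n leqnn => /(_ isT).
    by rewrite /crossing/= ltNge => /negP.
  rewrite /f/=; under eq_integral do rewrite EFinM muleC.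
  have mt := measurable_trunc_exp_inc1 a k h v (area X i w) (Ssum X i w).
  have mM : measurable_fun setT (fun u => (Num.max (Ssum X i w + u + D) 0
      * trunc_exp_inc a k h v (area X i w) (Ssum X i w) u)%:E).
    apply/measurable_EFinP; apply: measurable_funM => //.
    by apply: measurable_maxr => //; apply: measurable_funD => //; exact: measurable_funD.
  have M0 u : (0 <= (Num.max (Ssum X i w + u + D) 0
      * trunc_exp_inc a k h v (area X i w) (Ssum X i w) u)%:E)%E.
    by rewrite lee_fin mulr_ge0// trunc_exp_inc_ge0.
  under eq_integral do rewrite EFinD.
  rewrite ge0_integralZl//; last 2 first.
  + exact: emeasurable_funD.
  + by move=> u _; rewrite adde_ge0// lee_fin divr_ge0// ltW.
  rewrite ge0_integralD//; last by move=> u _; rewrite lee_fin divr_ge0// ltW.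
  rewrite integral_cst// [X in ((a / 4)%:E * X)%E](_ : _ = 1%E) ?mule1; last first.
    exact: probability_setT.
  rewrite (_ : (W i w)%:E = ((pot i w)%:E * (Ssum X i w + D)%:E)%E); last first.
    by rewrite -EFinM mulrC.
  rewrite lee_wpmul2l ?lee_fin ?expR_ge0//.
  have := integral_tilted_inc a_gt0 int1 mean int2 mom2 k_gt0 h_gt0 ha v_ge0 A0 S0 tail
    (drift (Hfun_gt0 a_gt0 k_gt0 A0 S0) Hy) D_gt0 tilt.
  move=> /(leeD2r (a / 4)%:E); move=> /le_trans; apply.
  by rewrite -EFinD lee_fin; lra.
move=> w Uw; rewrite !patchE (mem_set Uw).
rewrite /f/= mulrDl lerD2r.
case: ifPn => [/set_mem|_]; last by rewrite !mulr_ge0 ?expR_ge0// trunc_exp_inc_ge0.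
rewrite uncrossedS// => -[[_ [S1 Xv]] _].
rewrite /W -potS// mulrA ler_wpM2r ?expR_ge0// ler_wpM2r ?trunc_exp_inc_ge0//.
by rewrite SsumS le_max lexx.
Qed.

End Hitting.

(** * Upper bounds with a given tilt *)

Section UpperBound.
Context {d : measure_display} {T : measurableType d} {R : realType}.
Variables (P : probability T R) (X : nat -> {RV P >-> R}).
Hypothesis iidX : iid X.

Local Notation mu := (distribution P (X 0%N)).

Variables (a m2 : R).
Hypothesis a_gt0 : 0 < a.
Hypothesis int1 : mu.-integrable setT (fun u : R => u%:E).
Hypothesis mean : (\int[mu]_u u%:E = (- a)%:E)%E.
Hypothesis int2 : mu.-integrable setT (fun u : R => (u ^+ 2)%:E).
Hypothesis mom2 : (\int[mu]_u (u ^+ 2)%:E = m2%:E)%E.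

Local Notation pos := (positive_until X).

Lemma m2_ge0 : 0 <= m2.
Proof.
by rewrite -lee_fin -mom2; apply: integral_ge0 => u _; rewrite lee_fin sqr_ge0.
Qed.

Let mpos i : measurable (pos i : set (past X i)).
Proof. exact: past_measurable_positive_until. Qed.

Let mpos0 i : measurable (pos i).
Proof. exact: measurable_positive_until. Qed.

Definition tau_bound : R := (2 / a) * (m2 / (2 * a) + 1).

Lemma tau_bound_ge0 : 0 <= tau_bound.
Proof.
have a0 := ltW a_gt0; have m0 := m2_ge0.
by rewrite mulr_ge0 ?divr_ge0// addr_ge0 ?divr_ge0// mulr_ge0.
Qed.

Lemma sum_positive_until n :
  (\sum_(0 <= i < n) P (pos i) <= tau_bound%:E)%E.
Proof.
have a0 := a_gt0; have a0' := ltW a0; have m0 := m2_ge0.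
set D := m2 / (2 * a) + 1.
have D0 : 0 < D by rewrite ltr_wpDl// divr_ge0// mulr_ge0.
pose V n w := Ssum X n w + D.
have V0 i w : pos i w -> 0 <= V i w.
  by move=> pw; rewrite addr_ge0 ?(ltW D0)// (positive_until_ge0 pw).
have mV i : measurable_fun setT (V i).
  apply: measurable_funD => //; apply: (past_measurable_fun (X := X) (k := i)).
  exact: measurable_Ssum.
have base : (\int[P]_(w in pos 0) (V 0 w)%:E <= D%:E)%E.
  under eq_integral do rewrite /V Ssum0 add0r.
  by rewrite integral_cst// -[leRHS]mule1 lee_wpmul2l ?probability_le1// lee_fin ltW.
suff main : ((a / 2)%:E * \sum_(0 <= i < n) P (pos i)
    + \int[P]_(w in pos n) (V n w)%:E <= \int[P]_(w in pos 0) (V 0 w)%:E)%E.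
  have {}main : ((a / 2)%:E * \sum_(0 <= i < n) P (pos i) <= D%:E)%E.
    apply: le_trans base; apply: le_trans main; rewrite leeDl//.
    by apply: integral_ge0 => w /V0; rewrite lee_fin.
  have -> : tau_bound%:E = ((2 / a)%:E * D%:E)%E by rewrite -EFinM.
  rewrite -[leLHS]mul1e.
  have -> : (1 = (2 / a)%:E * (a / 2)%:E :> \bar R)%E.
    by rewrite -EFinM; congr (_%:E); field; rewrite gt_eqF.
  by rewrite -muleA lee_wpmul2l// lee_fin divr_ge0.
elim: n => [|i IH]; first by rewrite big_nil mule0 add0e.
apply: le_trans IH.
rewrite big_nat_recr//= ge0_muleDr//; last exact: sume_ge0.
rewrite -addeA leeD2l// addeC.
have <- : (\int[P]_(w in pos i) (cst (a / 2) w)%:E = (a / 2)%:E * P (pos i))%E.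
  exact: (integral_cst P (mpos0 i) (a / 2)%:E).
pose f (z : R * R) := Num.max (z.1 + z.2 + D) 0 + a / 2.
have mx0 x : 0 <= Num.max x 0 :> R by rewrite le_max lexx orbT.
have f0 z : 0 <= f z by rewrite addr_ge0 ?divr_ge0.
have ms i' : measurable_fun setT (Ssum X i' : past X i' -> R) by exact: measurable_Ssum.
apply: (potential_step (k := i) iidX (@mpos i) (mpos0 i.+1) (mpos0 i) _ _
  (Y := Ssum X i) (f := f) (V := V i) (V1 := V i.+1) (V2 := cst (a / 2))) => //.
- exact: positive_until_le.
- apply: measurable_funD => //; apply: measurable_maxr => //.
  by apply: measurable_funD => //; exact: measurable_funD.
- by move=> w; exact: V0.
- by move=> w _; rewrite divr_ge0.
- move=> w pw; have S0 := positive_until_ge0 pw (leqnn i).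
  apply: (@le_trans _ _ (Ssum X i w + D + a / 2 - 1 * a + (4 * D)^-1 * m2 + 0 * 0)%:E).
    apply: (integral_le_quad_trunc int1 mean int2 mom2 (h := 0) (b := 0) (w := 0)) => //.
    + apply: measurable_funD => //; apply: measurable_maxr => //=.
      by apply: measurable_funD => //; exact: measurable_funD.
    + move=> u; rewrite mul0r addr0 mul1r.
      suff : Num.max (Ssum X i w + u + D) 0 <= Ssum X i w + D + u + (4 * D)^-1 * u ^+ 2.
        by rewrite /f/=; lra.
      have am : - u <= D + (4 * D)^-1 * u ^+ 2.
        have -> : D + (4 * D)^-1 * u ^+ 2 = - u + (4 * D)^-1 * (2 * D + u) ^+ 2.
          by field; rewrite gt_eqF.
        by rewrite lerDl mulr_ge0 ?sqr_ge0// invr_ge0; lra.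
      have p : 0 <= (4 * D)^-1 * u ^+ 2 by rewrite mulr_ge0 ?sqr_ge0// invr_ge0; lra.
      by rewrite ge_max; apply/andP; split; lra.
    + by move=> u u1 u2; move: (lt_le_trans u1 u2); rewrite ltxx.
    + rewrite (eq_integral (cst 0%E)) ?integral0// => u _.
      by rewrite exp_truncE; case: ltP => //= u0; rewrite leNgt u0.
  rewrite lee_fin mul0r addr0 mul1r.
  have : (4 * D)^-1 * m2 <= a / 2.
    rewrite mulrC ler_pdivrMr; last lra.
    have : m2 = (m2 / (2 * a)) * (2 * a) by field; rewrite gt_eqF.
    rewrite /D; set q := m2 / (2 * a) => ->; nra.
  rewrite /V; lra.
move=> w pw; rewrite !patchE (mem_set pw) /f/= lerD2r.
case: ifPn => [_|//]; by rewrite /V SsumS le_max lexx.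
Qed.

Lemma positive_until_small n : (P (pos n) <= (tau_bound / n.+1%:R)%:E)%E.
Proof.
pose p i := fine (P (pos i)).
have pE i : P (pos i) = (p i)%:E by rewrite fineK// fin_num_measure.
have := sum_positive_until n.+1; under eq_bigr do rewrite pE.
rewrite sumEFin pE !lee_fin ler_pdivlMr ?ltr0n// => /(le_trans _); apply.
rewrite mulr_natr -[n.+1 in leLHS]subn0 -sumr_const_nat.
rewrite !big_nat; apply: ler_sum => i /andP[_ ni].
rewrite -lee_fin -!pE; apply: le_measure; rewrite ?inE//.
by apply: positive_until_le.
Qed.

Definition jump (i : nat) (y : R) : set T := [set w | y < X i w].

Lemma jumpE i y : jump i y = X i @^-1` `]y, +oo[%classic.
Proof. by apply/seteqP; split=> w /=; rewrite /jump/= in_itv/= andbT. Qed.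

Lemma big_jump i y : P (pos i `&` jump i y) = (P (pos i) * (utail mu y)%:E)%E.
Proof.
rewrite jumpE past_indep//; congr (_ * _)%E.
rewrite -utailE.
by have := iidX.2 i `]y, +oo[%classic (measurable_itv _); rewrite /distribution/= /pushforward.
Qed.

Lemma sum_big_jump n y :
  (\sum_(0 <= i < n) P (pos i `&` jump i y) <= (tau_bound * utail mu y)%:E)%E.
Proof.
under eq_bigr do rewrite big_jump.
rewrite -ge0_sume_distrl// EFinM lee_wpmul2r ?lee_fin ?utail_ge0//.
exact: sum_positive_until.
Qed.

Definition hits (k y : R) (n : nat) : set T :=
  [set w | exists m, [/\ (m <= n)%N, pos m w & y <= Hproc X a k m w]].

Lemma Atau_gt_hits k x n w : a <= k -> 0 <= x -> (x%:E < Atau X w)%E ->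
  pos n w \/ hits k (Num.sqrt (2 * a * x)) n w.
Proof.
move=> ak x0 /Atau_gtP[h|[m [pm xA]]]; first by left.
have [nm|mn] := leqP n m; first by left; exact: positive_until_le pm.
right; exists m; split=> //; first exact: ltnW.
have a0 := a_gt0; have k0 : 0 < k by lra.
have A0 : 0 <= area X m w by exact: positive_until_area_ge0 pm _.
have S0 : 0 <= Ssum X m w by exact: positive_until_ge0 pm _.
rewrite -(@ler_pXn2r _ 2)// ?nnegrE ?sqrtr_ge0//.
rewrite sqr_sqrtr; last by rewrite !mulr_ge0// ltW.
rewrite /Hproc Hfun_sqr//.
rewrite areaS in xA.
have h1 : a * x <= a * (area X m w + Ssum X m w) by rewrite ler_pM2l// ltW.
have h2 : a * Ssum X m w <= k * Ssum X m w by rewrite ler_wpM2r.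
have := sqr_ge0 (Ssum X m w); have := sqr_ge0 k.
rewrite sqrrD; lra.
Qed.

Local Notation avoid v k y := (crossed 0 setT (small_step X v) (crossing X a k y)).
Local Notation U v k y := (uncrossed 0 setT (small_step X v) (crossing X a k y)).

Definition first_jump (v k y : R) (i : nat) : set T :=
  U v k y i `&` [set w | v < X i w] `&` small_step X y i.+1.

Lemma hits_sub v k y n :
  hits k y n `<=` \bigcup_(i < n) (pos i `&` jump i y) `|` avoid v k y n
    `|` \bigcup_(i < n)
      crossed i.+1 (first_jump v k y i) (small_step X y) (crossing X a k y) n.
Proof.
move=> w [m [mn pm Hm]].
have [[j [jm Xj]]|noj] := pselect (exists j, (j < m)%N /\ y < X j w).
  left; left; exists j => /=; first exact: leq_trans jm mn.
  by split=> //; apply: positive_until_le pm; exact: ltnW.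
have Xy j : (j < m)%N -> X j w <= y.
  by move=> jm; rewrite leNgt; apply/negP => h; apply: noj; exists j.
have [exi|noi] := pselect (exists i, (i < m)%N && (v < X i w)); last first.
  left; right; split=> //; exists m; split=> //; case=> [//|i] im.
  split; first exact: pm.
  by rewrite /= leNgt; apply/negP => h; apply: noi; exists i; rewrite h andbT.
case: (ex_minnP exi) => i /andP[im vX] imin.
have Xv j : (j < i)%N -> X j w <= v.
  move=> ji; rewrite leNgt; apply/negP => h; have := imin j.
  by rewrite (ltn_trans ji im) h leqNgt ji => /(_ isT).
have [[j [ji Hj]]|noH] := pselect (exists j, (j <= i)%N /\ y <= Hproc X a k j w).
  left; right; split=> //; exists j; split=> //.
    by rewrite /= (leq_trans ji)// (leq_trans (ltnW im)).
  case=> [//|l] lj; split; last by apply: Xv; exact: leq_trans lj ji.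
  by apply: pm; rewrite /= (leq_trans lj)// (leq_trans ji)// ltnW.
right; exists i => /=; first exact: leq_trans im mn.
split.
  split; first split.
  - split=> //.
      case=> [//|l] /= li; split; last exact: Xv.
      by apply: pm; rewrite /= (leq_trans li)// ltnW.
    by move=> j /= ji Cj; apply: noH; exists j.
  - exact: vX.
  - by split; [apply: pm; rewrite /= im|exact: Xy].
exists m; split=> //; first by rewrite im mn.
case=> [//|l] /andP[_ lm]; split; last exact: Xy.
by apply: pm.
Qed.

Lemma measurable_hits k y n : measurable (hits k y n).
Proof.
rewrite (_ : hits k y n = \bigcup_(m < n.+1) (pos m `&` crossing X a k y m)).
  apply: bigcup_measurable => m _; apply: measurableI; first exact: mpos0.
  by apply: (past_measurable (X := X) (k := m)); exact: past_measurable_crossing.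
apply/seteqP; split=> w /= [m].
  by move=> [mn pm Hm]; exists m.
by move=> mn [pm Hm]; exists m.
Qed.

Definition admissible (k h v y tl : R) : Prop :=
  [/\ 0 < h, h * a <= 2^-1, 0 <= v,
    (\int[mu]_u (exp_trunc h (2 * h)^-1 v u)%:E <= tl%:E)%E &
    forall H, 0 < H -> H < y ->
      h * (m2 - 2 * a * k) / (2 * H) + 4 * h ^+ 2 * (m2 + a ^+ 2) + 2 * tl <= 0].

Lemma measurable_avoid v k y n : measurable (avoid v k y n).
Proof.
apply: (measurable_crossed (X := X) (leq0n n)); last by rewrite leqnn.
- exact: measurableT.
- by case=> // i _; exact: past_measurable_small_step.
- by move=> i _; exact: past_measurable_crossing.
Qed.

Lemma avoid_bound k h v y tl n : 0 < k -> admissible k h v y tl ->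
  (P (avoid v k y n) <= (expR (h * (k - y)))%:E)%E.
Proof.
move=> k0 [h0 ha v0 tail drift].
have H0 : Hfun a k 0 0 = k.
  by rewrite /Hfun mulr0 !add0r max_l ?(ltW k0)// sqrtr_sqr gtr0_norm.
apply: (le_trans (hitting_bound iidX a_gt0 int1 mean int2 mom2 k0 h0 ha v0 tail drift
  (n0 := 0) (G := setT) measurableT _ (leq0n n))).
  by move=> w _; rewrite Ssum0 area0.
have WE w : pot X a k h y 0 w = expR (h * (k - y)).
  by rewrite /pot /Hproc area0 Ssum0 H0.
under eq_integral do rewrite WE.
by rewrite integral_cst// -[leRHS]mule1 lee_wpmul2l ?probability_le1// lee_fin expR_ge0.
Qed.

Lemma measurable_big_jumps n y : measurable (\bigcup_(i < n) (pos i `&` jump i y)).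
Proof.
apply: bigcup_measurable => i _; apply: measurableI; first exact: mpos0.
by rewrite jumpE; exact: measurable_funPTI.
Qed.

Lemma big_jumps_bound n y :
  (P (\bigcup_(i < n) (pos i `&` jump i y)) <= (tau_bound * utail mu y)%:E)%E.
Proof.
apply: le_trans (sum_big_jump n y).
rewrite bigcup_mkord big_mkord.
apply: (Boole_inequality P (A := fun i => pos i `&` jump i y)) => i _.
apply: measurableI; first exact: mpos0.
by rewrite jumpE; exact: measurable_funPTI.
Qed.

Lemma hits_bound k h y tl n : 0 < k -> admissible k h y y tl ->
  (P (hits k y n) <= (tau_bound * utail mu y + expR (h * (k - y)))%:E)%E.
Proof.
move=> k0 adm.
apply: (@le_trans _ _ (P (\bigcup_(i < n) (pos i `&` jump i y) `|` avoid y k y n))).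
  apply: le_measure; rewrite ?inE; first exact: measurable_hits.
    by apply: measurableU; [exact: measurable_big_jumps|exact: measurable_avoid].
  move=> w /(@hits_sub y)[//|[i _ [[[_ vX] [_ Xy]] _]]].
  by move: vX Xy; rewrite /= leNgt => ->.
rewrite EFinD; apply: (le_trans (measureU2 _ _ _)).
- exact: measurable_big_jumps.
- exact: measurable_avoid.
by apply: leeD; [exact: big_jumps_bound|exact: avoid_bound adm].
Qed.

Section FirstJump.
Variables (k h h' v y tl tl' pl D : R).
Hypotheses (k_gt0 : 0 < k) (vy : v <= y).
Hypotheses (adm : admissible k h y y tl) (adm' : admissible k h' v y tl').
Hypothesis large : (\int[mu]_u (exp_trunc h v y u)%:E <= pl%:E)%E.
Hypothesis D_gt0 : 0 < D.
Hypothesis tilt : 3 * h * a + (3 * h + 3 * h * a + (2 * D)^-1) * m2 + 2 * v * tl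
  <= 3 / 4 * a.

Lemma admissible_sub : admissible k h v y tl.
Proof.
have [h0 ha y0 tail drift] := adm; have [_ _ v0 _ _] := adm'.
split=> //; apply: le_trans tail; apply: ge0_le_integral => //.
- by move=> u _; rewrite lee_fin exp_trunc_ge0.
- by apply/measurable_EFinP; exact: measurable_exp_trunc.
- by apply/measurable_EFinP; exact: measurable_exp_trunc.
move=> u _; rewrite lee_fin !exp_truncE.
case: ifPn => [/andP[-> uv]|_] /=; first by rewrite (le_trans uv vy).
by case: ifP => // _; exact: expR_ge0.
Qed.

Lemma past_measurable_first_jump i :
  measurable (first_jump v k y i : set (past X i.+1)).
Proof.
apply: measurableI; last exact: past_measurable_small_step.
apply: measurableI.
  by apply: past_measurableS; exact: past_measurable_U.
rewrite (_ : [set w | _] = setT `&` X i @^-1` `]v, +oo[).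
  have mX : measurable_fun setT (X i : past X i.+1 -> R) by exact: past_measurable_X.
  exact: mX.
by apply/seteqP; split=> w /=; rewrite in_itv/= andbT; [split|case].
Qed.

Lemma first_jump_pot i :
  (\int[P]_(w in first_jump v k y i) (pot X a k h y i.+1 w)%:E
   <= (2 * pl)%:E * \int[P]_(w in U v k y i) (pot X a k h y i w)%:E)%E.
Proof.
have [h0 ha y0 tail drift] := adm; have [_ _ v0 _ _] := adm'.
have pl0 : 0 <= pl.
  rewrite -lee_fin; apply: le_trans large; apply: integral_ge0 => u _.
  by rewrite lee_fin exp_trunc_ge0.
have mU : measurable (U v k y i : set (past X i)) by exact: past_measurable_U.
have mU0 : measurable (U v k y i) by exact: past_measurable mU.
have mp i' : measurable_fun setT (pot X a k h y i') by exact: measurable_pot.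
rewrite -ge0_integralZl//; last 3 first.
- by apply/measurable_EFinP; exact: measurable_funTS.
- by move=> w _; rewrite lee_fin pot_ge0.
- by rewrite lee_fin mulr_ge0.
rewrite -[leLHS]adde0.
have <- : (\int[P]_(w in set0) (cst 0 w)%:E = 0 :> \bar R)%E by rewrite integral_set0.
apply: (@le_trans _ _ (\int[P]_(w in U v k y i) (2 * pl * pot X a k h y i w)%:E)%E);
  last by under [leRHS]eq_integral do rewrite -EFinM.
pose f (z : R * R * R) := 2 * exp_trunc h v y z.2 * expR (h * (Hfun a k z.1.1 z.1.2 - y)).
have f0 z : 0 <= f z by rewrite !mulr_ge0 ?expR_ge0// exp_trunc_ge0.
apply: (potential_step (k := i) iidX mU _ measurable0 _ _
  (Y := fun w => (area X i w, Ssum X i w)) (f := f) (V1 := pot X a k h y i.+1)) => //.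
- by apply: (past_measurable (X := X) (k := i.+1)); exact: past_measurable_first_jump.
- by move=> w [[]].
- by apply: measurable_fun_pair; [exact: measurable_area|exact: measurable_Ssum].
- apply: measurable_funM; last exact: measurable_exp_Hfun.
  apply: measurable_funM => //.
  by apply: (measurableT_comp (measurable_exp_trunc h v y)).
- exact: measurable_funM.
- by move=> w _; exact: pot_ge0.
- move=> w Uw; rewrite /f/=.
  have mt := measurable_exp_trunc h v y.
  under eq_integral do rewrite mulrAC EFinM.
  rewrite ge0_integralZl//; last 2 first.
  + exact/measurable_EFinP.
  + by move=> u _; rewrite lee_fin exp_trunc_ge0.
  rewrite mulrAC [leRHS]EFinM lee_wpmul2l// lee_fin mulr_ge0 ?expR_ge0//.
move=> w Uw; rewrite !patchE in_set0 addr0.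
case: ifPn => [/set_mem [[_ vX] [_ Xy]]|_]; last exact: f0.
have [S0 A0] : 0 <= Ssum X i w /\ 0 <= area X i w.
  apply: (uncrossed_ge0 _ (leq0n i) Uw) => w' _.
  by rewrite Ssum0 area0.
have PS : trunc_exp_inc a k h y (area X i w) (Ssum X i w) (X i w)
    * pot X a k h y i w = pot X a k h y i.+1 w by exact: potS.
rewrite /= in vX; rewrite /= in Xy; rewrite -PS /f/= ler_wpM2r ?expR_ge0//.
rewrite /trunc_exp_inc exp_truncE vX Xy/=.
have d1 := Hinc_le a_gt0 k_gt0 A0 S0 (X i w).
rewrite max_l in d1; last exact/ltW/(le_lt_trans v0).
apply: le_trans (ler_wpM2r (expR_ge0 _) (@expR_half R)).
rewrite -expRD ler_expR.
have : h * Hinc a k (area X i w) (Ssum X i w) (X i w) <= h * (X i w + a).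
  by rewrite ler_pM2l.
lra.
Qed.

Lemma hits_bound_first_jump n :
  (P (hits k y n) <= (tau_bound * utail mu y + expR (h' * (k - y))
     + 8 / a * pl * D * expR (h * (k - y)))%:E)%E.
Proof.
have [h0 ha y0 tail drift] := adm; have [_ _ v0 _ _] := adm'.
have [_ _ _ tailv _] := admissible_sub.
have a0 := a_gt0.
have pl0 : 0 <= pl.
  rewrite -lee_fin; apply: le_trans large; apply: integral_ge0 => u _.
  by rewrite lee_fin exp_trunc_ge0.
pose F i := crossed i.+1 (first_jump v k y i) (small_step X y) (crossing X a k y) n.
have mF i : (i < n)%N -> measurable (F i).
  move=> ni.
  apply: (measurable_crossed (X := X) ni); last by rewrite leqnn andbT.
  - exact: past_measurable_first_jump.
  - by case=> // j _; exact: past_measurable_small_step.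
  - by move=> j _; exact: past_measurable_crossing.
have mbF : measurable (\bigcup_(i < n) F i) by exact: bigcup_measurable.
have mJ := measurable_big_jumps n y; have mN := measurable_avoid v k y n.
apply: (@le_trans _ _ (P (\bigcup_(i < n) (pos i `&` jump i y) `|` avoid v k y n
    `|` \bigcup_(i < n) F i))).
  apply: le_measure; rewrite ?inE; first exact: measurable_hits.
    by apply: measurableU => //; exact: measurableU.
  exact: hits_sub.
apply: (le_trans (measureU2 _ _ _)) => //; first exact: measurableU.
rewrite EFinD; apply: leeD.
  apply: (le_trans (measureU2 _ _ _)) => //.
  by rewrite EFinD; apply: leeD; [exact: big_jumps_bound|exact: avoid_bound adm'].
apply: (@le_trans _ _ (\sum_(0 <= i < n) P (F i))%E).
  by rewrite bigcup_mkord big_mkord; exact: (Boole_inequality P (A := F)).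
apply: (@le_trans _ _ (\sum_(0 <= i < n) (2 * pl)%:E *
    \int[P]_(w in U v k y i) (pot X a k h y i w)%:E)%E).
  rewrite big_nat [leRHS]big_nat; apply: lee_sum => i /andP[_ ni].
  apply: le_trans (first_jump_pot i).
  apply: (hitting_bound iidX a_gt0 int1 mean int2 mom2 k_gt0 h0 ha y0 tail drift) => //.
    exact: past_measurable_first_jump.
  move=> w [[Uw _] [S1 _]]; split; first exact: ltW.
  have [S0 A0] : 0 <= Ssum X i w /\ 0 <= area X i w.
    by apply: (uncrossed_ge0 _ (leq0n i) Uw) => w' _; rewrite Ssum0 area0.
  by rewrite areaS addr_ge0.
rewrite -ge0_sume_distrr; last first.
  by move=> i _; apply: integral_ge0 => w _; rewrite lee_fin pot_ge0.
have := sum_uncrossed_pot iidX a_gt0 int1 mean int2 mom2 k_gt0 h0 ha v0 tailv drift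
  D_gt0 tilt n.
have -> : Hfun a k 0 0 = k.
  by rewrite /Hfun mulr0 !add0r max_l ?(ltW k_gt0)// sqrtr_sqr gtr0_norm.
set s := (\sum_(0 <= i < n) _)%E => hs.
have -> : ((2 * pl)%:E * s = (8 / a * pl)%:E * ((a / 4)%:E * s))%E.
  rewrite muleA -EFinM; congr (_%:E * _)%E; by field; rewrite gt_eqF.
have -> : 8 / a * pl * D * expR (h * (k - y)) = (8 / a * pl) * (D * expR (h * (k - y))).
  by rewrite !mulrA.
rewrite [leRHS]EFinM lee_wpmul2l//.
by rewrite lee_fin mulr_ge0// divr_ge0// ltW.
Qed.

End FirstJump.

Lemma PAtau_gt_le k x b : a <= k -> 0 <= x ->
  (forall n, P (hits k (Num.sqrt (2 * a * x)) n) <= b%:E)%E ->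
  PAtau_gt X x <= b.
Proof.
move=> ak x0 hb.
have mA := measurable_Atau_gt X x.
have PE : P [set w | (x%:E < Atau X w)%E] = (PAtau_gt X x)%:E.
  by rewrite /PAtau_gt fineK// fin_num_measure.
apply/ler_addgt0Pl => e e0.
pose n := Num.trunc (tau_bound / e).
rewrite -lee_fin -PE.
apply: (@le_trans _ _ (P (pos n `|` hits k (Num.sqrt (2 * a * x)) n))).
  apply: le_measure; rewrite ?inE//.
    by apply: measurableU; [exact: mpos0|exact: measurable_hits].
  by move=> w /(Atau_gt_hits n ak x0).
apply: (le_trans (measureU2 _ _ _)).
- exact: mpos0.
- exact: measurable_hits.
rewrite EFinD; apply: leeD; last exact: hb.
apply: (le_trans (positive_until_small n)); rewrite lee_fin.
rewrite ler_pdivrMr ?ltr0n// mulrC -ler_pdivrMr//.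
exact/ltW/truncnS_gt.
Qed.

End UpperBound.

(** * Choice of the tilt *)

Section ExplicitUpperBounds.
Context {d : measure_display} {T : measurableType d} {R : realType}.
Variables (P : probability T R) (X : nat -> {RV P >-> R}).
Hypothesis iidX : iid X.

Local Notation mu := (distribution P (X 0%N)).

Variables (a m2 : R).
Hypothesis a_gt0 : 0 < a.
Hypothesis int1 : mu.-integrable setT (fun u : R => u%:E).
Hypothesis mean : (\int[mu]_u u%:E = (- a)%:E)%E.
Hypothesis int2 : mu.-integrable setT (fun u : R => (u ^+ 2)%:E).
Hypothesis mom2 : (\int[mu]_u (u ^+ 2)%:E = m2%:E)%E.

Variables (g : R -> R) (s0 : R).
Hypothesis g_ge0 : forall x, 0 < x -> 0 <= g x.
Hypothesis g_ratio : forall x y, 0 < x -> x <= y -> g y / y <= g x / x.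
Hypothesis s0_gt0 : 0 < s0.
Hypothesis utail_le : forall s, s0 <= s -> utail mu s <= 2 * expR (- g s) * s ^- 2.

Let m20 : 0 <= m2. Proof. exact: m2_ge0 mom2. Qed.

Lemma drift_from h k y tl B : 0 < h -> 4 * h ^+ 2 * (m2 + a ^+ 2) + 2 * tl <= h * B ->
  0 <= B -> m2 + 2 * y * B <= 2 * a * k ->
  forall H, 0 < H -> H < y ->
  h * (m2 - 2 * a * k) / (2 * H) + 4 * h ^+ 2 * (m2 + a ^+ 2) + 2 * tl <= 0.
Proof.
move=> h0 hB B0 hk H H0 Hy.
have H20 : 0 < 2 * H by rewrite mulr_gt0.
have : h * (m2 - 2 * a * k) / (2 * H) <= - (h * B).
  rewrite ler_pdivrMr//.
  have HB : H * B <= y * B by rewrite ler_wpM2r// ltW.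
  have : h * (m2 - 2 * a * k) <= h * - (2 * (H * B)) by rewrite ler_pM2l//; lra.
  lra.
lra.
Qed.

Lemma slope_le y w : 0 < y -> y <= w -> forall c, 0 <= c ->
  (g w + c) / w * y <= g y + c.
Proof.
move=> y0 yw c c0; have w0 := lt_le_trans y0 yw.
rewrite mulrDl mulrDl; apply: lerD.
  by rewrite -ler_pdivlMr//; exact: g_ratio.
by rewrite -mulrA ler_piMr// mulrC ler_pdivrMr// mul1r.
Qed.

Definition drift_cst : R := 4 * (m2 + a ^+ 2) + (8 * 64).

Lemma admissible_main k y (h := (g y + 1) / y) : 0 < y ->
  h * a <= 2^-1 -> s0 <= (2 * h)^-1 -> m2 + 2 * y * (h * drift_cst) <= 2 * a * k ->
  admissible X a m2 k h y y (64 * expR 1 * h ^+ 2).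
Proof.
move=> y0 ha sh hk.
have h0 : 0 < h by rewrite divr_gt0// ltr_wpDl// g_ge0.
have a0 := sqr_ge0 a; have m0 := m20.
split=> //; first exact: ltW.
  apply: (integral_exp_trunc_tail (g := g) s0_gt0) => // u bu uy.
  have u0 : 0 < u by apply: lt_le_trans bu; rewrite invr_gt0 mulr_gt0.
  exact: slope_le.
apply: (drift_from h0 _ _ hk).
  have e4 := @expR1_le4 R; have h2 := sqr_ge0 h.
  have := ler_wpM2r h2 e4; rewrite /drift_cst; lra.
rewrite mulr_ge0// ?(ltW h0)// /drift_cst; lra.
Qed.

Hypothesis g_small : forall e, 0 < e -> exists y0, forall y, y0 <= y -> g y / y <= e.

Definition tilt_cap : R := Num.min (2 * a)^-1 (Num.min (2 * s0)^-1 1).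
Local Notation e := tilt_cap.

Lemma tilt_cap_gt0 : 0 < e.
Proof. by rewrite !lt_min !invr_gt0 !mulr_gt0//=. Qed.

Lemma small_tilt h : 0 < h -> h <= e -> h * a <= 2^-1 /\ s0 <= (2 * h)^-1.
Proof.
move=> h0; rewrite !le_min => /and3P[h1 h2 _]; split.
  by rewrite -ler_pdivlMr// -invfM.
rewrite -[s0]invrK lef_pV2 ?posrE ?invr_gt0 ?mulr_gt0//.
by rewrite mulrC -ler_pdivlMr// -invfM mulrC.
Qed.

(* The tilt is h = (g y + 1) / y; the drift of H costs a factor of order (h y) ^ 2 / y
   in the exponent. *)
Lemma upper_bound_main : exists C y0, 0 < C /\ forall y x, y0 <= y -> 0 <= x ->
    y = Num.sqrt (2 * a * x) ->
    PAtau_gt X x <= C * expR (- g y + C * (g y ^+ 2 / y)).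
Proof.
have a0 := a_gt0; have m0 := m20; have s00 := s0_gt0; have e0 := tilt_cap_gt0.
have kap0 : 0 <= drift_cst by rewrite /drift_cst; have := sqr_ge0 a; lra.
pose tb := tau_bound a m2.
have tb0 : 0 <= tb by exact: tau_bound_ge0 mom2.
pose c := m2 / (2 * a) + a + 2 * drift_cst / a.
pose C := 2 * tb + expR c + 2 * drift_cst / a.
have q0 : 0 <= drift_cst / a by rewrite divr_ge0// ltW.
have C0 : 0 < C by rewrite /C; have := expR_gt0 c; lra.
have e20 : 0 < e / 2 by lra.
have [y1 hy1] := g_small e20.
exists C, (Num.max y1 (Num.max s0 (Num.max (2 / e) 1))); split=> // y x.
rewrite !ge_max => /and4P[yy1 ys ye y_ge1] x0 yE.
have y0 : 0 < y by lra.
have gy := hy1 _ yy1; have g0 := g_ge0 y0.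
pose h := (g y + 1) / y.
have h0 : 0 < h by rewrite divr_gt0// ltr_wpDl.
have he : h <= e.
  rewrite /h mulrDl mul1r.
  have : y^-1 <= e / 2 by rewrite -[e / 2]invrK lef_pV2 ?posrE ?invr_gt0// invf_div.
  lra.
have [ha sh] := small_tilt h0 he.
have h1 : h <= 1 by apply: (le_trans he); rewrite !ge_min lexx !orbT.
pose k := (m2 + 2 * y * (h * drift_cst)) / (2 * a) + a.
have hk : m2 + 2 * y * (h * drift_cst) <= 2 * a * k.
  have -> : 2 * a * k = m2 + 2 * y * (h * drift_cst) + 2 * a ^+ 2.
    by rewrite /k; field; rewrite gt_eqF.
  by rewrite lerDl mulr_ge0// sqr_ge0.
have ak : a <= k.
  have p : 0 <= h * drift_cst by rewrite mulr_ge0// ltW.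
  have p' : 0 <= y * (h * drift_cst) by rewrite mulr_ge0// ltW.
  by rewrite lerDr divr_ge0//; lra.
have adm := admissible_main y0 ha sh hk.
have k0 : 0 < k by lra.
have hE : h * y = g y + 1 by rewrite /h divfK// gt_eqF.
have gyy : 0 <= g y ^+ 2 / y by rewrite divr_ge0 ?sqr_ge0// ltW.
apply: (@le_trans _ _ (tb * utail mu y + expR (h * (k - y)))).
  apply: (PAtau_gt_le iidX a_gt0 int1 mean int2 mom2 ak x0) => n; rewrite -yE.
  exact: (hits_bound iidX a_gt0 int1 mean int2 mom2 n k0 adm).
have E1 : expR (- g y) <= expR (- g y + C * (g y ^+ 2 / y)).
  by rewrite ler_expR lerDl mulr_ge0// ltW.
have T1 : tb * utail mu y <= 2 * tb * expR (- g y).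
  have y2 : y ^- 2 <= 1 by rewrite invf_le1 ?exprn_gt0// expr_ge1// ltW.
  have p : 0 <= 2 * expR (- g y) by rewrite mulr_ge0// expR_ge0.
  have := ler_wpM2l tb0 (utail_le ys); have := ler_wpM2l tb0 (ler_wpM2l p y2); lra.
have T2 : expR (h * (k - y)) <= expR c * expR (- g y + C * (g y ^+ 2 / y)).
  rewrite -expRD ler_expR mulrBr hE.
  have hhy : h ^+ 2 * y = (g y + 1) ^+ 2 / y by rewrite /h; field; rewrite gt_eqF.
  have hhy2 : (g y + 1) ^+ 2 / y <= 2 * (g y ^+ 2 / y) + 2.
    have -> : 2 * (g y ^+ 2 / y) + 2 = (2 * g y ^+ 2 + 2 * y) / y.
      by field; rewrite gt_eqF.
    by rewrite ler_pM2r ?invr_gt0//; have := sqr_ge0 (g y - 1); lra.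
  have -> : h * k = h * (m2 / (2 * a) + a) + (drift_cst / a) * (h ^+ 2 * y).
    by rewrite /k; field; rewrite gt_eqF.
  have : h * (m2 / (2 * a) + a) <= m2 / (2 * a) + a.
    by rewrite ler_piMl// addr_ge0// ?divr_ge0// ?mulr_ge0// ltW.
  rewrite hhy; have := ler_wpM2l q0 hhy2.
  have CC : 2 * drift_cst / a * (g y ^+ 2 / y) <= C * (g y ^+ 2 / y).
    by rewrite ler_wpM2r// /C; have := expR_gt0 c; lra.
  rewrite /c; lra.
have T3 := ler_wpM2l (mulr_ge0 (ler0n _ 2) tb0) E1.
have T4 : 0 <= 2 * drift_cst / a * expR (- g y + C * (g y ^+ 2 / y)).
  by rewrite mulr_ge0 ?expR_ge0// -mulrA mulr_ge0.
have CE : C = 2 * tb + expR c + 2 * drift_cst / a by [].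
rewrite [X in _ <= X * _]CE 2!mulrDl.
apply: (le_trans (lerD T1 T2)); rewrite -[leLHS]addr0; apply: lerD => //.
exact: lerD.
Qed.

End ExplicitUpperBounds.

Section LogTilt.
Context {R : realType}.
Variables (g : R -> R) (x0 r : R).
Hypothesis g_ge0 : forall x, 0 < x -> 0 <= g x.
Hypothesis g_ratio : forall x y, 0 < x -> x <= y -> g y / y <= g x / x.
Hypothesis g_mono : forall x y, x0 <= x -> x <= y -> g x <= g y.
Hypotheses (r7 : 7 <= r) (xr : x0 <= r) (gyr : g (r ^+ 4) <= r).

Local Notation y := (r ^+ 4).
Local Notation v := (r ^+ 4 / 6).
Local Notation h := ((g y + 1) / y).
Local Notation L := (ln v / 2).
Local Notation h' := ((g v + L) / v).

Let r_gt0 : 0 < r. Proof. by apply: lt_le_trans r7; lra. Qed.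
Let r3_gt0 : 0 < r ^+ 3. Proof. exact: exprn_gt0. Qed.
Let y_gt0 : 0 < y. Proof. exact: exprn_gt0. Qed.
Let v_gt0 : 0 < v. Proof. by rewrite divr_gt0. Qed.

Lemma log_le_cube : r <= r ^+ 3.
Proof.
have r1 : 1 <= r by apply: le_trans r7; lra.
by rewrite exprS ler_peMr ?(ltW r_gt0)// exprn_ege1.
Qed.

Lemma log_level_ge : r <= v.
Proof.
rewrite ler_pdivlMr// exprSr mulrC ler_pM2r//.
by apply: le_trans log_le_cube; have := r7; lra.
Qed.

Lemma log_g_level : g y <= 6 * g v.
Proof.
have vy : v <= y by have := y_gt0; lra.
have := g_ratio v_gt0 vy; rewrite ler_pdivrMr// => /le_trans; apply.
by rewrite le_eqVlt; apply/orP; left; apply/eqP; field; rewrite gt_eqF.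
Qed.

Lemma log_tilt1_gt0 : 0 < h.
Proof. by rewrite divr_gt0// ltr_wpDl// g_ge0. Qed.

Lemma log_tilt1E : h * y = g y + 1.
Proof. by rewrite divfK// gt_eqF. Qed.

Lemma log_tilt1_le : h * r ^+ 3 <= 2.
Proof.
rewrite -(ler_pM2r r_gt0).
have -> : h * r ^+ 3 * r = g y + 1 by rewrite -[RHS]log_tilt1E; set H := h; ring.
have := r7; have := gyr; lra.
Qed.

Lemma log_ln_gt0 : 0 < L.
Proof.
by rewrite divr_gt0// ln_gt0//; apply: lt_le_trans log_level_ge; have := r7; lra.
Qed.

Lemma log_ln_le : L <= 2 * r.
Proof.
have vy : v <= y by have := y_gt0; lra.
have : ln v <= ln y by rewrite ler_ln ?posrE.
have lr : ln r <= r by exact/ltW/ln_sublinear.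
rewrite lnXn// -mulr_natl; lra.
Qed.

Lemma log_tilt2_gt0 : 0 < h'.
Proof. by rewrite divr_gt0// ltr_wpDl ?log_ln_gt0// g_ge0. Qed.

Lemma log_tilt2E : h' * y = 6 * (g v + L).
Proof. by field; rewrite gt_eqF. Qed.

Lemma log_tilt2_le : h' * r ^+ 3 <= 18.
Proof.
rewrite -(ler_pM2r r_gt0).
have -> : h' * r ^+ 3 * r = 6 * (g v + L) by rewrite -[RHS]log_tilt2E; set H := h'; ring.
have gvy : g v <= g y.
  by apply: g_mono; [exact: le_trans log_level_ge|have := y_gt0; lra].
have := log_ln_le; have := gyr; lra.
Qed.

Lemma log_exp_ge1 : 1 <= expR L.
Proof.
by have := ltW log_ln_gt0; rewrite -ler_expR expR0.
Qed.

Lemma log_exp_le : expR L <= r ^+ 2.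
Proof.
rewrite -(@ler_pXn2r _ 2)// ?nnegrE ?expR_ge0 ?exprn_ge0 ?(ltW r_gt0)//.
rewrite -expRM_natl -exprM mulrC divfK// lnK ?posrE//.
by have := y_gt0; lra.
Qed.

Lemma log_cond1 K kp : 0 <= kp -> 2 * kp <= K ->
  y * (h * kp) <= K * r ^+ 3.
Proof.
move=> k0 kK; have c := log_le_cube.
have -> : y * (h * kp) = (h * y) * kp by ring.
rewrite log_tilt1E; apply: (@le_trans _ _ ((2 * r ^+ 3) * kp)).
  by rewrite ler_wpM2r//; have := gyr; have := r7; lra.
have := ler_wpM2r (ltW r3_gt0) kK; lra.
Qed.

Lemma log_cond2 K kp : 0 <= kp -> 18 * kp <= K ->
  y * (h' * expR L * kp) <= K * r ^+ 3.
Proof.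
move=> k0 kK.
have -> : y * (h' * expR L * kp) = (h' * y) * expR L * kp by ring.
have h18 : h' * y <= 18 * r.
  have -> : h' * y = h' * r ^+ 3 * r by set H := h'; ring.
  by rewrite ler_pM2r// log_tilt2_le.
have h0 : 0 <= h' * y by rewrite mulr_ge0// ltW// log_tilt2_gt0.
have := ler_pM h0 (expR_ge0 L) h18 log_exp_le.
have -> : 18 * r * r ^+ 2 = 18 * r ^+ 3 by ring.
move=> /(ler_wpM2r k0) /le_trans; apply.
have := ler_wpM2r (ltW r3_gt0) kK; lra.
Qed.

Lemma log_cond3 (a m2 D : R) : 0 < a -> 0 <= m2 -> D = m2 / a + 1 ->
  6 * (a + m2 + a * m2) + 32 * 64 <= a / 4 * r ->
  3 * h * a + (3 * h + 3 * h * a + (2 * D)^-1) * m2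
    + 2 * v * (64 * expR 1 * h ^+ 2) <= 3 / 4 * a.
Proof.
move=> a0 m0 DE rz.
have D0 : 0 < D by rewrite DE ltr_wpDl// divr_ge0// ltW.
have t1 : (2 * D)^-1 * m2 <= a / 2.
  rewrite mulrC ler_pdivrMr ?mulr_gt0//.
  have -> : a / 2 * (2 * D) = m2 + a by rewrite DE; field; rewrite gt_eqF.
  lra.
have hp := log_tilt1_gt0; have hr := log_tilt1_le; have e4 := @expR1_le4 R.
set H := h in hp hr *.
have H0 := ltW hp.
have hr1 : H * r <= 2 by apply: le_trans hr; rewrite ler_pM2l// log_le_cube.
have vh0 : 0 <= v * H ^+ 2 by rewrite mulr_ge0 ?sqr_ge0// ltW.
have vh : r * (v * H ^+ 2) <= 4.
  apply: (@le_trans _ _ ((H * r ^+ 3) ^+ 2)).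
    have -> : (H * r ^+ 3) ^+ 2 = r ^+ 2 * (y * H ^+ 2) by ring.
    apply: ler_pM => //; first exact: ltW.
      by rewrite expr2 ler_peMr ?(ltW r_gt0)//; have := r7; lra.
    by rewrite ler_wpM2r ?sqr_ge0//; have := y_gt0; lra.
  have p : 0 <= H * r ^+ 3 by rewrite mulr_ge0// ltW.
  have -> : 4 = 2 ^+ 2 :> R by ring.
  by rewrite lerXn2r ?nnegrE.
have p : 0 <= a + m2 + a * m2 by rewrite !addr_ge0 ?mulr_ge0// ltW.
have t2 : H * (3 * (a + m2 + a * m2)) + 2 * (16 * 16 * (v * H ^+ 2)) <= a / 4.
  rewrite -(ler_pM2r r_gt0); apply: le_trans rz.
  have := ler_wpM2r p hr1; move: vh; lra.
have := ler_wpM2r vh0 e4; move: t1 t2; lra.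
Qed.

Lemma log_exponent c t k A : 0 <= t -> 0 <= A -> 0 <= c - A -> k <= A + (c - A) * r ^+ 3 ->
  t * k <= t * r ^+ 3 * c.
Proof.
move=> t0 A0 cA kc; rewrite -mulrA ler_wpM2l//; apply: (le_trans kc).
have : A * 1 <= A * r ^+ 3.
  by rewrite ler_wpM2l// exprn_ege1//; have := r7; lra.
lra.
Qed.

Lemma log_level_pow : expR (- (g v + L) * 6) <= 6 * 36 * (expR (- g y) * y ^- 2).
Proof.
have gy := log_g_level.
apply: (@le_trans _ _ (expR (- g y) * v ^- 3)).
  have -> : v ^- 3 = expR (- (3%:R * ln v)) by rewrite expRN expRM_natl lnK.
  by rewrite -expRD ler_expR; lra.
have : v ^- 3 <= 6 * 36 * y ^- 2.
  have -> : v ^- 3 = 6 * 36 * (y ^- 2 * y^-1) by field; rewrite gt_eqF.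
  have y1 : y^-1 <= 1.
    by rewrite invf_le1// exprn_ege1//; have := r7; lra.
  by rewrite ler_pM2l// ler_piMr// invr_ge0 sqr_ge0.
move=> /(ler_wpM2l (expR_ge0 (- g y))); lra.
Qed.

End LogTilt.

Section LogUpperBound.
Context {d : measure_display} {T : measurableType d} {R : realType}.
Variables (P : probability T R) (X : nat -> {RV P >-> R}).
Hypothesis iidX : iid X.

Local Notation mu := (distribution P (X 0%N)).

Variables (a m2 : R).
Hypothesis a_gt0 : 0 < a.
Hypothesis int1 : mu.-integrable setT (fun u : R => u%:E).
Hypothesis mean : (\int[mu]_u u%:E = (- a)%:E)%E.
Hypothesis int2 : mu.-integrable setT (fun u : R => (u ^+ 2)%:E).
Hypothesis mom2 : (\int[mu]_u (u ^+ 2)%:E = m2%:E)%E.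

Variables (g : R -> R) (s0 : R).
Hypothesis g_ge0 : forall x, 0 < x -> 0 <= g x.
Hypothesis g_ratio : forall x y, 0 < x -> x <= y -> g y / y <= g x / x.
Hypothesis s0_gt0 : 0 < s0.
Hypothesis utail_le : forall s, s0 <= s -> utail mu s <= 2 * expR (- g s) * s ^- 2.
Variable x0 : R.
Hypothesis g_mono : forall x y, x0 <= x -> x <= y -> g x <= g y.

Local Notation e := (tilt_cap a s0).
Local Notation kap := (drift_cst a m2).
Let kap' : R := 4 * (m2 + a ^+ 2) + 128.
Let K : R := 18 * kap' + 2 * kap.
Let A : R := m2 / (2 * a) + a.
Let c : R := A + K / a.
Let D : R := m2 / a + 1.

Section Fixed.
Variable r : R.
Hypotheses (r7 : 7 <= r) (rs : s0 <= r) (rx : x0 <= r) (re : 18 <= r * e).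
Hypothesis (rz : 6 * (a + m2 + a * m2) + 32 * 64 <= a / 4 * r).
Hypothesis gyr : g (r ^+ 4) <= r.

Local Notation y := (r ^+ 4).
Local Notation v := (r ^+ 4 / 6).
Local Notation h := ((g y + 1) / y).
Local Notation L := (ln v / 2).
Local Notation h' := ((g v + L) / v).
Local Notation k := (A + (c - A) * r ^+ 3).
Local Notation pl := (8 * expR 1 * (h * y + 1) * v ^- 2).

Let r_gt0 : 0 < r. Proof. by apply: lt_le_trans r7; lra. Qed.
Let r3_gt0 : 0 < r ^+ 3. Proof. exact: exprn_gt0. Qed.
Let y_gt0 : 0 < y. Proof. exact: exprn_gt0. Qed.
Let v_gt0 : 0 < v. Proof. by rewrite divr_gt0. Qed.
Let vy : v <= y. Proof. by have := y_gt0; lra. Qed.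
Let m0 : 0 <= m2. Proof. exact: m2_ge0 mom2. Qed.
Let kap_ge0 : 0 <= kap. Proof. by rewrite /drift_cst; have := sqr_ge0 a; have := m0; lra. Qed.
Let kap'_ge0 : 0 <= kap'. Proof. by rewrite /kap'; have := sqr_ge0 a; have := m0; lra. Qed.
Let A_ge : a <= A.
Proof. by rewrite /A lerDr divr_ge0// mulr_ge0// ltW. Qed.
Let cA_ge0 : 0 <= c - A.
Proof.
by rewrite /c addrAC subrr add0r divr_ge0 ?(ltW a_gt0)// addr_ge0// mulr_ge0.
Qed.
Let ak : a <= k.
Proof. by rewrite -[a]addr0 lerD// mulr_ge0// ltW. Qed.
Let k_gt0 : 0 < k. Proof. exact: lt_le_trans a_gt0 ak. Qed.
Let akE : 2 * a * k = m2 + 2 * (K * r ^+ 3) + 2 * a ^+ 2.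
Proof. by rewrite /c /A; field; rewrite gt_eqF. Qed.

Let cap (t : R) : t * r ^+ 3 <= 18 -> t <= e.
Proof.
move=> t18; have e0 := tilt_cap_gt0 a_gt0 s0_gt0.
rewrite -(ler_pM2r r3_gt0); apply: (le_trans t18); apply: (le_trans re).
by rewrite mulrC ler_pM2l// (log_le_cube r7).
Qed.

Let h0 : 0 < h := log_tilt1_gt0 g_ge0 r7.
Let h'0 : 0 < h' := log_tilt2_gt0 g_ge0 r7.

Lemma log_admissible1 : admissible X a m2 k h y y (64 * expR 1 * h ^+ 2).
Proof.
have [|ha sh] := small_tilt a_gt0 s0_gt0 h0.
  by apply: cap; apply: (le_trans (log_tilt1_le r7 gyr)); lra.
apply: (admissible_main mom2 g_ge0 g_ratio s0_gt0 utail_le y_gt0 ha sh).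
have kK : 2 * kap <= K by rewrite /K; have := kap'_ge0; lra.
have := log_cond1 r7 gyr kap_ge0 kK; have := sqr_ge0 a; rewrite akE; lra.
Qed.

Lemma log_admissible2 : admissible X a m2 k h' v y (64 * expR L * h' ^+ 2).
Proof.
have [|ha sh] := small_tilt a_gt0 s0_gt0 h'0.
  by apply: cap; exact: (log_tilt2_le g_mono r7 rx gyr).
have s1 := log_exp_ge1 r7.
split=> //; first exact: ltW.
  apply: (integral_exp_trunc_tail (g := g) s0_gt0) => // u bu uv.
  have u0 : 0 < u by apply: lt_le_trans bu; rewrite invr_gt0 mulr_gt0.
  by apply: slope_le => //; exact/ltW/(log_ln_gt0 r7).
have kK : 18 * kap' <= K by rewrite /K; have := kap_ge0; lra.
apply: (drift_from (B := h' * expR L * kap') h'0).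
- have hh := sqr_ge0 h'; have q0 : 0 <= 4 * (m2 + a ^+ 2).
    by have := m0; have := sqr_ge0 a; lra.
  have := ler_peMr (mulr_ge0 hh q0) s1; rewrite /kap'.
  set H := h'; lra.
- by rewrite mulr_ge0// mulr_ge0 ?expR_ge0// ltW.
have := log_cond2 g_ge0 g_mono r7 rx gyr kap'_ge0 kK; have := sqr_ge0 a; rewrite akE; lra.
Qed.

Lemma log_large : (\int[mu]_u (exp_trunc h v y u)%:E <= pl%:E)%E.
Proof.
apply: (integral_exp_trunc_large (g := g) s0_gt0) => // [|u vu uy].
  exact: le_trans (log_level_ge r7).
by apply: slope_le => //; exact: lt_le_trans vu.
Qed.

Lemma log_hits n : (P (hits X a k y n) <= (tau_bound a m2 * utail mu y
   + expR (h' * (k - y)) + 8 / a * pl * D * expR (h * (k - y)))%:E)%E.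
Proof.
have D0 : 0 < D by rewrite ltr_wpDl// divr_ge0// ltW.
exact: (hits_bound_first_jump iidX a_gt0 int1 mean int2 mom2 k_gt0 vy
  log_admissible1 log_admissible2 log_large D0
  (log_cond3 g_ge0 r7 gyr a_gt0 m0 erefl rz) n).
Qed.

Lemma log_exp2 : expR (h' * (k - y)) <= 6 * 36 * expR (18 * c) * (expR (- g y) * y ^- 2).
Proof.
have c0 : 0 <= c by have := A_ge; have := cA_ge0; have := a_gt0; lra.
have A0 : 0 <= A by have := A_ge; have := a_gt0; lra.
have p := log_level_pow g_ratio r7.
have : h' * (k - y) <= 18 * c + - (g v + L) * 6.
  rewrite mulrBr log_tilt2E//.
  have := log_exponent r7 (ltW h'0) A0 cA_ge0 (lexx k).
  have := ler_wpM2r c0 (log_tilt2_le g_mono r7 rx gyr); lra.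
rewrite -ler_expR expRD => /le_trans; apply.
have := ler_wpM2l (expR_ge0 (18 * c)) p; lra.
Qed.

Lemma log_exp1 : expR (h * (k - y)) <= expR (2 * c) * expR (- g y).
Proof.
have c0 : 0 <= c by have := A_ge; have := cA_ge0; have := a_gt0; lra.
have A0 : 0 <= A by have := A_ge; have := a_gt0; lra.
rewrite -expRD ler_expR mulrBr log_tilt1E//.
have := log_exponent r7 (ltW h0) A0 cA_ge0 (lexx k).
have := ler_wpM2r c0 (log_tilt1_le r7 gyr); lra.
Qed.

Lemma log_pl : pl <= 48 * 48 * (1 + g y) * y ^- 2.
Proof.
have g0 := g_ge0 y_gt0; have e4 := @expR1_le4 R.
have y2 : 0 <= y ^- 2 by rewrite invr_ge0 sqr_ge0.
rewrite log_tilt1E//.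
have -> : 8 * expR 1 * (g y + 1 + 1) * v ^- 2 = expR 1 * (6 * 48 * (g y + 2) * y ^- 2).
  by field; rewrite gt_eqF.
have p : 0 <= 6 * 48 * (g y + 2) * y ^- 2.
  by rewrite mulr_ge0// mulr_ge0//; lra.
apply: (le_trans (ler_wpM2r p e4)).
have -> : 4 * (6 * 48 * (g y + 2) * y ^- 2) = 24 * 48 * (g y + 2) * y ^- 2 by ring.
by rewrite ler_wpM2r//; lra.
Qed.

Lemma log_pl_ge0 : 0 <= pl.
Proof.
have hy : 0 <= h * y + 1 by rewrite addr_ge0// mulr_ge0// ltW.
by rewrite mulr_ge0 ?invr_ge0 ?sqr_ge0// mulr_ge0// mulr_ge0 ?expR_ge0.
Qed.

End Fixed.

(* The tilt h' = (g v + ln v / 2) / v with v = y / 6 gains the factor y ^- 3 on paths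
   without a jump above v; on the other paths that jump contributes the factor y ^- 2. *)
Lemma upper_bound_log : exists C r0, 0 < C /\ forall r x, r0 <= r -> 0 <= x ->
    r ^+ 4 = Num.sqrt (2 * a * x) -> g (r ^+ 4) <= r ->
    PAtau_gt X x <= C * ((1 + g (r ^+ 4)) * expR (- g (r ^+ 4)) * (r ^+ 4) ^- 2).
Proof.
have a0 := a_gt0; have e0 := tilt_cap_gt0 a_gt0 s0_gt0.
have m0 : 0 <= m2 := m2_ge0 mom2.
have tb0 : 0 <= tau_bound a m2 by exact: tau_bound_ge0 mom2.
set tb := tau_bound a m2 in tb0.
have w0 : 0 <= 8 / a * D.
  by rewrite mulr_ge0 ?divr_ge0 ?(ltW a0)// addr_ge0// divr_ge0// ltW.
pose c3 := 8 / a * D * (48 * 48 * expR (2 * c)).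
have c30 : 0 <= c3 by rewrite mulr_ge0// mulr_ge0 ?expR_ge0// mulr_ge0.
pose C := 2 * tb + 6 * 36 * expR (18 * c) + c3.
pose z := (6 * (a + m2 + a * m2) + 32 * 64) / (a / 4).
exists C, (Num.max 7 (Num.max s0 (Num.max x0 (Num.max (18 / e) z)))); split.
  by rewrite /C; have := expR_gt0 (18 * c); lra.
move=> r x; rewrite !ge_max => /and5P[r7 rs rx re rz] x_ge0 yE gyr.
have re' : 18 <= r * e by rewrite -ler_pdivrMr.
have rz' : 6 * (a + m2 + a * m2) + 32 * 64 <= a / 4 * r.
  have a4 : 0 < a / 4 by lra.
  by rewrite [leRHS]mulrC -ler_pdivrMr.
have r0 : 0 < r by lra.
have y0 : 0 < r ^+ 4 by exact: exprn_gt0.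
have y_ge : s0 <= r ^+ 4.
  apply: (le_trans rs); apply: (le_trans (log_level_ge r7)); lra.
have gy := g_ge0 y0.
set k := A + (c - A) * r ^+ 3.
have ak : a <= k.
  have cA : 0 <= c - A.
    rewrite /c addrAC subrr add0r divr_ge0 ?(ltW a0)// /K /kap' /drift_cst.
    have := sqr_ge0 a; lra.
  have Aa : a <= A by rewrite /A lerDr divr_ge0// mulr_ge0// ltW.
  by rewrite -[a]addr0 lerD// mulr_ge0// exprn_ge0// ltW.
have hh := PAtau_gt_le iidX a_gt0 int1 mean int2 mom2 ak x_ge0.
rewrite -yE in hh.
have {}hh := hh _ (log_hits r7 rs rx re' rz' gyr).
apply: (le_trans hh).
have T1 : tb * utail mu (r ^+ 4) <= 2 * tb * (expR (- g (r ^+ 4)) * (r ^+ 4) ^- 2).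
  have := ler_wpM2l tb0 (utail_le y_ge); lra.
have T2 := log_exp2 r7 rx gyr.
have T3 := ler_pM (log_pl_ge0 r7) (expR_ge0 _) (log_pl r7) (log_exp1 r7 gyr).
have {}T3 := ler_wpM2l w0 T3.
set E := expR (- g (r ^+ 4)) in T1 T2 T3 *.
set Y := (r ^+ 4) ^- 2 in T1 T2 T3 *.
have G0 : 0 <= E * Y by rewrite mulr_ge0 ?expR_ge0// invr_ge0 sqr_ge0.
have GG : E * Y <= (1 + g (r ^+ 4)) * (E * Y) by rewrite ler_peMl//; lra.
have CE : C = 2 * tb + 6 * 36 * expR (18 * c) + c3 by [].
rewrite -[(1 + g (r ^+ 4)) * E * Y]mulrA.
have -> : C * ((1 + g (r ^+ 4)) * (E * Y)) = 2 * tb * ((1 + g (r ^+ 4)) * (E * Y))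
    + 6 * 36 * expR (18 * c) * ((1 + g (r ^+ 4)) * (E * Y))
    + c3 * ((1 + g (r ^+ 4)) * (E * Y)) by rewrite CE !mulrDl.
apply: lerD; first apply: lerD.
- by apply: (le_trans T1); rewrite ler_wpM2l// mulr_ge0.
- by apply: (le_trans T2); rewrite ler_wpM2l// mulr_ge0// expR_ge0.
rewrite /c3; move: T3.
set H := expR (_ * (_ - _)); set p := 8 * expR 1 * _ * _.
by move=> T3; rewrite mulrAC [_ / a * p]mulrAC; lra.
Qed.

End LogUpperBound.

(** * Lower bound *)

Section LowerBound.
Context {d : measure_display} {T : measurableType d} {R : realType}.
Variables (P : probability T R) (X : nat -> {RV P >-> R}).
Hypothesis iidX : iid X.

Local Notation mu := (distribution P (X 0%N)).

Variables (a m2 : R).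
Hypothesis a_gt0 : 0 < a.
Hypothesis int1 : mu.-integrable setT (fun u : R => u%:E).
Hypothesis mean : (\int[mu]_u u%:E = (- a)%:E)%E.
Hypothesis int2 : mu.-integrable setT (fun u : R => (u ^+ 2)%:E).
Hypothesis mom2 : (\int[mu]_u (u ^+ 2)%:E = m2%:E)%E.

Local Notation pos := (positive_until X).

Definition centered (n0 n : nat) (w : T) : R :=
  Ssum X n w - Ssum X n0 w + a * (n - n0)%:R.

Definition deviates (n0 : nat) (K : R) (n : nat) : set T :=
  [set w | K < `|centered n0 n w|].

Lemma centeredS n0 n w : (n0 <= n)%N ->
  centered n0 n.+1 w = centered n0 n w + X n w + a.
Proof. by move=> h; rewrite /centered SsumS subSn// -natr1; ring. Qed.

Lemma measurable_centered n0 n : (n0 <= n)%N ->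
  measurable_fun setT (centered n0 n : past X n -> R).
Proof.
move=> h; apply: measurable_funD => //; apply: measurable_funB.
  exact: measurable_Ssum.
exact: measurable_Ssum.
Qed.

Lemma past_measurable_deviates n0 K n : (n0 <= n)%N ->
  measurable (deviates n0 K n : set (past X n)).
Proof.
move=> h.
have mf : measurable_fun setT ((fun w => `|centered n0 n w| - K) : past X n -> R).
  apply: measurable_funB => //; apply: measurableT_comp => //.
  exact: measurable_centered.
have := past_measurable_gt0 mf.
by congr (measurable _); apply/seteqP; split=> w /=; rewrite subr_gt0.
Qed.

Lemma integral_sqr_shift (M c : R) : 0 <= c ->
  (\int[mu]_u ((M + u + a) ^+ 2 + c)%:E = (M ^+ 2 + m2 - a ^+ 2 + c)%:E)%E.
Proof.
move=> c0.
have := integral_quad int1 mean int2 mom2 ((M + a) ^+ 2 + c) (2 * (M + a)) 1.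
have -> : (M + a) ^+ 2 + c - 2 * (M + a) * a + 1 * m2 = M ^+ 2 + m2 - a ^+ 2 + c by ring.
move=> <-; apply: eq_integral => u _; congr (_%:E); ring.
Qed.

Lemma kolmogorov_inequality n0 m K (G : set T) : 0 < K ->
  measurable (G : set (past X n0)) ->
  (P (crossed n0 G (fun=> setT) (deviates n0 K) (n0 + m))
    <= (m%:R * m2 / K ^+ 2)%:E * P G)%E.
Proof.
move=> K0 mG.
have K20 : 0 < K ^+ 2 by exact: exprn_gt0.
have m20 : 0 <= m2 := m2_ge0 mom2.
set N := (n0 + m)%N.
pose V n w : R := (centered n0 n w ^+ 2 + (N - n)%:R * m2) / K ^+ 2.
have n0N : (n0 <= N)%N by rewrite leq_addr.
have V0 n w : 0 <= V n w by rewrite divr_ge0 ?(ltW K20)// addr_ge0 ?sqr_ge0 ?mulr_ge0.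
have mV n : (n0 <= n <= N)%N -> measurable_fun setT (V n : past X n -> R).
  move=> /andP[n0n _]; apply: measurable_funM => //; apply: measurable_funD => //.
  by apply: (measurable_funX 2); exact: measurable_centered.
have mB n : (n0 < n <= N)%N -> measurable (setT : set (past X n)) by [].
have mC n : (n0 <= n <= N)%N -> measurable (deviates n0 K n : set (past X n)).
  by move=> /andP[n0n _]; exact: past_measurable_deviates.
have c0 w : centered n0 n0 w = 0 by rewrite /centered subnn mulr0 subrr addr0.
have mG' := past_measurable mG.
have -> : ((m%:R * m2 / K ^+ 2)%:E * P G = \int[P]_(w in G) (V n0 w)%:E)%E.
  rewrite -(integral_cst P mG'); apply: eq_integral => w _.
  by rewrite /V c0 expr0n/= add0r /N addKn.
apply: (maximal_inequality n0N mG mB mC (V := V)) => //; last by rewrite n0N leqnn.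
  by move=> w _; rewrite /deviates/= c0 normr0 ltNge (ltW K0).
move=> n /andP[n0n nN].
set Un := uncrossed n0 G (fun=> setT) (deviates n0 K).
have mU : measurable (Un n : set (past X n)).
  by apply: (past_measurable_uncrossed n0N mG mB mC); rewrite n0n ltnW.
have mU' : measurable (Un n.+1 : set (past X n.+1)).
  by apply: (past_measurable_uncrossed n0N mG mB mC); rewrite leqW.
have mH : measurable (Un n `&` setT `&` deviates n0 K n.+1).
  apply: (@past_measurable _ _ _ _ X n.+1).
  apply: measurableI; last by apply: past_measurable_deviates; exact: leqW.
  by rewrite setIT; exact: past_measurableS.
have <- : (\int[P]_(w in Un n `&` setT `&` deviates n0 K n.+1) (cst (1 : R) w)%:E
    = P (Un n `&` setT `&` deviates n0 K n.+1))%E.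
  by rewrite (integral_cst P mH 1%E) mul1e.
pose f (z : R * R) := ((z.1 + z.2 + a) ^+ 2 + (N - n.+1)%:R * m2) / K ^+ 2.
have f0 z : 0 <= f z by rewrite divr_ge0 ?(ltW K20)// addr_ge0 ?sqr_ge0 ?mulr_ge0.
have mU'0 : measurable (Un n.+1) by exact: past_measurable mU'.
have mVn : measurable_fun setT (V n).
  apply: (past_measurable_fun (X := X) (k := n)); apply: mV; by rewrite n0n ltnW.
have mVn1 : measurable_fun setT (V n.+1).
  apply: (past_measurable_fun (X := X) (k := n.+1)); apply: mV; by rewrite leqW.
apply: (potential_step (k := n) iidX mU mU'0 mH _ _
  (Y := centered n0 n) (f := f) (V := V n) (V1 := V n.+1) (V2 := cst 1)) => //.
- by rewrite /Un uncrossedS// => w [[]].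
- by move=> w [[]].
- exact: measurable_centered.
- apply: measurable_funM => //; apply: measurable_funD => //.
  apply: (measurable_funX 2); apply: measurable_funD => //.
  exact: measurable_funD.
- move=> w _; rewrite /f/=.
  have cc : 0 <= (N - n.+1)%:R * m2 by rewrite mulr_ge0.
  under eq_integral do rewrite mulrC EFinM.
  rewrite ge0_integralZl//.
  + rewrite integral_sqr_shift// -EFinM lee_fin /V mulrC ler_pM2r ?invr_gt0//.
    have -> : (N - n)%:R = (N - n.+1)%:R + 1 :> R by rewrite natr1 -subSn// subSS.
    have := sqr_ge0 a; lra.
  + apply/measurable_EFinP; apply: measurable_funD => //.
    apply: (measurable_funX 2); apply: measurable_funD => //.
    exact: measurable_funD.
  + by move=> u _; rewrite lee_fin addr_ge0 ?sqr_ge0.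
  + by rewrite lee_fin invr_ge0 ltW.
move=> w Uw; rewrite !patchE.
have fV : f (centered n0 n w, X n w) = V n.+1 w by rewrite /f /V /= centeredS.
rewrite fV; case: ifPn => [/set_mem|_].
  rewrite /Un uncrossedS// => -[_ nC].
  by rewrite memNset ?addr0// => -[_].
case: ifPn => [/set_mem [_ Cw]|_]; last by rewrite addr0.
rewrite add0r /V ler_pdivlMr// mul1r.
rewrite /deviates/= in Cw.
apply: (@le_trans _ _ (centered n0 n.+1 w ^+ 2)); last by rewrite lerDl mulr_ge0.
by rewrite -[leRHS]real_normK ?num_real// lerXn2r ?nnegrE// ltW.
Qed.

(* The jump at time i puts the walk above y + K; as long as the centred walk stays
   within K, the path then dominates the line of slope -a issued from height y. *)
Lemma area_after_jump i m y K w : pos i w -> y + K < X i w -> 0 < y ->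
  m%:R * a <= y -> y < m.+1%:R * a ->
  (forall j, (j <= m)%N -> `|centered i.+1 (i.+1 + j) w| <= K) ->
  ((y ^+ 2 / (2 * a))%:E < Atau X w)%E.
Proof.
move=> pw Xw y0 my ym hK.
have a0 := a_gt0.
have Sj j : (j <= m)%N -> y - a * j%:R < Ssum X (i.+1 + j) w.
  move=> jm; have := hK _ jm; rewrite ler_norml /centered addKn => /andP[h1 _].
  have h2 := positive_until_ge0 pw (leqnn i).
  have h3 := SsumS X i w; lra.
have Sj0 j : (j <= m)%N -> 0 < Ssum X (i.+1 + j) w.
  move=> jm; apply: le_lt_trans (Sj _ jm).
  have : j%:R * a <= m%:R * a by rewrite ler_pM2r// ler_nat.
  lra.
apply/Atau_gtP; right; exists (i.+1 + m)%N; split.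
  move=> l /andP[l0 lm]; have [li|il] := leqP l i; first by apply: pw; rewrite l0 li.
  by rewrite -(subnKC il); apply: Sj0; rewrite leq_subLR.
have Ai := positive_until_area_ge0 pw (leqnn i.+1).
have claim j : (j <= m)%N ->
    (j%:R + 1) * y - a * j%:R * (j%:R + 1) / 2 < area X (i.+1 + j).+1 w.
  elim: j => [|j IH] jm.
    by rewrite addn0 areaS; have := Sj 0%N jm; rewrite addn0; lra.
  have := IH (ltnW jm); have := Sj _ jm; rewrite addnS [area X _.+2 w]areaS -natr1.
  lra.
apply: le_lt_trans (claim m (leqnn m)).
rewrite -natr1 in ym.
rewrite ler_pdivrMr; last lra.
have : 0 <= ((m%:R + 1) * a - y) * y by rewrite mulr_ge0//; lra.
have : 0 <= ((m%:R + 1) * a) * (y - m%:R * a) by rewrite mulr_ge0 ?mulr_ge0//; lra.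
lra.
Qed.

Definition first_large (z : R) (i : nat) : set T :=
  pos i `&` [set w | forall l, (l < i)%N -> X l w <= z].

Lemma past_measurable_first_large z i : measurable (first_large z i : set (past X i)).
Proof.
apply: measurableI; first exact: past_measurable_positive_until.
rewrite (_ : [set w | _] = \bigcap_(l in [set l | (l < i)%N]) [set w | X l w <= z]).
  apply: bigcap_measurableType => l li.
  by apply: measurable_set_le; exact: past_measurable_X.
by apply/seteqP; split.
Qed.

Lemma first_large_ge z i N : (i <= N)%N ->
  (P (pos i) - (N%:R * utail mu z)%:E <= P (first_large z i))%E.
Proof.
move=> iN.
have mp : measurable (pos i) by exact: measurable_positive_until.
have mf : measurable (first_large z i).
  by apply: (past_measurable (X := X) (k := i)); exact: past_measurable_first_large.
have mj l : measurable (jump X l z) by rewrite jumpE; exact: measurable_funPTI.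
have mJ : measurable (\bigcup_(l < i) jump X l z) by exact: bigcup_measurable.
rewrite leeBlDr ?fin_num_fun//.
apply: (@le_trans _ _ (P (first_large z i `|` \bigcup_(l < i) jump X l z))).
  apply: le_measure; rewrite ?inE//; first exact: measurableU.
  move=> w pw; have [[l [li h]]|h] := pselect (exists l, (l < i)%N /\ z < X l w).
    by right; exists l.
  left; split=> // l li; rewrite leNgt; apply/negP => zX; apply: h; by exists l.
apply: (le_trans (measureU2 _ _ _)) => //; rewrite leeD2l//.
apply: (@le_trans _ _ (\sum_(l < i) (utail mu z)%:E)%E).
  rewrite bigcup_mkord; apply: (le_trans (Boole_inequality P (A := fun l => jump X l z) _)) => //.
  apply: lee_sum => l _; rewrite jumpE -utailE.
  by have := iidX.2 l `]z, +oo[%classic (measurable_itv _); rewrite /distribution/= /pushforward => ->.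
rewrite sumEFin lee_fin sumr_const card_ord -[utail mu z *+ i]mulr_natl ler_wpM2r ?utail_ge0//.
by rewrite ler_nat.
Qed.

Lemma tail_lower_bound (N : nat) (x K : R) (y := Num.sqrt (2 * a * x)) (q := utail mu (y + K)) :
  0 < x -> 0 < K -> y / a * m2 / K ^+ 2 <= 1 ->
  (\sum_(0 <= i < N) fine (P (pos i)) - N%:R * (N%:R * q)) * q * (1 - y / a * m2 / K ^+ 2)
    <= PAtau_gt X x.
Proof.
move=> x0 K0 eta1.
have a0 := a_gt0; have m20 : 0 <= m2 := m2_ge0 mom2.
have y0 : 0 < y by rewrite sqrtr_gt0 !mulr_gt0.
have yx : y ^+ 2 / (2 * a) = x.
  by rewrite sqr_sqrtr ?mulr_ge0 ?(ltW a0) ?(ltW x0)//; field; rewrite gt_eqF.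
set eta := y / a * m2 / K ^+ 2 in eta1 *.
have q0 : 0 <= q by exact: utail_ge0.
pose m := Num.trunc (y / a).
have ya0 : 0 <= y / a by rewrite divr_ge0// ltW.
have my : m%:R * a <= y by rewrite -ler_pdivlMr// -truncn_ge_nat.
have ym : y < m.+1%:R * a by rewrite -ltr_pdivrMr// truncnS_gt.
pose G i := first_large (y + K) i `&` jump X i (y + K).
have mG i : measurable (G i : set (past X i.+1)).
  apply: measurableI; first by apply: past_measurableS; exact: past_measurable_first_large.
  have mX : measurable_fun setT (X i : past X i.+1 -> R) by exact: past_measurable_X.
  by rewrite jumpE -[_ @^-1` _]setTI; exact: mX.
pose bad i := crossed i.+1 (G i) (fun=> setT) (deviates i.+1 K) (i.+1 + m).
have mbad i : measurable (bad i).
  apply: (measurable_crossed (X := X) (N := (i.+1 + m)%N)) => //; rewrite ?leq_addr ?leqnn//.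
  by move=> n /andP[h _]; exact: past_measurable_deviates.
have mG0 i : measurable (G i) by exact: past_measurable (mG i).
pose Dk i := G i `\` bad i.
have mD i : measurable (Dk i) by exact: measurableD.
have PG i : P (G i) = (P (first_large (y + K) i) * q%:E)%E.
  rewrite /G jumpE past_indep//; last exact: past_measurable_first_large.
  congr (_ * _)%E; rewrite /q -utailE.
  by have := iidX.2 i `]y + K, +oo[%classic (measurable_itv _); rewrite /distribution/= /pushforward.
have PGfin i : P (G i) = (fine (P (G i)))%:E by rewrite fineK// fin_num_measure.
have PD i : ((fine (P (G i)) * (1 - eta))%:E <= P (Dk i))%E.
  have K20 : 0 < K ^+ 2 by exact: exprn_gt0.
  have h1 := kolmogorov_inequality m K0 (mG i).
  have h2 : (P (bad i) <= (eta * fine (P (G i)))%:E)%E.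
    apply: (le_trans h1); rewrite PGfin -EFinM lee_fin ler_wpM2r ?fine_ge0//.
    by rewrite ler_wpM2r ?invr_ge0 ?(ltW K20)// ler_wpM2r// ler_pdivlMr.
  have h3 : (P (G i) <= P (Dk i) + P (bad i))%E.
    apply: (@le_trans _ _ (P (Dk i `|` bad i))); last exact: measureU2.
    apply: le_measure; rewrite ?inE//; first exact: measurableU.
    by move=> w Gw; have [b|b] := pselect (bad i w); [right|left].
  have fD : P (Dk i) = (fine (P (Dk i)))%:E by rewrite fineK// fin_num_measure.
  have fb : P (bad i) = (fine (P (bad i)))%:E by rewrite fineK// fin_num_measure.
  move: h2 h3; rewrite fD fb PGfin -EFinD !lee_fin; lra.
have mA := measurable_Atau_gt X x.
have sub : \big[setU/set0]_(i < N) Dk i `<=` [set w | (x%:E < Atau X w)%E].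
  rewrite -bigcup_mkord => w [i _ [Gw nb]] /=; have [[pw _] Xw] := Gw.
  rewrite -yx; apply: (area_after_jump (K := K) (m := m) pw) => // j jm.
  rewrite leNgt; apply/negP => dev; apply: nb; split=> //.
  by exists (i.+1 + j)%N; split=> //; rewrite leq_addr leq_add2l.
have tD : trivIset `I_N Dk.
  apply/trivIsetP => i j _ _; wlog ij : i j / (i < j)%N.
    move=> hw ij; case: (ltngtP i j) => h; first exact: hw.
      by rewrite setIC; apply: hw => //; rewrite eq_sym.
    by move: ij; rewrite h eqxx.
  move=> _; rewrite -subset0 => w [[[_ Xi] _] [[[_ hj] _] _]].
  by have := hj i ij; rewrite /= leNgt Xi.
have main : (\sum_(i < N) P (Dk i) <= (PAtau_gt X x)%:E)%E.
  rewrite -(measure_semi_additive_ord_I P (F := Dk))//; last first.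
    exact: bigsetU_measurable.
  rewrite /PAtau_gt fineK ?fin_num_measure//.
  by apply: le_measure => //; rewrite inE//; exact: bigsetU_measurable.
rewrite -lee_fin; apply: le_trans main.
apply: (@le_trans _ _ (\sum_(i < N) ((fine (P (pos i)) - N%:R * q) * q * (1 - eta))%:E)%E).
  rewrite sumEFin lee_fin -!mulr_suml sumrB sumr_const card_ord big_mkord.
  by rewrite -[(N%:R * q) *+ N]mulr_natl.
apply: lee_sum => i _; apply: le_trans (PD i); rewrite lee_fin.
rewrite ler_wpM2r ?subr_ge0// -lee_fin -PGfin PG EFinM lee_wpmul2r//.
have fp : P (pos i) = (fine (P (pos i)))%:E.
  by rewrite fineK// fin_num_measure//; exact: measurable_positive_until.
rewrite EFinB -fp; apply: first_large_ge; exact: ltnW.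
Qed.

End LowerBound.

(** * Asymptotics *)

Section Asymptotics.
Context {d : measure_display} {T : measurableType d} {R : realType}.
Variables (P : probability T R) (X : nat -> {RV P >-> R}).
Hypothesis iidX : iid X.

Local Notation mu := (distribution P (X 0%N)).

Variables (a m2 : R).
Hypothesis a_gt0 : 0 < a.
Hypothesis int1 : mu.-integrable setT (fun u : R => u%:E).
Hypothesis mean : (\int[mu]_u u%:E = (- a)%:E)%E.
Hypothesis int2 : mu.-integrable setT (fun u : R => (u ^+ 2)%:E).
Hypothesis mom2 : (\int[mu]_u (u ^+ 2)%:E = m2%:E)%E.

Variables (g : R -> R) (s0 x0 : R).
Hypothesis g_ge0 : forall x, 0 < x -> 0 <= g x.
Hypothesis g_ratio : forall x y, 0 < x -> x <= y -> g y / y <= g x / x.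
Hypothesis g_small : forall e, 0 < e -> exists y0, forall y, y0 <= y -> g y / y <= e.
Hypothesis g_mono : forall x y, x0 <= x -> x <= y -> g x <= g y.
Hypothesis s0_gt0 : 0 < s0.
Hypothesis utail_le : forall s, s0 <= s -> utail mu s <= 2 * expR (- g s) * s ^- 2.
Hypothesis utail_ge : forall s, s0 <= s -> 2^-1 * expR (- g s) * s ^- 2 <= utail mu s.

Lemma sqrt_large (y0 : R) : exists2 x1, 0 < x1 & forall x, x1 <= x -> y0 <= Num.sqrt (2 * a * x).
Proof.
have a2 : 0 < 2 * a by rewrite mulr_gt0.
exists (y0 ^+ 2 / (2 * a) + 1); first by rewrite ltr_wpDl// divr_ge0 ?sqr_ge0// ltW.
move=> x hx; apply: (le_trans (ler_norm _)); rewrite -sqrtr_sqr ler_wsqrtr//.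
rewrite -ler_pdivrMl// mulrC; lra.
Qed.

Lemma upper_tail : exists C, 0 < C /\ exists x1, forall x, x1 <= x ->
  PAtau_gt X x <= C * x `^ (4^-1) *
    expR (- (g (Num.sqrt (2 * a * x)) *
       Num.sqrt (1 - 2 * C * g (Num.sqrt (2 * a * x)) / (a * Num.sqrt (2 * a * x))))).
Proof.
have a0 := a_gt0.
have [C1 [y0 [C10 main]]] := upper_bound_main iidX a_gt0 int1 mean int2 mom2 g_ge0
  g_ratio s0_gt0 utail_le g_small.
pose C := C1 * (1 + a).
have C0 : 0 < C by rewrite mulr_gt0//; lra.
have e0 : 0 < a / (2 * C) by rewrite divr_gt0// mulr_gt0.
have [y1 hy1] := g_small e0.
have [x1 x10 hx1] := sqrt_large (Num.max y0 (Num.max y1 1)).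
exists C; split=> //; exists (Num.max x1 1) => x; rewrite ge_max => /andP[xx1 x_ge1].
have := hx1 _ xx1; set y := Num.sqrt _; rewrite !ge_max => /and3P[yy0 yy1 y_ge1].
have y_gt0 : 0 < y by lra.
have x_ge0 : 0 <= x by lra.
apply: (le_trans (main y x yy0 x_ge0 erefl)).
have gy := g_ge0 y_gt0.
set t := 2 * C * g y / (a * y).
have tE : t = (2 * C / a) * (g y / y) by rewrite /t; field; rewrite !gt_eqF.
have t1 : t <= 1.
  have p : 0 <= 2 * C / a by apply: divr_ge0; lra.
  have := ler_wpM2l p (hy1 _ yy1); rewrite -tE => /le_trans; apply.
  by rewrite le_eqVlt; apply/orP; left; apply/eqP; field; rewrite !gt_eqF.
have st : Num.sqrt (1 - t) <= 1 - t / 2.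
  rewrite -(@ler_pXn2r _ 2)// ?nnegrE ?sqrtr_ge0//; last lra.
  rewrite sqr_sqrtr; last lra.
  have := sqr_ge0 t; lra.
have C1C : C1 <= C by rewrite /C ler_peMr ?(ltW C10)//; lra.
have xq : 1 <= x `^ 4^-1.
  have p4 : 0 <= 4^-1 :> R by lra.
  by have := ler_powR x_ge1 p4; rewrite powRr0.
apply: ler_pM; rewrite ?expR_ge0 ?(ltW C10)//.
  by apply: (le_trans C1C); rewrite ler_peMr// ltW.
rewrite ler_expR.
have gst := ler_wpM2l gy st.
have gt : g y * (t / 2) = (C / a) * (g y ^+ 2 / y).
  by rewrite /t; field; rewrite !gt_eqF.
have Ca : C1 <= C / a by rewrite /C ler_pdivlMr// ler_wpM2l ?(ltW C10)//; lra.
have p : 0 <= g y ^+ 2 / y by rewrite divr_ge0 ?sqr_ge0// ltW.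
have := ler_wpM2r p Ca; lra.
Qed.

Lemma utail_gt0 s : s0 <= s -> 0 < utail mu s.
Proof.
move=> ss; apply: lt_le_trans (utail_ge ss).
have s_gt0 := lt_le_trans s0_gt0 ss.
by rewrite !mulr_gt0 ?expR_gt0// invr_gt0 exprn_gt0.
Qed.

Lemma lower_tail (eps c : R) : 0 < eps -> (c%:E < Etau X)%E ->
  exists x1, forall x, x1 <= x ->
    c <= PAtau_gt X x / utail mu (Num.sqrt (2 * a * x) + x `^ (4^-1 + eps)).
Proof.
move=> eps0 /lt_Etau[N].
pose p i := fine (P (positive_until X i)).
have pE i : P (positive_until X i) = (p i)%:E.
  by rewrite fineK// fin_num_measure//; exact: measurable_positive_until.
under eq_bigr do rewrite pE.
rewrite sumEFin lte_fin; set s := \sum_(0 <= i < N) p i => cs.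
have a0 := a_gt0; have m20 : 0 <= m2 := m2_ge0 mom2.
have s_ge0 : 0 <= s by apply: sumr_ge0 => i _; exact: fine_ge0.
pose dl := Num.min ((s - c) / (1 + s)) 1.
have dl0 : 0 < dl by rewrite lt_min ltr01 andbT divr_gt0//; lra.
have dl1 : dl <= 1 by rewrite ge_min lexx orbT.
have dls : dl * (1 + s) <= s - c.
  by rewrite -ler_pdivlMr ?ge_min ?lexx//; lra.
pose M := (Num.sqrt (2 * a) / a * m2) / dl.
have M0 : 0 <= M by rewrite !mulr_ge0 ?sqrtr_ge0 ?invr_ge0// ltW.
pose x2 := M `^ (2 * eps)^-1.
pose x3 := (N%:R * N%:R) / (a * dl).
have [x1 x10 hx1] := sqrt_large (Num.max s0 1).
exists (Num.max x1 (Num.max 1 (Num.max x2 x3))) => x.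
rewrite !ge_max => /and4P[xx1 x_ge1 xx2 xx3].
have := hx1 _ xx1; set y := Num.sqrt _; rewrite ge_max => /andP[ys y1].
have x_gt0 : 0 < x by lra.
set K := x `^ _.
have K0 : 0 < K by exact: powR_gt0.
have K2 : K ^+ 2 = Num.sqrt x * x `^ (2 * eps).
  rewrite /K -powR_mulrn ?powR_ge0// -powRrM.
  have -> : (4^-1 + eps) * 2%:R = 2^-1 + 2 * eps by lra.
  rewrite powRD; last by rewrite (gt_eqF x_gt0) implybT.
  by rewrite powR12_sqrt// ltW.
have xM : M <= x `^ (2 * eps).
  have e2 : 0 < 2 * eps by rewrite mulr_gt0.
  have : x2 `^ (2 * eps) <= x `^ (2 * eps).
    by apply: ge0_ler_powR; rewrite ?nnegrE ?powR_ge0 ?(ltW e2) ?(ltW x_gt0).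
  by rewrite /x2 -powRrM mulVf ?gt_eqF// powRr1.
have etadl : y / a * m2 / K ^+ 2 <= dl.
  have sx : 0 < Num.sqrt x by rewrite sqrtr_gt0.
  have -> : y = Num.sqrt (2 * a) * Num.sqrt x by rewrite /y sqrtrM// mulr_ge0// ltW.
  rewrite K2 ler_pdivrMr ?mulr_gt0 ?powR_gt0//.
  have -> : Num.sqrt (2 * a) * Num.sqrt x / a * m2 = dl * (Num.sqrt x * M).
    by rewrite /M; field; rewrite !gt_eqF.
  by rewrite ler_pM2l// ler_pM2l.
have zs : s0 <= y + K by lra.
have q0 := utail_gt0 zs; set q := utail mu (y + K) in q0 *.
have Nq : N%:R * (N%:R * q) <= dl.
  have q1 : q <= (a * x)^-1.
    apply: (le_trans (utail_le zs)).
    have z_gt0 : 0 < y + K by lra.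
    have eg : expR (- g (y + K)) <= 1 by rewrite -expR0 ler_expR oppr_le0 g_ge0.
    have y2 : y ^+ 2 = 2 * a * x by rewrite sqr_sqrtr// !mulr_ge0// ltW.
    have yz : (y + K) ^- 2 <= (2 * a * x)^-1.
      rewrite lef_pV2 ?posrE ?exprn_gt0 ?mulr_gt0// -y2.
      by rewrite lerXn2r ?nnegrE; lra.
    have -> : (a * x)^-1 = 2 * 1 * (2 * a * x)^-1.
      by field; rewrite !gt_eqF.
    have p1 : 0 <= 2 * expR (- g (y + K)) by rewrite mulr_ge0// expR_ge0.
    have p2 : 0 <= (y + K) ^- 2 by rewrite invr_ge0 sqr_ge0.
    have p3 : 2 * expR (- g (y + K)) <= 2 * 1 by rewrite ler_pM2l.
    exact: ler_pM.
  have NN : 0 <= N%:R * N%:R :> R by rewrite mulr_ge0.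
  rewrite mulrA; apply: (le_trans (ler_wpM2l NN q1)).
  rewrite ler_pdivrMr ?mulr_gt0//.
  by move: xx3; rewrite /x3 ler_pdivrMr ?mulr_gt0//; lra.
have eta1 : y / a * m2 / K ^+ 2 <= 1 by exact: le_trans dl1.
have eta0 : 0 <= y / a * m2 / K ^+ 2.
  by rewrite divr_ge0 ?exprn_ge0 ?(ltW K0)// mulr_ge0// divr_ge0 ?sqrtr_ge0// ltW.
have := tail_lower_bound iidX a_gt0 int1 mean int2 mom2 N x_gt0 K0 eta1.
rewrite -/y -/q -/s; set eta := y / a * m2 / K ^+ 2 in etadl eta1 eta0 *.
rewrite ler_pdivlMr// => /(le_trans _); apply.
rewrite mulrAC ler_wpM2r ?(ltW q0)//.
set A := s - _; have As : s - dl <= A by rewrite /A lerB.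
have [A0|A0] := leP 0 A.
  have : A * (1 - dl) <= A * (1 - eta) by rewrite ler_wpM2l//; lra.
  have : (s - dl) * (1 - dl) <= A * (1 - dl) by rewrite ler_wpM2r//; lra.
  have := sqr_ge0 dl; lra.
have : A * 1 <= A * (1 - eta) by rewrite ler_wnM2l ?(ltW A0)//; lra.
have : 0 <= dl * s by rewrite mulr_ge0// ltW.
lra.
Qed.

Lemma lt_half_Etau : ((2^-1 : R)%:E < Etau X)%E.
Proof.
apply: (@lt_le_trans _ _ 1%:E); first by rewrite lte_fin; lra.
rewrite EtauE; apply: le_trans (nneseries_lim_ge 1 _); last by [].
rewrite big_nat1 positive_until0 probability_setT//.
Qed.

Lemma upper_log (e : R) : 0 < e -> e <= 1 -> exists B y1, forall y x, y1 <= y -> 0 <= x ->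
  y = Num.sqrt (2 * a * x) -> 0 < PAtau_gt X x ->
  (1 - e / 2) * (g y + 2 * ln y) - B <= - ln (PAtau_gt X x).
Proof.
move=> e0 e1; have a0 := a_gt0.
have [C1 [y1 [C10 main1]]] := upper_bound_main iidX a_gt0 int1 mean int2 mom2 g_ge0
  g_ratio s0_gt0 utail_le g_small.
have [C2 [r1 [C20 main2]]] := upper_bound_log iidX a_gt0 int1 mean int2 mom2 g_ge0
  g_ratio s0_gt0 utail_le g_mono.
have e4C : 0 < e / (4 * C1) by rewrite divr_gt0// mulr_gt0.
have [y2 hy2] := g_small e4C.
have e40 : 0 < e / 4 by lra.
pose B := Num.max (ln C1) (ln C2 + e / 4 - 1 - ln (e / 4)).
pose r2 := Num.max 1 (Num.max r1 ((64 / e) ^+ 2)).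
have r21 : 1 <= r2 by rewrite le_max lexx.
exists B, (Num.max y1 (Num.max y2 (r2 ^+ 4))) => y x.
rewrite !ge_max => /and3P[yy1 yy2 yr2] x_ge0 yE P0.
have r20 : 0 < r2 ^+ 4 by rewrite exprn_gt0//; lra.
have y0 : 0 < y by lra.
have gy := g_ge0 y0.
pose r := Num.sqrt (Num.sqrt y).
have r4 : r ^+ 4 = y.
  by rewrite (exprM r 2 2) sqr_sqrtr ?sqrtr_ge0// sqr_sqrtr// ltW.
have r_ge0 : 0 <= r by exact: sqrtr_ge0.
have : r2 <= r.
  by rewrite -(@ler_pXn2r _ 4)// ?nnegrE ?r4//; lra.
rewrite !ge_max => /and3P[r_ge1 rr1 re].
have lny : ln y = 4 * ln r by rewrite -r4 lnXn ?mulr_natl//; lra.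
have lr0 : 0 <= ln r by exact: ln_ge0.
have [gr|gr] := leP (g y) r.
  have := main2 r x rr1 x_ge0; rewrite r4 => /(_ yE gr).
  have p1 : 0 < 1 + g y by lra.
  have p2 : 0 < expR (- g y) := expR_gt0 _.
  have p3 : 0 < y ^- 2 by rewrite invr_gt0 exprn_gt0.
  rewrite -ler_ln ?posrE ?mulr_gt0// lnM ?posrE ?mulr_gt0// lnM ?posrE ?mulr_gt0//.
  rewrite lnM ?posrE// expRK lnV ?posrE ?exprn_gt0// lnXn// => hP.
  have l1 : ln (1 + g y) <= e / 4 * (1 + g y) - 1 - ln (e / 4).
    have : ln (1 + (e / 4 * (1 + g y) - 1)) <= e / 4 * (1 + g y) - 1.
      by apply: le_ln1Dx; rewrite ltrBDr addNr mulr_gt0.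
    by rewrite addrC subrK lnM ?posrE//; lra.
  have hB : ln C2 + e / 4 - 1 - ln (e / 4) <= B by rewrite le_max lexx orbT.
  have eg : 0 <= e * g y by rewrite mulr_ge0// ltW.
  have el : 0 <= e * ln y by rewrite lny !mulr_ge0// ltW.
  move: hP; rewrite mulr2n; lra.
have := main1 y x yy1 x_ge0 yE.
rewrite -ler_ln ?posrE ?mulr_gt0 ?expR_gt0// lnM ?posrE ?expR_gt0// expRK => hP.
have hB : ln C1 <= B by rewrite le_max lexx.
have g2 : C1 * (g y ^+ 2 / y) <= e / 4 * g y.
  have -> : C1 * (g y ^+ 2 / y) = (C1 * g y) * (g y / y) by ring.
  have -> : e / 4 * g y = (C1 * g y) * (e / (4 * C1)) by field; rewrite gt_eqF.
  by rewrite ler_wpM2l ?hy2// mulr_ge0// ltW.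
have lr : 8 * ln r <= e / 4 * r.
  have sr : 0 < Num.sqrt r by rewrite sqrtr_gt0; lra.
  have rE : r = Num.sqrt r ^+ 2 by rewrite sqr_sqrtr.
  have ls : ln r = 2 * ln (Num.sqrt r) by rewrite {1}rE lnXn ?mulr_natl.
  have lsq : ln (Num.sqrt r) <= Num.sqrt r by apply: ltW; exact: ln_sublinear.
  have se : 64 / e <= Num.sqrt r.
    have e64 : 0 <= 64 / e by rewrite divr_ge0// ltW.
    by rewrite -(@ler_pXn2r _ 2)// ?nnegrE ?(ltW sr)// -rE.
  have : 64 <= Num.sqrt r * e by rewrite -ler_pdivrMr.
  move=> /(ler_wpM2r (ltW sr)); rewrite mulrAC -expr2 -rE; lra.
have lg : 2 * ln y <= e / 4 * g y.
  rewrite lny; have : e / 4 * r <= e / 4 * g y by rewrite ler_pM2l// ltW.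
  lra.
have el : 0 <= e * ln y by rewrite lny !mulr_ge0// ltW.
lra.
Qed.

Lemma lower_log (e : R) : 0 < e -> e <= 1 -> exists B y1, forall y x, y1 <= y -> 0 <= x ->
  y = Num.sqrt (2 * a * x) -> 0 < PAtau_gt X x /\
  - ln (PAtau_gt X x) <= (1 + e / 2) * (g y + 2 * ln y) + B.
Proof.
move=> e0 e1; have a0 := a_gt0.
have eps0 : 0 < 8^-1 :> R by lra.
have [x1 hx1] := lower_tail eps0 lt_half_Etau.
pose M := (2 * a) `^ (- (3 / 8)) * 2 / e.
pose y3 := M `^ 4.
exists (4 * ln 2), (Num.max s0 (Num.max 1 (Num.max (x1 * (2 * a)) y3))) => y x.
rewrite !ge_max => /and4P[ys y_ge1 yx1 yy3] x_ge0 yE.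
have y0 : 0 < y by lra.
have y2 : y ^+ 2 = 2 * a * x by rewrite yE sqr_sqrtr// !mulr_ge0// ltW.
have a2 : 0 < 2 * a by rewrite mulr_gt0.
have xx1 : x1 <= x.
  rewrite -(ler_pM2r a2); apply: (le_trans yx1).
  by rewrite [x * _]mulrC -y2 expr2 ler_peMr// ltW.
have x_gt0 : 0 < x.
  by rewrite -(pmulr_rgt0 _ a2) -y2 exprn_gt0.
have := hx1 _ xx1; rewrite -yE.
set K := x `^ _.
have K0 : 0 < K by exact: powR_gt0.
have Ky : K <= e / 2 * y.
  have xE : x = (2 * a)^-1 * y ^+ 2 by rewrite y2 mulKf// gt_eqF.
  have KE : K = (2 * a) `^ (- (3 / 8)) * y `^ (3 / 4).
    rewrite /K xE (_ : 4^-1 + 8^-1 = 3 / 8 :> R); last by lra.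
    rewrite (@powRM _ (2 * a)^-1 (y ^+ 2)) ?invr_ge0 ?sqr_ge0 ?(ltW a2)//.
    congr (_ * _).
      by rewrite -powR_inv1 ?(ltW a2)// -powRrM mulN1r.
    rewrite -powR_mulrn ?(ltW y0)// -powRrM; congr (_ `^ _); lra.
  have yq : y = y `^ (3 / 4) * y `^ (1 / 4).
    rewrite -powRD; last by rewrite (gt_eqF y0) implybT.
    by rewrite (_ : 3 / 4 + 1 / 4 = 1 :> R) ?powRr1 ?(ltW y0)//; lra.
  have My : M <= y `^ (1 / 4).
    have M0 : 0 <= M by rewrite !mulr_ge0 ?powR_ge0 ?invr_ge0 ?(ltW e0).
    have : y3 `^ (1 / 4) <= y `^ (1 / 4).
      by apply: ge0_ler_powR; rewrite ?nnegrE ?powR_ge0 ?(ltW y0)//; lra.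
    rewrite /y3 -powRrM (_ : 4 * (1 / 4) = 1 :> R) ?powRr1//; lra.
  rewrite KE {2}yq.
  have -> : (2 * a) `^ (- (3 / 8)) = e / 2 * M by rewrite /M; field; rewrite gt_eqF.
  have ye0 : 0 <= y `^ (3 / 4) := powR_ge0 _ _.
  have p : 0 <= e / 2 * y `^ (3 / 4) by rewrite mulr_ge0//; lra.
  have := ler_wpM2l p My; lra.
have e2y : e / 2 * y <= 1 * y by rewrite ler_pM2r//; lra.
have zs : s0 <= y + K by lra.
have q0 := utail_gt0 zs.
rewrite ler_pdivlMr// => hP.
have P0 : 0 < PAtau_gt X x by apply: lt_le_trans hP; rewrite mulr_gt0//; lra.
split=> //.
have z0 : 0 < y + K by lra.
have : 2^-1 * (2^-1 * expR (- g (y + K)) * (y + K) ^- 2) <= PAtau_gt X x.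
  by apply: le_trans hP; rewrite ler_pM2l ?utail_ge//; lra.
have p3 : 0 < (y + K) ^- 2 by rewrite invr_gt0 exprn_gt0.
have h20 : 0 < 2^-1 :> R by lra.
rewrite -ler_ln ?posrE ?mulr_gt0 ?expR_gt0//.
rewrite lnM ?posrE ?mulr_gt0 ?expR_gt0// lnM ?posrE ?mulr_gt0 ?expR_gt0//.
rewrite lnM ?posrE ?expR_gt0// expRK !lnV ?posrE ?exprn_gt0// lnXn// -[ln (y + K) *+ 2]mulr_natl => hln.
have gz : g (y + K) <= (1 + e / 2) * g y.
  have yz : y <= y + K by lra.
  have := g_ratio y0 yz; rewrite ler_pdivrMr// => /le_trans; apply.
  have -> : (1 + e / 2) * g y = g y / y * ((1 + e / 2) * y) by field; rewrite gt_eqF.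
  by rewrite ler_wpM2l ?divr_ge0 ?g_ge0 ?(ltW y0)//; lra.
have lz : ln (y + K) <= ln y + ln 2.
  by rewrite -lnM ?posrE// ler_ln ?posrE ?mulr_gt0//; lra.
have ly : 0 <= e * ln y by rewrite mulr_ge0 ?ln_ge0// ltW.
have l2 : 0 <= ln 2 :> R by apply: ln_ge0; lra.
lra.
Qed.

Lemma log_tail (e : R) : 0 < e -> e <= 1 -> exists x1, forall x, x1 <= x ->
  `|1 - ln (PAtau_gt X x) / ln (utail mu (Num.sqrt (2 * a * x)))| <= e.
Proof.
move=> e0 e1; have a0 := a_gt0.
have [B1 [y1 h1]] := upper_log e0 e1.
have [B2 [y2 h2]] := lower_log e0 e1.
have l20 : 0 < ln 2 :> R by apply: ln_gt0; lra.
pose L := Num.max (2 / e * (B1 + 2 * ln 2)) (Num.max (2 / e * (B2 + 2 * ln 2)) (2 * ln 2)).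
have [x1 x10 hx1] := sqrt_large (Num.max y1 (Num.max y2 (Num.max s0 (expR L)))).
exists x1 => x xx1; have := hx1 _ xx1; set y := Num.sqrt _.
rewrite !ge_max => /and4P[yy1 yy2 ys yL].
have x_ge0 : 0 <= x by lra.
have y0 : 0 < y := lt_le_trans s0_gt0 ys.
have [P0 up] := h2 y x yy2 x_ge0 erefl.
have lo := h1 y x yy1 x_ge0 erefl P0.
have gy := g_ge0 y0.
have Ly : L <= ln y by rewrite -[L]expRK ler_ln ?posrE ?expR_gt0.
have q0 := utail_gt0 ys.
have y20 : 0 < y ^- 2 by rewrite invr_gt0 exprn_gt0.
have h20 : 0 < 2^-1 :> R by lra.
have qu : ln (utail mu y) <= ln 2 - (g y + 2 * ln y).
  have := utail_le ys; rewrite -ler_ln ?posrE ?mulr_gt0 ?expR_gt0//.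
  rewrite lnM ?posrE ?mulr_gt0 ?expR_gt0// lnM ?posrE ?expR_gt0// expRK.
  by rewrite lnV ?posrE ?exprn_gt0// lnXn// -[ln y *+ 2]mulr_natl; lra.
have ql : - ln 2 - (g y + 2 * ln y) <= ln (utail mu y).
  have := utail_ge ys; rewrite -ler_ln ?posrE ?mulr_gt0 ?expR_gt0//.
  rewrite lnM ?posrE ?mulr_gt0 ?expR_gt0// lnM ?posrE ?expR_gt0// expRK.
  by rewrite !lnV ?posrE ?exprn_gt0// lnXn// -[ln y *+ 2]mulr_natl; lra.
move: Ly; rewrite !ge_max => /and3P[L1 L2 L3].
set Q := g y + 2 * ln y in up lo qu ql.
have lyQ : ln y <= Q.
  have : 0 <= ln y by lra.
  rewrite /Q; lra.
have Q1 : B1 + 2 * ln 2 <= e / 2 * Q.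
  have -> : B1 + 2 * ln 2 = e / 2 * (2 / e * (B1 + 2 * ln 2)) by field; rewrite gt_eqF.
  by rewrite ler_pM2l ?(le_trans L1)//; lra.
have Q2 : B2 + 2 * ln 2 <= e / 2 * Q.
  have -> : B2 + 2 * ln 2 = e / 2 * (2 / e * (B2 + 2 * ln 2)) by field; rewrite gt_eqF.
  by rewrite ler_pM2l ?(le_trans L2)//; lra.
set p := ln (PAtau_gt X x) in up lo *; set q := ln (utail mu y) in qu ql *.
have qneg : q < 0 by lra.
have q'0 : 0 < - q by lra.
have -> : 1 - p / q = (p - q) / (- q) by field; rewrite lt_eqF.
rewrite normrM normfV (gtr0_norm q'0) ler_pdivrMr// ler_norml.
have el : 0 <= (1 - e) * ln 2 by rewrite mulr_ge0//; lra.
have el' : 0 <= e * ln 2 by rewrite mulr_ge0// ltW.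
have eq1 : e * (Q - ln 2) <= e * - q by rewrite ler_pM2l//; lra.
have eq2 : e * - q <= e * (Q + ln 2) by rewrite ler_pM2l//; lra.
apply/andP; split; lra.
Qed.

End Asymptotics.

Theorem theorem1 (d : measure_display) (T : measurableType d) (R : realType)
  (P : probability T R) (X : nat -> {RV P >-> R}) (a : R) (g : R -> R) :
  iid X ->
  0 < a ->
  P.-integrable setT (EFin \o X 0%N) ->
  ('E_P[X 0%N] = (- a)%:E)%E ->
  (X 0%N : T -> R) \in Lfun P 2%:E ->
  (* Fbar(x) ~ e^{-g(x)} x^{-2} *)
  (fun x => Fbar X x / (expR (- g x) * x ^- 2)) @ +oo --> (1:R) ->
  (* g continuously differentiable on (0, oo) *)
  (forall x, 0 < x -> derivable g x 1) ->
  {in `]0, +oo[, continuous (derive1 g)} ->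
  (* g nondecreasing for all sufficiently large x *)
  (exists x0, forall x y, x0 <= x -> x <= y -> g x <= g y) ->
  (* g(x)/x nonincreasing on (0, oo), tending to 0 *)
  (forall x y, 0 < x -> x <= y -> g y / y <= g x / x) ->
  (fun x => g x / x) @ +oo --> (0:R) ->
  [/\
   (* (i) *)
   (exists C, 0 < C /\
      \forall x \near +oo,
        PAtau_gt X x <=
          C * x `^ (4^-1) *
          expR (- (g (Num.sqrt (2 * a * x)) *
                   Num.sqrt (1 - 2 * C * g (Num.sqrt (2 * a * x))
                                   / (a * Num.sqrt (2 * a * x)))))),
   (* (ii) : liminf_{x -> oo} ratio >= E tau *)
   (forall eps, 0 < eps -> exists C, 0 < C /\
      forall c : R, (c%:E < Etau X)%E ->
        \forall x \near +oo,
          c <= PAtau_gt X x / Fbar X (Num.sqrt (2 * a * x) + C * x `^ (4^-1 + eps)))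
   &
   (* (iii) *)
   ((exists gamma0, 0 < gamma0 < 1 /\
       (forall x y, 0 < x -> x <= y -> g y / y `^ gamma0 <= g x / x `^ gamma0) /\
       (fun x => g x / x `^ gamma0) @ +oo --> (0:R)) ->
    (fun x => ln (PAtau_gt X x) / ln (Fbar X (Num.sqrt (2 * a * x)))) @ +oo --> (1:R))].
Proof.
move=> iidX a0 intX EX L2 tail_eq _ _ [x0 g_mono] g_ratio g_lim.
set mu := distribution P (X 0%N).
have mid : measurable_fun [set: R] (fun u : R => u%:E) by exact/measurable_EFinP.
have msq : measurable_fun [set: R] (fun u : R => (u ^+ 2)%:E).
  by apply/measurable_EFinP; exact: measurable_funX.
have int1 : mu.-integrable setT (fun u : R => u%:E).
  exact: (integrable_pushforward (measurable_funPT (X 0%N)) mid intX measurableT).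
have mean : (\int[mu]_u u%:E = (- a)%:E)%E.
  by rewrite integral_distribution// -EX unlock.
have int2 : mu.-integrable setT (fun u : R => (u ^+ 2)%:E).
  exact: (integrable_pushforward (measurable_funPT (X 0%N)) msq (Lfun2_integrable_sqr L2)
    measurableT).
have mom2 : (\int[mu]_u (u ^+ 2)%:E = (fine (\int[mu]_u (u ^+ 2)%:E))%:E)%E.
  by rewrite fineK//; exact: integrable_fin_num.
have FbarE s : Fbar X s = utail mu s.
  rewrite /Fbar /utail /mu /distribution /pushforward/=; congr (fine (P _)).
  by apply/seteqP; split=> w /=; rewrite in_itv/= andbT.
have g_small e : 0 < e -> exists y0, forall y, y0 <= y -> g y / y <= e.
  move=> e0; have /cvgrPdist_lt /(_ e e0)[M [_ hM]] := g_lim.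
  exists (M + 1) => y yM; have /hM : M < y by lra.
  by rewrite sub0r normrN => /ltW/(le_trans (ler_norm _)).
have g_ge0 x : 0 < x -> 0 <= g x.
  move=> xp; rewrite leNgt; apply/negP => gx.
  have e0 : 0 < - (g x / x) by rewrite oppr_gt0 pmulr_llt0// invr_gt0.
  have /cvgrPdist_lt /(_ _ e0)[M [_ hM]] := g_lim.
  have /hM : M < Num.max x (M + 1) by rewrite lt_max ltrDl ltr01 orbT.
  have : g (Num.max x (M + 1)) / Num.max x (M + 1) <= g x / x.
    by apply: g_ratio => //; rewrite le_max lexx.
  by rewrite sub0r normrN ltr_norml => h /andP[]; lra.
have [s0 [s0_gt0 hs0]] : exists s0, 0 < s0 /\ forall s, s0 <= s ->
    2^-1 * expR (- g s) * s ^- 2 <= utail mu s <= 2 * expR (- g s) * s ^- 2.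
  have h20 : 0 < 2^-1 :> R by lra.
  have /cvgrPdist_lt /(_ _ h20)[M [_ hM]] := tail_eq.
  exists (Num.max 1 (M + 1)); split=> [|s]; first by rewrite lt_max ltr01.
  rewrite ge_max => /andP[s1 sM]; have /hM : M < s by lra.
  have q0 : 0 < expR (- g s) * s ^- 2 by rewrite mulr_gt0 ?expR_gt0// invr_gt0 exprn_gt0; lra.
  rewrite FbarE ltr_norml => /andP[h1 h2]; rewrite -!mulrA.
  by apply/andP; split; [rewrite -ler_pdivlMr//|rewrite -ler_pdivrMr//]; lra.
have utail_le s : s0 <= s -> utail mu s <= 2 * expR (- g s) * s ^- 2.
  by move=> /hs0/andP[].
have utail_ge s : s0 <= s -> 2^-1 * expR (- g s) * s ^- 2 <= utail mu s.
  by move=> /hs0/andP[].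
have near_ge (Q : R -> Prop) : (exists x1, forall x, x1 <= x -> Q x) -> \forall x \near +oo, Q x.
  by move=> [x1 hx1]; exists x1; split; [exact: num_real|move=> x /ltW; exact: hx1].
split.
- have [C [C0 hC]] := upper_tail iidX a0 int1 mean int2 mom2 g_ge0 g_ratio g_small
    s0_gt0 utail_le.
  by exists C; split=> //; exact: near_ge.
- move=> eps eps0; exists 1; split=> // c cE; apply: near_ge.
  have [x1 hx1] := lower_tail iidX a0 int1 mean int2 mom2 g_ge0 s0_gt0
    utail_le utail_ge eps0 cE.
  by exists x1 => x /hx1; rewrite FbarE mul1r.
- move=> _; apply/cvgrPdist_le => e e0; apply: near_ge.
  have e'0 : 0 < Num.min e 1 by rewrite lt_min e0 ltr01.
  have e'1 : Num.min e 1 <= 1 by rewrite ge_min lexx orbT.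
  have [x1 hx1] := log_tail iidX a0 int1 mean int2 mom2 g_ge0 g_ratio g_small g_mono
    s0_gt0 utail_le utail_ge e'0 e'1.
  by exists x1 => x /hx1; rewrite FbarE => /le_trans; apply; rewrite ge_min lexx.
Qed.
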